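(* Let $T>0$, let $d\ge 1$ be an integer, let $\mathbb{T}^d=(\mathbb{R}/\mathbb{Z})^d$, and let $B_0\in C(\mathbb{T}^d,\mathbb{R}^d)'$ be a fixed initial condition. Then the set of all dissipative solutions $(B,P)$ on $[0,T]$ of the curve-shortening flow with initial data $B_0$ (as defined in the context), if it is not empty, is convex and compact for the weak-* topology of measures.
   Context: Notation. $C(\mathbb{T}^d,\mathbb{R}^d)'$ is the space of $\mathbb{R}^d$-valued (finite) Borel measures on $\mathbb{T}^d$, the dual of $C(\mathbb{T}^d,\mathbb{R}^d)$; the subscript $w^*$ means that it carries the weak-* topology. Likewise $C([0,T]\times\mathbb{T}^d,\mathbb{R}^d)'$ is the space of $\mathbb{R}^d$-valued Borel measures on $[0,T]\times\mathbb{T}^d$. For a vector-valued measure $B$, $|B|$ denotes its total variation measure (with respect to the Euclidean norm). For vectors, $a\cdot b$ is the Euclidean inner product and $a^2=a\cdot a$; $(a\cdot\nabla)=\sum_j a_j\partial_j$. $\|\cdot\|_\infty$ is the sup over $[0,T]\times\mathbb{T}^d$ of the Euclidean norm. An element $B\in C([0,T],C(\mathbb{T}^d,\mathbb{R}^d)'_{w^*})$ is identified with the measure $B(\theta)\,d\theta$ on $[0,T]\times\mathbb{T}^d$ when it is considered as a space-time measure; the weak-* topology of measures on pairs $(B,P)$ is that of pairs of $\mathbb{R}^d$-valued measures on $[0,T]\times\mathbb{T}^d$. Trial functions. Trial functions are triples $(b^*,v^*,A)$ of smooth (here: $C^1$) functions $[0,T]\times\mathbb{T}^d\to\mathbb{R}^d$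 with ${b^*}^2=1$ everywhere. For such $(b^*,v^* )$ set $$L_2=-\partial_\theta b^*-(v^*\cdot\nabla)b^*+(b^*\cdot\nabla)v^*+b^*{v^*}^2-b^*\,(b^*\cdot\nabla)(b^*\cdot v^* ),\qquad L_3=-v^*+(b^*\cdot\nabla)b^*.$$ The constants. The following are fixed once and for all. (1) Finite constants $K_1,K_2$ depending only on $T$ and $\int_{\mathbb{T}^d}|B_0|$. (2) For each $(b^*,v^* )$, a finite constant $c^*$ depending only on $(b^*,v^* )$, chosen such that at every $(\theta,x)\in[0,T]\times\mathbb{T}^d$ and for all $\beta\in\mathbb{R}^d\setminus\{0\}$, $p\in\mathbb{R}^d$, with $\rho=|\beta|$, $$\sum_{i,j}\frac{(\beta_i-\rho b^*_i)(\beta_j-\rho b^*_j)}{2\rho}(\partial_jv^*_i+\partial_iv^*_j)-\sum_{i,j}\frac{(\beta_i-\rho b^*_i)(p_j-\rho v^*_j)}{\rho}(\partial_jb^*_i-\partial_ib^*_j)+(\rho-\beta\cdot b^* )\big({v^*}^2-b^*\cdot\nabla(b^*\cdot v^* )\big)\le c^*(\rho-\beta\cdot b^* )+\frac{|p-\rho v^*|^2}{2\rho}.$$ Definition (dissipative solution). A pair $(B,P)$ with $B\in C([0,T],C(\mathbb{T}^d,\mathbb{R}^d)'_{w^*})$ and $P\in C([0,T]\times\mathbb{T}^d,\mathbb{R}^d)'$ is a dissipative solution of the curve-shortening flow with initial data $B_0$ if and only if: (i) $B(0)=B_0$ and $\nabla\cdot B=0$ in the sense of distributions; (ii) $B$ and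 $P$ are bounded, respectively, in $C^{1/2}([0,T],(C^1(\mathbb{T}^d))'_{w^*})$ and $C([0,T]\times\mathbb{T}^d,\mathbb{R}^d)'$ by $K_1$ and $K_2$; that is, $|\int\varphi\cdot dB(\theta)|\le K_1\|\varphi\|_{C^1}$ and $|\int\varphi\cdot d(B(\theta_1)-B(\theta_0))|\le K_1|\theta_1-\theta_0|^{1/2}\|\varphi\|_{C^1}$ for all $\varphi\in C^1(\mathbb{T}^d,\mathbb{R}^d)$ and $\theta,\theta_0,\theta_1\in[0,T]$, and the total variation of $P$ is at most $K_2$; (iii) for all $\lambda>0$, all $\theta\in[0,T]$, all trial functions $(b^*,v^*,A)$ with $\|A\|_\infty\le\lambda$ and ${b^*}^2=1$, and all $r\ge c^*+\frac{\lambda^2}{2}+\lambda\|v^*\|_\infty$, writing $\eta=|B|-B\cdot b^*$ (a measure on $\mathbb{T}^d$ at each time), $$e^{-r\theta}\int\eta(\theta)+\int_0^\theta e^{-r\sigma}\left[\int P\cdot(A-L_3)+\Big(r-c^*-\frac{A\cdot(A+2v^* )}{2}\Big)\eta-B\cdot\Big(L_2+b^*\frac{A\cdot(A+2v^* )}{2}\Big)\right](\sigma)\,d\sigma\le\int\eta(0).$$ Here all inner integrals are over $\mathbb{T}^d$, and the term involving $P$ means the integral of $e^{-r\sigma}(A-L_3)$ against the measure $P$ over $[0,\theta]\times\mathbb{T}^d$ (closed time interval). *)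

(* Defs.v *)
From HB Require Import structures.
From mathcomp Require Import all_boot all_order all_algebra.
From mathcomp Require Import all_classical all_reals all_analysis.

Set Implicit Arguments.
Unset Strict Implicit.
Unset Printing Implicit Defensive.

Import Order.TTheory GRing.Theory Num.Theory.
Import numFieldNormedType.Exports.

Local Open Scope classical_set_scope.
Local Open Scope ring_scope.
Local Open Scope quotient_scope.

Section euclidean.
Context {R : realType} {n : nat}.
Implicit Types u v : 'rV[R]_n.

Definition dotp u v : R := \sum_i u 0 i * v 0 i.

(* The library norm of 'rV[R]_n is the sup norm. *)
Definition enorm u : R := Num.sqrt (dotp u u).

End euclidean.

Section torus.
Context (R : realType) (d : nat).

Definition lattice_eq (x y : 'rV[R]_d) : bool :=
  [forall i, (x 0 i - y 0 i) \is a Num.int].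

Lemma lattice_eq_equiv : equiv_class_of lattice_eq.
Proof.
split=> [x|x y|y x z].
- by apply/forallP => i; rewrite subrr rpred0.
- by apply/forallP/forallP => h i; rewrite -opprB rpredN.
- move=> /forallP xy /forallP yz; apply/forallP => i.
  by rewrite -(subrKA (y 0 i)) rpredD.
Qed.

Canonical lattice_eq_rel := EquivRelPack lattice_eq_equiv.

Definition torus : Type := quotient_topology {eq_quot lattice_eq_rel}.

HB.instance Definition _ := PointedTopological.on torus.
HB.instance Definition _ := Quotient.on torus.

Definition torus_pi (y : 'rV[R]_d) : torus := \pi_torus y.

End torus.

HB.instance Definition _ (R : realType) (d : nat) :=
  Measurable.copy (torus R d) (g_sigma_algebraType (@open (torus R d))).

#[short(type=topMeasurableType)]
HB.structure Definition TopMeasurable d :=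
  {T of Topological T & Measurable d T}.

HB.instance Definition _ (R : realType) (d : nat) :=
  Topological.on (torus R d).
HB.saturate Real.sort.
HB.saturate prod.

Section vector_measures.
Context {R : realType} (n : nat) {disp : measure_display} {X : measurableType disp}.
Implicit Types (mu nu : set X -> 'rV[R]_n) (K A D : set X) (i : 'I_n).

Definition component mu i : set X -> \bar R := fun A => (mu A 0 i)%:E.

(* R^n-valued Borel measures on K, as set functions on the ambient space X that
   vanish off K. The last clause makes two measures that agree on measurable
   sets equal. *)
Record is_vmeasure K mu : Prop := IsVmeasure {
  vmeasure_set0 : mu set0 = 0 ;
  vmeasure_sigma_additive : forall i, semi_sigma_additive (component mu i) ;
  vmeasure_off : forall A, measurable A -> A `&` K = set0 -> mu A = 0 ;
  vmeasure_junk : forall A, ~ measurable A -> mu A = 0 }.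

Definition vmeasure_pred K : {pred set X -> 'rV[R]_n} :=
  fun mu => `[< is_vmeasure K mu >].

Lemma vmeasure_submod_closed K : submod_closed (vmeasure_pred K).
Proof.
split=> [|a mu nu].
  apply/asboolP; split=> // i F mF tF mUF.
  rewrite [X in _ --> X](_ : _ = 0%E); last by rewrite /component mxE.
  apply: cvg_near_cst; apply: nearW => k.
  by rewrite big1 // => j _; rewrite /component mxE.
move=> /asboolP Hmu /asboolP Hnu.
case: (Hmu) => mu0 muS muK muJ; case: (Hnu) => nu0 nuS nuK nuJ.
apply/asboolP; split.
- by change (a *: mu set0 + nu set0 = 0); rewrite mu0 nu0 scaler0 addr0.
- move=> i F mF tF mUF.
  rewrite (_ : (fun k => _) =
    ((fun k => a%:E * \sum_(0 <= j < k) component mu i (F j)) \+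
     (fun k => \sum_(0 <= j < k) component nu i (F j)))%E); last first.
    apply/funext => k /=.
    rewrite /component !sumEFin -EFinM -EFinD mulr_sumr -big_split /=.
    by congr (_%:E); apply: eq_bigr => j _; rewrite !mxE.
  rewrite (_ : component (a *: mu + nu) i (\bigcup_k F k) =
    (a%:E * component mu i (\bigcup_k F k) + component nu i (\bigcup_k F k))%E);
    last by rewrite /component -EFinM -EFinD !mxE.
  apply: cvgeD => //; last exact: nuS.
  by apply: cvgeZl => //; exact: muS.
- move=> A mA AK; change (a *: mu A + nu A = 0); by rewrite muK// nuK// scaler0 addr0.
- move=> A mA; change (a *: mu A + nu A = 0); by rewrite muJ// nuJ// scaler0 addr0.
Qed.

HB.instance Definition _ K := GRing.isSubmodClosed.Build R (set X -> 'rV[R]_n)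
  (vmeasure_pred K) (vmeasure_submod_closed K).

Definition vmeasure K : Type := {mu | mu \in vmeasure_pred K}.
HB.instance Definition _ K := [isSub of vmeasure K for @sval _ _].
HB.instance Definition _ K := [Choice of vmeasure K by <:].
HB.instance Definition _ K := [SubChoice_isSubLmodule of vmeasure K by <:].


HB.instance Definition _ K := GRing.SubLmodule.on (vmeasure K).


(* Total variation for the Euclidean norm. *)
Definition tv mu A : \bar R := ereal_sup [set s | exists k (F : 'I_k -> set X),
  [/\ forall j, measurable (F j), trivIset setT F,
      \bigcup_j F j `<=` A & s = (\sum_(j < k) enorm (mu (F j)))%:E]].

Lemma vmeasureP K (m : vmeasure K) : is_vmeasure K (val m).
Proof. exact/asboolP/(valP m). Qed.

Definition vcomp K (m : vmeasure K) i : set X -> \bar R := component (val m) i.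

Section vcomp_charge.
Context K (m : vmeasure K) i.

Let vcomp0 : vcomp m i set0 = 0%E.
Proof. by rewrite /vcomp /component (vmeasure_set0 (vmeasureP m)) mxE. Qed.

Let vcomp_fin A : measurable A -> vcomp m i A \is a fin_num.
Proof. by []. Qed.

Let vcomp_sigma_additive : semi_sigma_additive (vcomp m i).
Proof. exact: (vmeasure_sigma_additive (vmeasureP m)). Qed.

HB.instance Definition _ := isCharge.Build disp X R (vcomp m i)
  vcomp0 vcomp_fin vcomp_sigma_additive.
End vcomp_charge.
End vector_measures.

Section integral_against_charge.
Context {R : realType} {disp : measure_display} {X : measurableType disp}.

Lemma hahn_sig (nu : {charge set X -> \bar R}) :
  {PN : set X * set X | hahn_decomposition nu PN.1 PN.2}.
Proof.
by apply: cid; have [P [N h]] := Hahn_decomposition nu; exists (P, N).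
Qed.

Definition cint (nu : {charge set X -> \bar R}) (D : set X) (f : X -> R) : R :=
  \int[jordan_pos (svalP (hahn_sig nu))]_(x in D) f x
  - \int[jordan_neg (svalP (hahn_sig nu))]_(x in D) f x.
End integral_against_charge.

Section weak_star.
Context {R : realType} (n : nat) {disp : measure_display}
  {X : topMeasurableType disp}.

(* The integral over D of F . dm. *)
Definition vint (K : set X) (m : vmeasure n K) (D : set X) (F : X -> 'rV[R]_n) : R :=
  \sum_(i < n) cint (vcomp m i) D (fun x => F x 0 i).

(* The integral over D of f d|m|. *)
Definition tvint (K : set X) (m : vmeasure n K) (D : set X) (f : X -> R) : R :=
  fine (\int[tv (val m)]_(x in D) (f x)%:E)%E.

Definition test_fun (K : set X) : Type :=
  {F : X -> 'rV[R]_n | {within K, continuous F}}.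

Definition pairing (K : set X) (m : vmeasure n K) : {ptws test_fun K -> R} :=
  fun F => vint m K (sval F).

HB.instance Definition _ (K : set X) :=
  Topological.copy (vmeasure n K) (initial_topology (@pairing K)).
End weak_star.

Section differential_operators.
Context {R : realType} {d : nat}.
Local Notation torus := (torus R d).
Local Notation e_ j := (delta_mx 0 j : 'rV[R]_d).

Section target.
Context {W : normedModType R}.

(* Functions on the torus are differentiated through their periodic lift. *)
Definition partial (j : 'I_d) (f : torus -> W) (x : torus) : W :=
  'D_(e_ j) (f \o torus_pi (d := d)) (repr x).

Fixpoint Ck (k : nat) (f : torus -> W) : Prop :=
  continuous f /\
  (if k is k'.+1 then forall j : 'I_d,
     (forall y, derivable (f \o torus_pi (d := d)) y (e_ j)) /\
     Ck k' (partial j f)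
   else True).

Definition slab (T : R) : set (R * torus) := `[0, T]%classic `*` setT.

Definition xpartial (j : 'I_d) (f : R * torus -> W) (q : R * torus) : W :=
  partial j (fun x => f (q.1, x)) q.2.

Definition tquotient (f : R * torus -> W) (q : R * torus) (h : R) : W :=
  h^-1 *: (f (q.1 + h, q.2) - f q).

(* increments keeping the time in [0, T]: one-sided derivative at 0 and T *)
Definition tincr (T : R) (q : R * torus) : set_system R :=
  within [set h | q.1 + h \in `[0, T]] 0^'.

Definition tpartial (T : R) (f : R * torus -> W) (q : R * torus) : W :=
  lim (tquotient f q @ tincr T q).

Definition C1_slab (T : R) (f : R * torus -> W) : Prop :=
  [/\ {within slab T, continuous f},
      forall q, slab T q -> cvg (tquotient f q @ tincr T q),
      forall q j, slab T q ->
        derivable (fun y => f (q.1, torus_pi y)) (repr q.2) (e_ j),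
      {within slab T, continuous (tpartial T f)} &
      forall j, {within slab T, continuous (xpartial j f)}].

(* (a . nabla) f *)
Definition along (a : R * torus -> 'rV[R]_d) (f : R * torus -> W)
    (q : R * torus) : W :=
  \sum_j a q 0 j *: xpartial j f q.
End target.

Definition grad (f : torus -> R) (x : torus) : 'rV[R]_d :=
  \row_j partial j f x.

Definition sup_norm (T : R) (f : R * torus -> 'rV[R]_d) : R :=
  sup [set enorm (f q) | q in slab T].

Definition C1_norm (f : torus -> 'rV[R]_d) : R :=
  sup [set enorm (f x) | x in setT] +
  sup [set Num.sqrt (\sum_j enorm (partial j f x) ^+ 2) | x in setT].
End differential_operators.

Section dissipative_solutions.
Context {R : realType} {d : nat} (T : R).
Local Notation torus := (torus R d).
Local Notation field := (R * torus -> 'rV[R]_d).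
Local Notation M := (@vmeasure R d _ torus setT).
Local Notation MQ := (@vmeasure R d _ (R * torus)%type (slab T)).
Implicit Types (b v A : field) (m : M) (B : R -> M) (P mu : MQ).

Definition L2 b v : field := fun q =>
  - tpartial T b q - along v b q + along b v q
  + dotp (v q) (v q) *: b q
  - along b (fun q' => dotp (b q') (v q') : R^o) q *: b q.

Definition L3 b v : field := fun q => - v q + along b b q.

Definition trial b v :=
  [/\ C1_slab T b, C1_slab T v & forall q, slab T q -> dotp (b q) (b q) = 1].

Definition cstar_ineq b v (c : R) : Prop :=
  forall q (beta p : 'rV[R]_d), slab T q -> beta != 0 ->
  let rho := enorm beta in
  let D j (f : field) i : R := xpartial j f q 0 i in
  \sum_i \sum_j
    (beta 0 i - rho * b q 0 i) * (beta 0 j - rho * b q 0 j) / (2 * rho)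
      * (D j v i + D i v j)
  - \sum_i \sum_j
    (beta 0 i - rho * b q 0 i) * (p 0 j - rho * v q 0 j) / rho
      * (D j b i - D i b j)
  + (rho - dotp beta (b q))
      * (dotp (v q) (v q) - along b (fun q' => dotp (b q') (v q') : R^o) q)
  <= c * (rho - dotp beta (b q)) + enorm (p - rho *: v q) ^+ 2 / (2 * rho).

(* Fields on [0, T] x T^d are represented by fields on R x T^d, whence the
   first clause. *)
Definition cstar_spec (cstar : field -> field -> R) : Prop :=
  (forall b b' v v', {in slab T, b =1 b'} -> {in slab T, v =1 v'} ->
     cstar b v = cstar b' v') /\
  (forall b v, trial b v -> cstar_ineq b v (cstar b v)).

(* mu = B(theta) dtheta *)
Definition disintegrates mu B : Prop :=
  forall (S : set (R * torus)) i, measurable S ->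
    val mu S 0 i =
    \int[lebesgue_measure]_(t in `[0, T]) val (B t) (xsection S t) 0 i.

(* the integral of f d eta with eta = |m| - m . b *)
Definition etaint m (b : torus -> 'rV[R]_d) (f : torus -> R) : R :=
  tvint m setT f - vint m setT (fun x => f x *: b x).

Definition diss_ineq B P b v A (c r t : R) : Prop :=
  let w q := dotp (A q) (A q + 2 *: v q) / 2 in
  let at_ s (f : field) x := f (s, x) in
  expR (- r * t) * etaint (B t) (at_ t b) (fun=> 1)
  + vint P (`[0, t]%classic `*` setT)
      (fun q => expR (- r * q.1) *: (A q - L3 b v q))
  + \int[lebesgue_measure]_(s in `[0, t])
      (expR (- r * s) *
        (etaint (B s) (at_ s b) (fun x => r - c - w (s, x))
         - vint (B s) setT (fun x => L2 b v (s, x) + w (s, x) *: b (s, x))))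
  <= etaint (B 0) (at_ 0 b) (fun=> 1).

Record dissipative_solution (cstar : field -> field -> R) (K1 K2 : R)
    (B0 : M) B P : Prop := DissipativeSolution {
  diss_continuous : {within `[0, T], continuous B} ;
  diss_init : B 0 = B0 ;
  diss_div_free : forall t, t \in `[0, T] -> forall phi : torus -> R^o,
    (forall k, Ck k phi) -> vint (B t) setT (grad phi) = 0 ;
  diss_bound : forall t, t \in `[0, T] -> forall phi : torus -> 'rV[R]_d,
    Ck 1 phi -> `|vint (B t) setT phi| <= K1 * C1_norm phi ;
  diss_holder : forall t0 t1, t0 \in `[0, T] -> t1 \in `[0, T] ->
    forall phi : torus -> 'rV[R]_d, Ck 1 phi ->
    `|vint (B t1 - B t0) setT phi| <=
      K1 * Num.sqrt `|t1 - t0| * C1_norm phi ;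
  diss_tv : (tv (val P) (slab T) <= K2%:E)%E ;
  diss_dissipation : forall (lambda t : R) b v A (r : R),
    0 < lambda -> t \in `[0, T] -> trial b v -> C1_slab T A ->
    sup_norm T A <= lambda ->
    cstar b v + lambda ^+ 2 / 2 + lambda * sup_norm T v <= r ->
    diss_ineq B P b v A (cstar b v) r t }.

Definition solution_set (cstar : field -> field -> R) (K1 K2 : R) (B0 : M)
    : set (MQ * MQ) :=
  [set bp | exists2 B, disintegrates bp.1 B &
    dissipative_solution cstar K1 K2 B0 B bp.2].
End dissipative_solutions.

(* Main.v *)
Require Import Defs.
From HB Require Import structures.
From mathcomp Require Import all_boot all_order all_algebra.
From mathcomp Require Import all_classical all_reals all_analysis.
From mathcomp Require Import measurable_realfun ring lra.

Set Implicit Arguments.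
Unset Strict Implicit.
Unset Printing Implicit Defensive.

Import Order.TTheory GRing.Theory Num.Theory.
Import numFieldNormedType.Exports.

Local Open Scope classical_set_scope.
Local Open Scope ring_scope.

(** Why the theorem holds.

Except for the dissipation inequality, the conditions defining a solution
[(B, P)] are linear in [(B, P)] or bound the absolute value of a linear
expression. In the inequality, [B] also enters through its total variation,
with the weight [exp (- r t)] at the final time and with a multiple of
[r - c - A . (A + 2 v) / 2] inside the time integral, where [c] is the constant
of the trial fields [b] and [v]. The lower bound imposed on [r] makes the second
weight nonnegative, like the first. This sign is all that matters: the integral
of a nonnegative function against the total variation is convex in the measure
and lower semicontinuous for the weak-* topology, being a supremum of pairings
with continuous fields ([tvint_polar_cts]).

Convexity follows at once ([dissipates_comb], [solution_comb]).

For compactness, let solutions run along an ultrafilter ([compact_prod_ultra]).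

A constant unit field is a trial field for which the source terms vanish, and
the inequality for it bounds the mass of [B] at all times by a constant common
to all solutions ([solution_tv_bounded]). With this bound and the density of
continuously differentiable fields ([C1_dense]), the Hoelder estimate makes the
paths equicontinuous in time when they are tested against any continuous field
([solution_equicontinuous]).

Measures of bounded mass converge along an ultrafilter ([alaoglu]): the
integrals against the positive and negative parts of each component have limits,
and these limits are positive functionals, represented by measures
([riesz_integral]). This applies to [P] and to [B] at each time. By
equicontinuity the limit path is weakly continuous ([path_limit_cts]); hence it
disintegrates a measure on space-time ([path_disintegration]), to which the
space-time measures of the given paths converge ([vint_slice_limit]).

It remains to pass to the limit in the inequality ([dissipates_limit]). The
terms linear in [B] converge. The mass terms are lower semicontinuous; for their
time integrals, countably many fields suffice to recover the mass at all times
([mass_at_sup]), and finitely many to recover its integral up to a given error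
([mass_time_limit]). The term in [P] is an integral over the closed time
interval from 0 to [t], and is not weakly continuous. Averaging the inequalities
over slightly later times replaces this interval by a continuous cutoff, and the
remaining terms lose nothing when the averaging times return to [t] because they
are lower semicontinuous from the right ([cutoff_limit]).

The measure theory is done on compact sets whose Borel sets are generated by
their continuous functions ([baire]), which include the torus ([torus_baire])
and the slab of space-time ([slab_baire]). *)

(** * Bounded measurable functions and integration against charges *)

Section bounded_measurable.
Context {R : realType} {disp : measure_display} {X : measurableType disp}.
Implicit Types (D A : set X) (f g : X -> R) (a e M C : R).

Definition bm D f := measurable_fun D f /\ exists M : R, forall x, D x -> `|f x| <= M.

Lemma bm_cst D (a : R) : bm D (fun=> a).
Proof. by split=> //; exists `|a|. Qed.

Lemma bm_indic D A : measurable A -> bm D \1_A.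
Proof.
move=> mA; split; first exact: measurable_indic.
by exists 1 => x _; rewrite indicE; case: (x \in A); rewrite ?normr1 ?normr0.
Qed.

Lemma bmD D f g : bm D f -> bm D g -> bm D (fun x => f x + g x).
Proof.
move=> [mf [M fM]] [mg [N gN]]; split; first exact: measurable_funD.
by exists (M + N) => x Dx; rewrite (le_trans (ler_normD _ _))// lerD ?fM ?gN.
Qed.

Lemma bmM D f g : bm D f -> bm D g -> bm D (fun x => f x * g x).
Proof.
move=> [mf [M fM]] [mg [N gN]]; split; first exact: measurable_funM.
by exists (M * N) => x Dx; rewrite normrM ler_pM ?fM ?gN.
Qed.

Lemma bmZ D a f : bm D f -> bm D (fun x => a * f x).
Proof. by move=> bf; apply: bmM => //; exact: bm_cst. Qed.

Lemma bmN D f : bm D f -> bm D (fun x => - f x).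
Proof.
move=> bf; rewrite (_ : (fun x => - f x) = (fun x => -1 * f x)); first exact: bmZ.
by apply/funext => x; rewrite mulN1r.
Qed.

Lemma bmB D f g : bm D f -> bm D g -> bm D (fun x => f x - g x).
Proof. by move=> bf bg; apply: bmD => //; exact: bmN. Qed.

Lemma bm_sum (I : Type) (r : seq I) D (F : I -> X -> R) : (forall i, bm D (F i)) ->
  bm D (fun x => \sum_(i <- r) F i x).
Proof.
move=> bF; elim: r => [|i r IH].
  by under eq_fun do rewrite big_nil; exact: bm_cst.
by under eq_fun do rewrite big_cons; exact: bmD.
Qed.

Lemma bm_eq D f g : measurable D -> (forall x, D x -> f x = g x) -> bm D f -> bm D g.
Proof.
move=> mD fg [mf [M fM]]; split.
  by apply: eq_measurable_fun mf => x /set_mem Dx; exact: fg.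
by exists M => x Dx; rewrite -fg// fM.
Qed.

Lemma bm_sub D E f : measurable D -> measurable E -> E `<=` D -> bm D f -> bm E f.
Proof.
move=> mD mE ED [mf [M fM]]; split; first exact: measurable_funS mf.
by exists M => x /ED; exact: fM.
Qed.

Lemma bm_norm D f : bm D f -> bm D (fun x => `|f x|).
Proof.
move=> [mf [M fM]]; split; first exact: measurableT_comp.
by exists M => x Dx; rewrite normr_id fM.
Qed.

Lemma bm_integrable_lty (mu : {measure set X -> \bar R}) D f :
  measurable D -> (mu D < +oo)%E -> bm D f -> mu.-integrable D (EFin \o f).
Proof.
move=> mD muD [mf [M fM]]; apply: measurable_bounded_integrable => //.
exists M; split; first by rewrite num_real.
by move=> N MN x Dx /=; rewrite (le_trans (fM _ Dx))// ltW.
Qed.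

Lemma bm_integrable (mu : {finite_measure set X -> \bar R}) D f :
  measurable D -> bm D f -> mu.-integrable D (EFin \o f).
Proof.
by move=> mD; apply: bm_integrable_lty => //; rewrite ltey_eq fin_num_measure.
Qed.

(** Floors cut the range of a bounded function into finitely many cells. *)
Lemma bm_cells1 D f (e : R) : measurable D -> bm D f -> 0 < e ->
  exists (N : nat) (c : X -> 'I_N.+1) (u : 'I_N.+1 -> R),
    (forall i, measurable (D `&` c @^-1` [set i])) /\
    forall x, D x -> u (c x) <= f x <= u (c x) + e.
Proof.
move=> mD [mf [M fM]] e0.
pose g x := (f x + M) / e.
have g0 x : D x -> 0 <= g x.
  move=> Dx; rewrite divr_ge0 ?(ltW e0)//.
  by have := fM _ Dx; rewrite ler_norml => /andP[h _]; rewrite -lerBlDr sub0r.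
pose N := Num.truncn ((M + M) / e).
have gN x : D x -> (Num.truncn (g x) <= N)%N.
  move=> Dx; apply: le_truncn; rewrite ler_pM2r ?invr_gt0// lerD2r.
  by have := fM _ Dx; rewrite ler_norml => /andP[].
exists N, (fun x => inord (Num.truncn (g x))), (fun i => (i : nat)%:R * e - M); split.
  move=> i.
  have mg : measurable_fun D g.
    by apply: measurable_funM => //; apply: measurable_funD.
  rewrite (_ : _ `&` _ = D `&` g @^-1` `[(i : nat)%:R, (i : nat).+1%:R[%classic).
    exact: mg.
  apply/seteqP; split=> x [Dx] /=.
    move=> ix; split=> //; rewrite /= in_itv /=.
    rewrite -truncn_eq ?g0//.
    by rewrite -ix inordK// ltnS gN.
  rewrite in_itv/= -truncn_eq ?g0// => /eqP gi; split=> //.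
  by apply/val_inj; rewrite /= inordK ?gi.
move=> x Dx /=.
rewrite inordK ?ltnS ?gN//.
have /andP[h1 h2] := truncn_itv (g0 _ Dx).
rewrite lerBlDr -ler_pdivlMr// -/(g x) h1/=.
rewrite addrAC lerBrDr -[X in _ <= _ + X]mul1r -mulrDl natr1 -ler_pdivrMr//.
exact: ltW.
Qed.

Lemma sum_cells (I : finType) (V : lmodType R) D (c : X -> I) (u : I -> V) x :
  D x -> \sum_i \1_(D `&` c @^-1` [set i]) x *: u i = u (c x).
Proof.
move=> Dx; rewrite (bigD1 (c x))//= big1 ?addr0.
  by rewrite indicE mem_set ?scale1r.
move=> i ic; rewrite indicE memNset ?scale0r// => -[_ /= ci].
by rewrite ci eqxx in ic.
Qed.

Lemma bm_cells_bm (I : finType) D (c : X -> I) (u : I -> R) :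
  (forall i, measurable (D `&` c @^-1` [set i])) ->
  bm D (fun x => \sum_i \1_(D `&` c @^-1` [set i]) x *: u i).
Proof.
move=> mc; apply: (@bm_sum _ _ D (fun i x => \1_(D `&` c @^-1` [set i]) x *: u i)) => i.
by apply: bmM; [exact: bm_indic|exact: bm_cst].
Qed.

(** By [bm_cells1] a bounded measurable function is a uniform limit of
combinations of indicators. *)
Lemma bm_ind D (Q : (X -> R) -> Prop) : measurable D ->
  (forall A, measurable A -> A `<=` D -> Q \1_A) ->
  (forall a f g, bm D f -> bm D g -> Q f -> Q g -> Q (fun x => a * f x + g x)) ->
  (forall f, bm D f -> (forall e : R, 0 < e -> exists g, [/\ bm D g, Q g &
     forall x, D x -> `|f x - g x| <= e]) -> Q f) ->
  forall f, bm D f -> Q f.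
Proof.
move=> mD Q1 QD Ql f bf; apply: Ql => // e e0.
have [N [c [u [mc fu]]]] := bm_cells1 mD bf e0.
exists (fun x => \sum_i \1_(D `&` c @^-1` [set i]) x *: u i).
split; first exact: bm_cells_bm.
- have Q0 : Q (fun=> 0).
    rewrite (_ : (fun=> 0) = (\1_(@set0 X) : X -> R)); first exact: Q1.
    by apply/funext => x; rewrite indicE in_set0.
  suff h (r : seq 'I_N.+1) :
    Q (fun x => \sum_(i <- r) \1_(D `&` c @^-1` [set i]) x *: u i) by exact: h.
  elim: r => [|i r IH]; first by under eq_fun do rewrite big_nil.
  under eq_fun do rewrite big_cons [_ *: _]mulrC.
  apply: QD => //; first exact: bm_indic.
    by apply: bm_sum => j; apply: bmM; [exact: bm_indic|exact: bm_cst].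
  by apply: Q1 => //; exact: subIsetl.
- move=> x Dx; rewrite sum_cells//; have /andP[h1 h2] := fu _ Dx.
  by rewrite ger0_norm ?subr_ge0// lerBlDl.
Qed.

Lemma bm_Rintegral_sum (mu : {finite_measure set X -> \bar R}) D (I : Type) (r : seq I)
    (f : I -> X -> R) : measurable D -> (forall i, bm D (f i)) ->
  \int[mu]_(x in D) (\sum_(i <- r) f i x) = \sum_(i <- r) \int[mu]_(x in D) f i x.
Proof.
move=> mD bf; elim: r => [|i r IH].
  by under eq_Rintegral do rewrite big_nil; rewrite Rintegral_cst// mul0r big_nil.
under eq_Rintegral do rewrite big_cons.
rewrite RintegralD// ?IH ?big_cons//; apply: bm_integrable => //; exact: bm_sum.
Qed.

Lemma Rintegral_sup_le (mu : {finite_measure set X -> \bar R}) D f M :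
  measurable D -> bm D f -> (forall x, D x -> `|f x| <= M) ->
  `|\int[mu]_(x in D) f x| <= M * fine (mu D).
Proof.
move=> mD bf fM; rewrite -Rintegral_cst//.
apply: (le_trans (le_normr_Rintegral _ _)) => //; first exact: bm_integrable.
apply: le_Rintegral => //; apply: bm_integrable => //; last exact: bm_cst.
exact: bm_norm.
Qed.

(** ** Integration against a charge *)
Section charge_integral.
Variable nu : {charge set X -> \bar R}.
Local Notation jp := (jordan_pos (svalP (hahn_sig nu))).
Local Notation jn := (jordan_neg (svalP (hahn_sig nu))).

Lemma cintZD D a f g : measurable D -> bm D f -> bm D g ->
  cint nu D (fun x => a * f x + g x) = a * cint nu D f + cint nu D g.
Proof.
move=> mD bf bg.
have h (mu : {finite_measure set X -> \bar R}) :
    \int[mu]_(x in D) (a * f x + g x) =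
    a * \int[mu]_(x in D) f x + \int[mu]_(x in D) g x.
  rewrite RintegralD ?RintegralZl//; apply: bm_integrable => //.
  exact: bmZ.
by rewrite /cint !h; ring.
Qed.

Lemma cint0 D : cint nu D (fun=> 0) = 0.
Proof. by rewrite /cint /Rintegral !integral0 subr0. Qed.

Lemma cint_indic D A : measurable D -> measurable A ->
  cint nu D \1_A = fine (nu (A `&` D)).
Proof.
move=> mD mA; have mAD : measurable (A `&` D) by exact: measurableI.
rewrite /cint /Rintegral !integral_indic//.
rewrite (jordan_decomp (svalP (hahn_sig nu)) mAD).
rewrite cscaleN1 /cadd /= fineD ?fineN//; last first.
  by rewrite cscaleN1 fin_numN fin_num_measure.
- exact: fin_num_measure.
- by rewrite cscaleN1 fineN.
Qed.

Lemma cint_bound D f M : measurable D -> bm D f -> (forall x, D x -> `|f x| <= M) ->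
  `|cint nu D f| <= M * (fine (jp D) + fine (jn D)).
Proof.
move=> mD bf fM; rewrite /cint (le_trans (ler_normB _ _))// mulrDr.
by rewrite lerD// Rintegral_sup_le.
Qed.

Lemma eq_cint D f g : (forall x, D x -> f x = g x) -> cint nu D f = cint nu D g.
Proof.
by move=> fg; rewrite /cint; congr (_ - _); apply: eq_Rintegral => x /set_mem/fg.
Qed.

End charge_integral.

(** An instance of [bm_ind], by which integrals are compared through their values
on sets. It is the way around Hahn decompositions, which do not depend linearly
on the charge. *)
Lemma bm_functional_eq D (Phi Psi : (X -> R) -> R) C : measurable D ->
  (forall a f g, bm D f -> bm D g -> Phi (fun x => a * f x + g x) = a * Phi f + Phi g) ->
  (forall a f g, bm D f -> bm D g -> Psi (fun x => a * f x + g x) = a * Psi f + Psi g) ->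
  (forall f M, 0 <= M -> bm D f -> (forall x, D x -> `|f x| <= M) -> `|Phi f| <= M * C) ->
  (forall f M, 0 <= M -> bm D f -> (forall x, D x -> `|f x| <= M) -> `|Psi f| <= M * C) ->
  (forall A, measurable A -> A `<=` D -> Phi \1_A = Psi \1_A) ->
  forall f, bm D f -> Phi f = Psi f.
Proof.
move=> mD PhiD PsiD PhiC PsiC H1; apply: bm_ind => //.
  by move=> a f g bf bg; rewrite PhiD// PsiD// => -> ->.
move=> f bf fe; apply/eqP; rewrite -subr_eq0 -normr_le0; apply/ler_addgt0Pr => e e0.
rewrite add0r.
have C0 : 0 < `|C| + 1 by rewrite ltr_wpDl.
have e'0 : 0 < e / 2 / (`|C| + 1) by rewrite !divr_gt0.
have [g [bg gE fg]] := fe _ e'0.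
have hP (Th : (X -> R) -> R) :
    (forall a f g, bm D f -> bm D g -> Th (fun x => a * f x + g x) = a * Th f + Th g) ->
    (forall f M, 0 <= M -> bm D f -> (forall x, D x -> `|f x| <= M) -> `|Th f| <= M * C) ->
    `|Th g - Th f| <= e / 2.
  move=> ThD ThC.
  have -> : Th g - Th f = Th (fun x => -1 * f x + g x) by rewrite ThD// mulN1r addrC.
  apply: (@le_trans _ _ (e / 2 / (`|C| + 1) * C)).
    apply: ThC; [exact: ltW|by apply: bmD => //; exact: bmZ|].
    by move=> x Dx; rewrite mulN1r addrC distrC fg.
  rewrite (le_trans (ler_wpM2l (ltW e'0) (ler_norm C)))//.
  rewrite -[leLHS]mulrA ler_piMr ?divr_ge0 ?(ltW e0)//.
  by rewrite mulrC ler_pdivrMr// mul1r lerDl.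
rewrite (_ : Phi f - Psi f = (Psi g - Psi f) - (Phi g - Phi f)); last first.
  by rewrite gE; ring.
rewrite (le_trans (ler_normB _ _))// [e]splitr.
by apply: lerD; [exact: hP PsiD PsiC|exact: hP PhiD PhiC].
Qed.

End bounded_measurable.

(** * The Euclidean norm and integrals of vector fields *)

Section euclid.
Context {R : realType} {n : nat}.
Implicit Types (u v w : 'rV[R]_n) (a : R).

Lemma dotpC u v : dotp u v = dotp v u.
Proof. by apply: eq_bigr => i _; rewrite mulrC. Qed.

Lemma dotpDl u v w : dotp (u + v) w = dotp u w + dotp v w.
Proof. by rewrite -big_split; apply: eq_bigr => i _; rewrite mxE mulrDl. Qed.

Lemma dotpZl a u v : dotp (a *: u) v = a * dotp u v.
Proof. by rewrite mulr_sumr; apply: eq_bigr => i _; rewrite mxE mulrA. Qed.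

Lemma dotpNl u v : dotp (- u) v = - dotp u v.
Proof. by rewrite -scaleN1r dotpZl mulN1r. Qed.

Lemma dotpDr u v w : dotp u (v + w) = dotp u v + dotp u w.
Proof. by rewrite dotpC dotpDl !(dotpC u). Qed.

Lemma dotpZr a u v : dotp u (a *: v) = a * dotp u v.
Proof. by rewrite dotpC dotpZl dotpC. Qed.

Lemma dotp0l v : dotp 0 v = 0.
Proof. by rewrite -(scale0r 0) dotpZl mul0r. Qed.

Lemma dotp_ge0 u : 0 <= dotp u u.
Proof. by apply: sumr_ge0 => i _; rewrite -expr2 sqr_ge0. Qed.

Lemma enorm_ge0 u : 0 <= enorm u. Proof. exact: sqrtr_ge0. Qed.

Lemma enorm_sqr u : enorm u ^+ 2 = dotp u u.
Proof. by rewrite sqr_sqrtr// dotp_ge0. Qed.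

Lemma enormZ a u : enorm (a *: u) = `|a| * enorm u.
Proof. by rewrite /enorm dotpZl dotpZr mulrA -expr2 sqrtrM ?sqr_ge0// sqrtr_sqr. Qed.

Lemma enormN u : enorm (- u) = enorm u.
Proof. by rewrite -scaleN1r enormZ normrN1 mul1r. Qed.

Lemma enorm0 : enorm (0 : 'rV[R]_n) = 0.
Proof. by rewrite /enorm dotp0l sqrtr0. Qed.

Lemma enorm_comp u i : `|u 0 i| <= enorm u.
Proof.
rewrite -sqrtr_sqr ler_wsqrtr// /dotp (bigD1 i)//= -expr2 lerDl.
by apply: sumr_ge0 => j _; rewrite -expr2 sqr_ge0.
Qed.

Lemma enorm_eq0 u : enorm u = 0 -> u = 0.
Proof.
move=> u0; apply/rowP => i; rewrite mxE; apply/eqP; rewrite -normr_le0 -u0.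
exact: enorm_comp.
Qed.

(** Cauchy-Schwarz, from the nonnegativity of the square norm of
[|v| u - |u| v]. *)
Lemma dotp_le u v : dotp u v <= enorm u * enorm v.
Proof.
have [/enorm_eq0->|u0] := eqVneq (enorm u) 0.
  by rewrite dotp0l mulr_ge0// enorm_ge0.
have [/enorm_eq0->|v0] := eqVneq (enorm v) 0.
  by rewrite dotpC dotp0l mulr_ge0// enorm_ge0.
have uv0 : 0 < enorm u * enorm v by rewrite mulr_gt0// lt0r ?u0 ?v0 enorm_ge0.
have := dotp_ge0 (enorm v *: u - enorm u *: v).
rewrite dotpDl !dotpDr !dotpNl -!scaleNr !dotpZr !dotpZl -!enorm_sqr (dotpC v u).
set p := dotp u v; set a := enorm u in uv0 *; set b := enorm v in uv0 *.
by move=> h; rewrite -(ler_pM2l uv0); nra.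
Qed.

Lemma dotp_norm_le u v : `|dotp u v| <= enorm u * enorm v.
Proof. by rewrite ler_norml dotp_le lerNl -dotpNl -(enormN u) dotp_le. Qed.

Lemma enormD u v : enorm (u + v) <= enorm u + enorm v.
Proof.
rewrite -ler_sqr ?nnegrE ?addr_ge0 ?enorm_ge0// enorm_sqr sqrrD !enorm_sqr.
rewrite dotpDl !dotpDr (dotpC v u); have := dotp_le u v; lra.
Qed.

Lemma enorm_sum (I : Type) (r : seq I) (P : pred I) (F : I -> 'rV[R]_n) :
  enorm (\sum_(i <- r | P i) F i) <= \sum_(i <- r | P i) enorm (F i).
Proof.
elim/big_rec2 : _ => [|i x y _ h]; first by rewrite enorm0.
by rewrite (le_trans (enormD _ _))// lerD2l.
Qed.

Lemma enorm_le_sum u : enorm u <= \sum_i `|u 0 i|.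
Proof.
have s0 : 0 <= \sum_i `|u 0 i| by apply: sumr_ge0.
rewrite -ler_sqr ?nnegrE ?enorm_ge0// enorm_sqr expr2 mulr_suml.
apply: ler_sum => i _; rewrite -expr2 -real_normK ?num_real// expr2.
by rewrite ler_wpM2l// (bigD1 i)//= lerDl sumr_ge0.
Qed.

Lemma enorm_le_max u e : (forall i, `|u 0 i| <= e) -> enorm u <= n%:R * e.
Proof.
move=> ue; rewrite (le_trans (enorm_le_sum u))//.
rewrite (le_trans (ler_sum _ (fun i _ => ue i)))//.
by rewrite sumr_const card_ord mulr_natl.
Qed.

Lemma dotp_normalize u : dotp ((enorm u)^-1 *: u) u = enorm u.
Proof.
rewrite dotpZl -enorm_sqr; have [->|u0] := eqVneq (enorm u) 0.
  by rewrite expr0n mulr0.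
by rewrite expr2 mulKf.
Qed.

Lemma enorm_normalize u : enorm ((enorm u)^-1 *: u) <= 1.
Proof.
rewrite enormZ ger0_norm ?invr_ge0 ?enorm_ge0//.
by have [->|u0] := eqVneq (enorm u) 0; rewrite ?mulr0// mulVf.
Qed.

Lemma row_delta u : u = \sum_i u 0 i *: delta_mx 0 i.
Proof. exact: row_sum_delta. Qed.

End euclid.

Section vector_integral.
Context {R : realType} (n : nat) {disp : measure_display}
  {X : topMeasurableType disp} (K : set X).
Implicit Types (m : @vmeasure R n disp X K) (D A B : set X) (F G : X -> 'rV[R]_n) (a e : R)
  (u : 'rV[R]_n).

Definition bmv D F := forall i, bm D (fun x => F x 0 i).

Lemma bmv_cst D u : bmv D (fun=> u).
Proof. by move=> i; exact: bm_cst. Qed.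

Lemma bmvZf D (f : X -> R) F : bm D f -> bmv D F -> bmv D (fun x => f x *: F x).
Proof. by move=> bf bF i; under eq_fun do rewrite !mxE; exact: bmM. Qed.

Lemma bmv_sum (I : Type) (r : seq I) D (F : I -> X -> 'rV[R]_n) :
  (forall i, bmv D (F i)) -> bmv D (fun x => \sum_(i <- r) F i x).
Proof.
by move=> bF j; under eq_fun do rewrite summxE; apply: bm_sum => i; exact: bF.
Qed.

Lemma bmvD D F G : bmv D F -> bmv D G -> bmv D (fun x => F x + G x).
Proof. by move=> bF bG i; under eq_fun do rewrite !mxE; exact: bmD. Qed.

Lemma bmvN D F : bmv D F -> bmv D (fun x => - F x).
Proof. by move=> bF i; under eq_fun do rewrite !mxE; exact: bmN. Qed.

Lemma bmvB D F G : bmv D F -> bmv D G -> bmv D (fun x => F x - G x).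
Proof. by move=> bF bG; apply: bmvD => //; exact: bmvN. Qed.

Lemma bmv_sub D D' F : measurable D -> measurable D' -> D' `<=` D -> bmv D F -> bmv D' F.
Proof. by move=> mD mD' DD bF i; exact: bm_sub (bF i). Qed.

Lemma bmv_dotp D F G : bmv D F -> bmv D G -> bm D (fun x => dotp (F x) (G x)).
Proof.
move=> bF bG.
by apply: (@bm_sum _ _ _ _ _ D (fun i x => F x 0 i * G x 0 i)) => i; exact: bmM.
Qed.

Lemma bm_enorm D F : bmv D F -> bm D (fun x => enorm (F x)).
Proof.
move=> bF; have [mf [M fM]] := bmv_dotp bF bF; split.
  apply: (measurableT_comp _ mf); apply: continuous_measurable_fun.
  exact: sqrt_continuous.
exists (Num.sqrt `|M|) => x Dx.
rewrite ger0_norm ?enorm_ge0// ler_wsqrtr//.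
by rewrite (le_trans (ler_norm _))// (le_trans (fM _ Dx))// ler_norm.
Qed.

(** The cells of the coordinates are intersected. *)
Lemma bmv_cells D F e : measurable D -> bmv D F -> 0 < e ->
  exists (I : finType) (c : X -> I) (u : I -> 'rV[R]_n),
    (forall i, measurable (D `&` c @^-1` [set i])) /\
    forall x, D x -> forall i, `|F x 0 i - u (c x) 0 i| <= e.
Proof.
move=> mD bF e0.
have /choice[N hN] : forall i : 'I_n, exists N : nat, exists c : X -> 'I_N.+1,
    exists u : 'I_N.+1 -> R,
    (forall i, measurable (D `&` c @^-1` [set i])) /\
    forall x, D x -> u (c x) <= F x 0 i <= u (c x) + e.
  by move=> i; have [N [c [u h]]] := bm_cells1 mD (bF i) e0; exists N, c, u.
have {hN}[c [u cu]] : exists c : (forall i : 'I_n, X -> 'I_(N i).+1),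
    exists u : (forall i : 'I_n, 'I_(N i).+1 -> R), forall i,
    (forall j, measurable (D `&` c i @^-1` [set j])) /\
    forall x, D x -> u i (c i x) <= F x 0 i <= u i (c i x) + e.
  exists (fun i => projT1 (cid (hN i))).
  exists (fun i => projT1 (cid (projT2 (cid (hN i))))) => i.
  exact: (projT2 (cid (projT2 (cid (hN i))))).
exists {dffun forall i : 'I_n, 'I_(N i).+1}.
exists (fun x => finfun (fun i => c i x)).
exists (fun k : {dffun forall i : 'I_n, 'I_(N i).+1} => \row_i u i (k i)); split.
  move=> k.
  rewrite (_ : _ `&` _ = D `&` \bigcap_(i in [set: 'I_n]) (D `&` c i @^-1` [set k i])).
    apply: measurableI => //; apply: fin_bigcap_measurable => // i _.
    by case: (cu i).
  apply/seteqP; split => x [Dx].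
    by move=> /= <-; split=> // i _; split=> //=; rewrite ffunE.
  move=> h; split=> //=; apply/ffunP => i; rewrite ffunE.
  by have [] := h i I.
move=> x Dx i; rewrite mxE ffunE; have [_ /(_ x Dx)/andP[h1 h2]] := cu i.
by rewrite ger0_norm ?subr_ge0// lerBlDl.
Qed.

Lemma vm_setU m A B : measurable A -> measurable B -> A `&` B = set0 ->
  val m (A `|` B) = val m A + val m B.
Proof.
move=> mA mB AB; apply/rowP => i; rewrite mxE.
have := chargeU (vcomp m i) mA mB AB.
by move=> /(congr1 fine).
Qed.

Lemma vm_set0 m : val m set0 = 0.
Proof. exact: (vmeasure_set0 (vmeasureP m)). Qed.

Lemma vintZD m D a F G : measurable D -> bmv D F -> bmv D G ->
  vint m D (fun x => a *: F x + G x) = a * vint m D F + vint m D G.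
Proof.
move=> mD bF bG; rewrite /vint mulr_sumr -big_split /=; apply: eq_bigr => i _.
by under eq_fun do rewrite !mxE; exact: cintZD.
Qed.

Lemma eq_vint m D F G : (forall x, D x -> F x = G x) -> vint m D F = vint m D G.
Proof. by move=> FG; apply: eq_bigr => i _; apply: eq_cint => x /FG ->. Qed.

Lemma vint0 m D : vint m D (fun=> 0) = 0.
Proof.
rewrite /vint big1// => i _; under eq_fun do rewrite mxE; exact: cint0.
Qed.

Lemma vintZ m D a F : measurable D -> bmv D F ->
  vint m D (fun x => a *: F x) = a * vint m D F.
Proof.
move=> mD bF; rewrite -[RHS]addr0 -(vint0 m D) -vintZD//; last exact: bmv_cst.
by apply: eq_vint => x _; rewrite addr0.
Qed.

Lemma vintD m D F G : measurable D -> bmv D F -> bmv D G ->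
  vint m D (fun x => F x + G x) = vint m D F + vint m D G.
Proof.
move=> mD bF bG; rewrite -[in RHS](mul1r (vint m D F)) -vintZD//.
by apply: eq_vint => x _; rewrite scale1r.
Qed.

Lemma vintB m D F G : measurable D -> bmv D F -> bmv D G ->
  vint m D (fun x => F x - G x) = vint m D F - vint m D G.
Proof.
move=> mD bF bG; rewrite vintD//; last exact: bmvN.
congr (_ + _); rewrite -mulN1r -vintZ//.
by apply: eq_vint => x _; rewrite scaleN1r.
Qed.

Lemma vint_sum (I : Type) (r : seq I) m D (F : I -> X -> 'rV[R]_n) : measurable D ->
  (forall i, bmv D (F i)) ->
  vint m D (fun x => \sum_(i <- r) F i x) = \sum_(i <- r) vint m D (F i).
Proof.
move=> mD bF; elim: r => [|i r IH].
  by rewrite big_nil -[RHS](vint0 m D); apply: eq_vint => x _; rewrite big_nil.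
rewrite big_cons -IH -vintD//; last exact: bmv_sum.
by apply: eq_vint => x _; rewrite big_cons.
Qed.

Lemma vint_bound m D : measurable D -> exists2 C, 0 <= C &
  forall F M, bmv D F -> (forall x i, D x -> `|F x 0 i| <= M) -> `|vint m D F| <= M * C.
Proof.
move=> mD; pose C i := fine (jordan_pos (svalP (hahn_sig (vcomp m i))) D) +
  fine (jordan_neg (svalP (hahn_sig (vcomp m i))) D).
exists (\sum_i C i); first by apply: sumr_ge0 => i _; rewrite addr_ge0// fine_ge0.
move=> F M bF FM; rewrite (le_trans (ler_norm_sum _ _ _))// mulr_sumr.
by apply: ler_sum => i _; apply: cint_bound => // x Dx; exact: FM.
Qed.

Lemma vint_indic m D A u : measurable D -> measurable A -> A `<=` D ->
  vint m D (fun x => \1_A x *: u) = dotp u (val m A).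
Proof.
move=> mD mA AD; apply: eq_bigr => i _.
transitivity (cint (vcomp m i) D (fun x => u 0 i * \1_A x + 0)).
  by apply: eq_cint => x _; rewrite mxE mulrC addr0.
rewrite cintZD//; [|exact: bm_indic|exact: bm_cst].
by rewrite cint0 addr0 cint_indic// (_ : A `&` D = A)//; apply/setIidPl.
Qed.

Lemma vint_cells (I : finType) m D (c : X -> I) (u : I -> 'rV[R]_n) :
  measurable D -> (forall i, measurable (D `&` c @^-1` [set i])) ->
  vint m D (fun x => u (c x)) =
  \sum_i dotp (u i) (val m (D `&` c @^-1` [set i])).
Proof.
move=> mD mc.
rewrite (@eq_vint m D _ (fun x => \sum_i \1_(D `&` c @^-1` [set i]) x *: u i)).
  rewrite (@vint_sum _ _ m D (fun i x => \1_(D `&` c @^-1` [set i]) x *: u i))//.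
    by apply: eq_bigr => i _; rewrite vint_indic.
  by move=> i; apply: bmvZf; [exact: bm_indic|exact: bmv_cst].
by move=> x Dx; rewrite sum_cells.
Qed.

Lemma bmv_cells_bmv (I : finType) D (c : X -> I) (u : I -> 'rV[R]_n) :
  measurable D -> (forall i, measurable (D `&` c @^-1` [set i])) ->
  bmv D (fun x => u (c x)).
Proof.
move=> mD mc j.
apply: (@bm_eq _ _ _ D (fun x => \sum_i \1_(D `&` c @^-1` [set i]) x *: u i 0 j)) => //.
  by move=> x Dx; rewrite (@sum_cells R disp X I R^o).
exact: bm_cells_bm.
Qed.

(** The components are integrated through their Hahn decompositions, so linearity
in the measure is not visible in the definition; it holds on indicators. *)
Lemma vint_mZD a m1 m2 D F : measurable D -> bmv D F ->
  vint (a *: m1 + m2) D F = a * vint m1 D F + vint m2 D F.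
Proof.
move=> mD bF; rewrite /vint mulr_sumr -big_split/=; apply: eq_bigr => i _.
set nu := vcomp _ i.
pose J (nu : {charge set X -> \bar R}) := fine (jordan_pos (svalP (hahn_sig nu)) D) +
  fine (jordan_neg (svalP (hahn_sig nu)) D).
have J0 nu' : 0 <= J nu' by rewrite addr_ge0// fine_ge0.
apply: (@bm_functional_eq _ _ _ D (cint nu D)
  (fun f => a * cint (vcomp m1 i) D f + cint (vcomp m2 i) D f)
  (J nu + `|a| * J (vcomp m1 i) + J (vcomp m2 i))) => //.
- by move=> b f g bf bg; exact: cintZD.
- by move=> b f g bf bg; rewrite !cintZD//; ring.
- move=> f M M0 bf fM; rewrite (le_trans (cint_bound nu mD bf fM))// ler_wpM2l//.
  by rewrite -addrA lerDl addr_ge0// mulr_ge0.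
- move=> f M M0 bf fM.
  have hJ nu' : `|cint nu' D f| <= M * J nu' by exact: cint_bound.
  rewrite (le_trans (ler_normD _ _))// normrM.
  have := hJ (vcomp m1 i); have := hJ (vcomp m2 i).
  have := normr_ge0 a; have : 0 <= M * J nu by rewrite mulr_ge0.
  by move: (J nu) (J (vcomp m1 i)) (J (vcomp m2 i)) => j j1 j2; nra.
- by move=> A mA AD; rewrite !cint_indic//= !mxE.
Qed.

Lemma vint_mB m1 m2 D F : measurable D -> bmv D F ->
  vint (m1 - m2) D F = vint m1 D F - vint m2 D F.
Proof.
by move=> mD bF; rewrite addrC -scaleN1r vint_mZD// mulN1r addrC.
Qed.

Lemma vint_sub m D E F : D `<=` E -> vint m D F = vint m E (fun x => \1_D x *: F x).
Proof.
move=> DE; apply: eq_bigr => i _; rewrite /cint.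
have h (mu : {measure set X -> \bar R}) :
    \int[mu]_(x in D) F x 0 i = \int[mu]_(x in E) (\1_D x *: F x) 0 i.
  rewrite [LHS]Rintegral_mkcond [RHS]Rintegral_mkcond.
  congr (Rintegral _ _ _); apply/funext => x.
  rewrite /patch mxE indicE; case: ifPn => [/set_mem Dx|xD].
    by rewrite mem_set ?mul1r//; exact: DE.
  by rewrite mul0r; case: ifP.
by rewrite !h.
Qed.

End vector_integral.

(** * The total variation is a finite measure *)

Lemma cvg_sumr {R : realType} (I T : Type) (r : seq I) (F : set_system T)
    {FF : Filter F} (f : I -> T -> R) (l : I -> R) :
  (forall i, f i @ F --> l i) ->
  \sum_(i <- r) f i x @[x --> F] --> \sum_(i <- r) l i.
Proof.
move=> fl; elim: r => [|i r IH].
  by under eq_fun do rewrite big_nil; rewrite big_nil; exact: cvg_cst.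
by under eq_fun do rewrite big_cons; rewrite big_cons; exact: cvgD.
Qed.

Section total_variation.
Context {R : realType} (n : nat) {disp : measure_display}
  {X : topMeasurableType disp} (K : set X).
Implicit Types (m : @vmeasure R n disp X K) (D A B : set X) (e : R) (u : 'rV[R]_n).

Lemma tv_ge (I : finType) m (F : I -> set X) A :
  (forall i, measurable (F i)) -> trivIset setT F -> (forall i, F i `<=` A) ->
  ((\sum_i enorm (val m (F i)))%:E <= tv (val m) A)%E.
Proof.
move=> mF tF FA; apply: ereal_sup_ubound; exists #|I|, (fun j => F (enum_val j)).
split=> //.
- by move=> i j _ _ ij; apply: enum_val_inj; exact: tF ij.
- by move=> x [j _ Fx]; exact: FA Fx.
- by congr (_%:E); rewrite [LHS](reindex _ (onW_bij _ (enum_val_bij I))).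
Qed.

Lemma tv_approx m A (y : R) : (y%:E < tv (val m) A)%E ->
  exists k (F : 'I_k -> set X), [/\ forall j, measurable (F j), trivIset setT F,
    forall j, F j `<=` A & y < \sum_j enorm (val m (F j))].
Proof.
move=> /ereal_sup_gt[_ [k [F [mF tF FA ->]]]]; rewrite lte_fin => h.
by exists k, F; split=> // j x Fx; apply: FA; exists j.
Qed.

Lemma tv_ge0 m A : (0 <= tv (val m) A)%E.
Proof.
have := @tv_ge 'I_0 m (fun=> set0) A; rewrite big_ord0; apply=> // i; by case: i => [].
Qed.

Lemma tv_set0 m : tv (val m) set0 = 0%E.
Proof.
apply/eqP; rewrite eq_le tv_ge0 andbT; apply: ub_ereal_sup => _ [k [F [mF tF F0 ->]]].
rewrite lee_fin big1// => j _.
suff -> : F j = set0 by rewrite vm_set0 enorm0.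
by apply/seteqP; split=> // x Fx; apply: F0; exists j.
Qed.

Lemma tv_mono m A B : A `<=` B -> (tv (val m) A <= tv (val m) B)%E.
Proof.
move=> AB; apply: ub_ereal_sup => _ [k [F [mF tF FA ->]]].
by apply: tv_ge => // j x Fx; apply/AB/FA; exists j.
Qed.

Lemma enorm_le_tv m A : measurable A -> ((enorm (val m A))%:E <= tv (val m) A)%E.
Proof.
move=> mA; have := @tv_ge 'I_1 m (fun=> A) A; rewrite big_ord_recl big_ord0 addr0.
apply=> //.
- by move=> i j _ _ _; rewrite !ord1.
- by move=> i.
Qed.

(** The Euclidean norm is at most the sum of the absolute values of the
coordinates, and each component has finite Jordan parts. *)
Lemma tv_lty m A : (tv (val m) A < +oo)%E.
Proof.
pose J i A := fine (jordan_pos (svalP (hahn_sig (vcomp m i))) A) +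
  fine (jordan_neg (svalP (hahn_sig (vcomp m i))) A).
apply: (@le_lt_trans _ _ (\sum_i J i setT)%:E); last exact: ltry.
apply: ub_ereal_sup => _ [k [F [mF tF FA ->]]]; rewrite lee_fin.
apply: (@le_trans _ _ (\sum_(j < k) \sum_i `|val m (F j) 0 i|)).
  by apply: ler_sum => j _; exact: enorm_le_sum.
rewrite exchange_big /=; apply: ler_sum => i _.
apply: (@le_trans _ _ (\sum_(j < k) J i (F j))).
  apply: ler_sum => j _.
  have -> : val m (F j) 0 i = cint (vcomp m i) setT \1_(F j).
    by rewrite cint_indic// setIT.
  rewrite -(mul1r (J i _)).
  rewrite (_ : cint _ _ _ = cint (vcomp m i) (F j) \1_(F j)).
    apply: cint_bound => //; first exact: bm_indic.
    by move=> x Fx; rewrite indicE mem_set ?normr1.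
  by rewrite !cint_indic// setIT setIid.
have h (mu : {finite_measure set X -> \bar R}) :
    \sum_(j < k) fine (mu (F j)) <= fine (mu setT).
  rewrite -lee_fin -sumEFin fineK ?fin_num_measure//.
  under eq_bigr do rewrite fineK ?fin_num_measure//.
  rewrite -measure_bigsetU_ord//.
  apply: le_measure; rewrite ?inE//; exact: bigsetU_measurable.
by rewrite big_split /= lerD.
Qed.

Lemma tv_fin m A : tv (val m) A \is a fin_num.
Proof. by rewrite ge0_fin_numE ?tv_lty ?tv_ge0. Qed.

Lemma tv_superadd2 m A B : A `&` B = set0 ->
  (tv (val m) A + tv (val m) B <= tv (val m) (A `|` B))%E.
Proof.
move=> AB; apply/lee_addgt0Pr => e e0.
have e20 : 0 < e / 2 by rewrite divr_gt0.
have ap C : exists k (F : 'I_k -> set X), [/\ forall j, measurable (F j), trivIset setT F,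
    forall j, F j `<=` C & fine (tv (val m) C) - e / 2 < \sum_j enorm (val m (F j))].
  apply: tv_approx; rewrite EFinB fineK ?tv_fin// lteBlDr//.
  by rewrite -(fineK (tv_fin m C)) -EFinD lte_fin ltrDl.
have [k1 [F1 [mF1 tF1 F1A h1]]] := ap A.
have [k2 [F2 [mF2 tF2 F2B h2]]] := ap B.
pose F (j : 'I_k1 + 'I_k2) := match j with inl i => F1 i | inr i => F2 i end.
have : ((\sum_j enorm (val m (F j)))%:E <= tv (val m) (A `|` B))%E.
  apply: tv_ge.
  - by case.
  - move=> [i|i] [j|j] _ _ /= ij.
    + by rewrite (tF1 i j).
    + exfalso; case: ij => x [/F1A Ax /F2B Bx].
      by have : set0 x by rewrite -AB.
    + exfalso; case: ij => x [/F2B Bx /F1A Ax].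
      by have : set0 x by rewrite -AB.
    + by rewrite (tF2 i j).
  - by move=> [i|i] x /= Fx; [left; exact: F1A Fx|right; exact: F2B Fx].
rewrite big_sumType/= => h.
rewrite -(fineK (tv_fin m A)) -(fineK (tv_fin m B)) -(fineK (tv_fin m (A `|` B))).
move: h; rewrite -{1}(fineK (tv_fin m (A `|` B))) -!EFinD !lee_fin; lra.
Qed.

Lemma vm_cvg m (F : (set X)^nat) A i : measurable A -> (forall k, measurable (F k)) ->
  trivIset setT F ->
  \sum_(0 <= k < N) val m (A `&` F k) 0 i @[N --> \oo] -->
    val m (A `&` \bigcup_k F k) 0 i.
Proof.
move=> mA mF tF.
have := @vmeasure_sigma_additive _ _ _ _ _ _ (vmeasureP m) i (fun k => A `&` F k).
rewrite -setI_bigcupr => h.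
have {}h := h _ _ _.
have /fine_cvgP[_] := h (fun k => measurableI _ _ mA (mF k)) (trivIset_setIl (G := fun=> A) tF)
  (measurableI _ _ mA (bigcup_measurable (fun k _ => mF k))).
apply: cvg_trans; apply: near_eq_cvg; apply: nearW => N /=.
by rewrite /component sumEFin.
Qed.

(** One inequality is superadditivity. For the other one, each piece of a
partition of the union is cut by the sets of the sequence; countable additivity
is available for each coordinate only, hence an error term summed over
coordinates. *)
Lemma tv_sigma_additive m : semi_sigma_additive (tv (val m)).
Proof.
move=> F mF tF mUF.
set U := \bigcup_k F k.
have nd : nondecreasing_seq (fun N => \sum_(0 <= k < N) tv (val m) (F k))%E.
  by apply: ereal_nondecreasing_series => k _ _; exact: tv_ge0.
have cv := ereal_nondecreasing_cvgn nd.
rewrite (_ : tv (val m) U = ereal_sup (range (fun N => \sum_(0 <= k < N) tv (val m) (F k)))%E)//.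
apply/eqP; rewrite eq_le; apply/andP; split; last first.
  apply: ub_ereal_sup => _ [N _ <-].
  apply: (@le_trans _ _ (tv (val m) (\bigcup_(k < N) F k))); last first.
    by apply: tv_mono => x [k _ Fx]; exists k.
  elim: N => [|N IH]; first by rewrite big_geq ?tv_ge0.
  rewrite big_nat_recr//= bigcup_mkord big_ord_recr /= -bigcup_mkord.
  apply: (le_trans _ (tv_superadd2 _ _)); first by rewrite leeD2r.
  apply/seteqP; split=> // x [[k /= kN Fkx] FNx].
  by have := tF k N I I (ex_intro _ x (conj Fkx FNx)) => kE; rewrite kE ltnn in kN.
apply: ub_ereal_sup => _ [p [G [mG tG GU ->]]].
set S := ereal_sup _.
have S0 : (0 <= S)%E.
  by apply: ereal_sup_ubound; exists 0%N => //; rewrite big_geq.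
case: (leP +oo%E S) => [|Sy]; first by rewrite leye_eq => /eqP ->; rewrite leey.
rewrite -(fineK (x := S)) ?ge0_fin_numE// lee_fin -subr_le0.
(* the partial sums of F cut G_j, up to an error that vanishes componentwise *)
pose r N := \sum_(j < p) \sum_i
  `|val m (G j `&` U) 0 i - \sum_(0 <= k < N) val m (G j `&` F k) 0 i|.
have r0 : r N @[N --> \oo] --> 0.
  rewrite -[X in _ --> X](_ : \sum_(j < p) \sum_(i < n) 0 = 0); last first.
    by rewrite big1// => j _; rewrite big1.
  apply: cvg_sumr => j; apply: cvg_sumr => i.
  rewrite [X in _ --> X](_ : 0 = `|val m (G j `&` U) 0 i - val m (G j `&` U) 0 i|);
    last by rewrite subrr normr0.
  by apply: cvg_norm; apply: cvgB; [exact: cvg_cst|exact: vm_cvg].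
suff h N : \sum_(j < p) enorm (val m (G j)) - fine S <= r N.
  by apply: (cvgr_to_ge r0); exact: nearW.
rewrite lerBlDr.
have -> : \sum_(j < p) enorm (val m (G j)) = \sum_(j < p) enorm (val m (G j `&` U)).
  apply: eq_bigr => j _; congr (enorm (val m _)); apply/esym/setIidPl.
  by move=> x Gx; apply: GU; exists j.
apply: (@le_trans _ _ (r N + \sum_(j < p) \sum_(0 <= k < N) enorm (val m (G j `&` F k)))).
  rewrite -big_split /=; apply: ler_sum => j _.
  set u := \sum_(0 <= k < N) val m (G j `&` F k).
  rewrite -{1}(subrK u (val m (G j `&` U))) (le_trans (enormD _ _))// lerD ?enorm_sum//.
  rewrite (le_trans (enorm_le_sum _))//; apply: ler_sum => i _.
  by rewrite !mxE summxE.
rewrite lerD2l exchange_big/= -lee_fin fineK ?ge0_fin_numE//.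
apply: (@le_trans _ _ (\sum_(0 <= k < N) tv (val m) (F k))%E); last first.
  by apply: ereal_sup_ubound; exists N.
rewrite -sumEFin; apply: lee_sum => k _; apply: tv_ge.
- by move=> j; exact: measurableI.
- exact: trivIset_setIr.
- by move=> j; exact: subIsetr.
Qed.

HB.instance Definition _ m := isMeasure.Build _ X R (tv (val m))
  (tv_set0 m) (tv_ge0 m) (@tv_sigma_additive m).

Let tv_finite m : fin_num_fun (tv (val m)).
Proof. by move=> A _; exact: tv_fin. Qed.

HB.instance Definition _ m := @Measure_isFinite.Build _ X R (tv (val m)) (@tv_finite m).

Definition tvr m A : R := fine (tv (val m) A).

End total_variation.

(** * Duality between vector fields and the total variation *)

Section tv_integral.
Context {R : realType} (n : nat) {disp : measure_display}
  {X : topMeasurableType disp} (K : set X).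
Implicit Types (m : @vmeasure R n disp X K) (D A B : set X) (e : R) (u : 'rV[R]_n)
  (f g : X -> R) (F G : X -> 'rV[R]_n).

Lemma tvintE m D f : tvint m D f = \int[tv (val m)]_(x in D) f x.
Proof. by []. Qed.

Lemma tvr_ge0 m A : 0 <= tvr m A.
Proof. by rewrite fine_ge0// tv_ge0. Qed.

Lemma tvint_le m D f g : measurable D -> bm D f -> bm D g ->
  (forall x, D x -> f x <= g x) -> tvint m D f <= tvint m D g.
Proof. by move=> mD bf bg fg; apply: le_Rintegral => //; exact: bm_integrable. Qed.

Lemma tvint_cst m D (a : R) : measurable D -> tvint m D (fun=> a) = a * tvr m D.
Proof. by move=> mD; rewrite tvintE Rintegral_cst. Qed.

Lemma tvintD m D f g : measurable D -> bm D f -> bm D g ->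
  tvint m D (fun x => f x + g x) = tvint m D f + tvint m D g.
Proof. by move=> mD bf bg; rewrite !tvintE RintegralD//; exact: bm_integrable. Qed.

Lemma tvintZ m D (a : R) f : measurable D -> bm D f ->
  tvint m D (fun x => a * f x) = a * tvint m D f.
Proof. by move=> mD bf; rewrite !tvintE RintegralZl//; exact: bm_integrable. Qed.

Lemma tvint_ge0 m D f : (forall x, D x -> 0 <= f x) -> 0 <= tvint m D f.
Proof. by move=> f0; rewrite tvintE Rintegral_ge0. Qed.

Lemma tvint_sum (I : Type) (r : seq I) m D (f : I -> X -> R) : measurable D ->
  (forall i, bm D (f i)) ->
  tvint m D (fun x => \sum_(i <- r) f i x) = \sum_(i <- r) tvint m D (f i).
Proof. by move=> mD bf; rewrite tvintE bm_Rintegral_sum. Qed.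

Lemma eq_tvint m D f g : (forall x, D x -> f x = g x) -> tvint m D f = tvint m D g.
Proof. by move=> fg; rewrite !tvintE; apply: eq_Rintegral => x /set_mem/fg. Qed.

Lemma tvint_cells (I : finType) m D (c : X -> I) (u : I -> R) : measurable D ->
  (forall i, measurable (D `&` c @^-1` [set i])) ->
  tvint m D (fun x => u (c x)) = \sum_i u i * tvr m (D `&` c @^-1` [set i]).
Proof.
move=> mD mc.
rewrite (@eq_tvint m D _ (fun x => \sum_i u i * \1_(D `&` c @^-1` [set i]) x)).
  rewrite (@tvint_sum _ _ m D (fun i x => u i * \1_(D `&` c @^-1` [set i]) x))//.
    apply: eq_bigr => i _; rewrite tvintZ//; last exact: bm_indic.
    by rewrite tvintE /Rintegral integral_indic// setIAC setIid.
  by move=> i; apply: bmZ; exact: bm_indic.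
move=> x Dx; under eq_bigr do rewrite mulrC.
by rewrite (@sum_cells R disp X I R^o).
Qed.

(** For fields constant on the cells of a finite partition this is the
Cauchy-Schwarz inequality on each cell, and bounded measurable fields are uniform limits of these. *)
Lemma vint_le_tvint m D F : measurable D -> bmv D F ->
  `|vint m D F| <= tvint m D (fun x => enorm (F x)).
Proof.
move=> mD bF; have [C C0 hC] := vint_bound m mD.
apply/ler_addgt0Pr => e e0.
pose d := e / (C + n%:R * tvr m D + 1).
have den0 : 0 < C + n%:R * tvr m D + 1.
  by rewrite ltr_wpDl// addr_ge0// mulr_ge0// tvr_ge0.
have d0 : 0 < d by rewrite divr_gt0.
have [I [c [u [mc cu]]]] := bmv_cells mD bF d0.
have bs : bmv D (fun x => u (c x)) by exact: bmv_cells_bmv.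
have bFs : bmv D (fun x => F x - u (c x)) by exact: bmvB.
have h1 : `|vint m D F - vint m D (fun x => u (c x))| <= d * C.
  rewrite -vintB//; apply: hC => // x i Dx.
  by rewrite !mxE; exact: cu.
have h2 : `|vint m D (fun x => u (c x))| <= tvint m D (fun x => enorm (u (c x))).
  rewrite vint_cells// (@tvint_cells _ _ D c (fun i => enorm (u i)))//.
  rewrite (le_trans (ler_norm_sum _ _ _))//; apply: ler_sum => i _.
  rewrite (le_trans (dotp_norm_le _ _))// ler_wpM2l ?enorm_ge0//.
  by rewrite -lee_fin fineK ?tv_fin// enorm_le_tv.
have h3 : tvint m D (fun x => enorm (u (c x))) <=
    tvint m D (fun x => enorm (F x)) + n%:R * d * tvr m D.
  rewrite -tvint_cst// -tvintD//; [|exact: bm_enorm|exact: bm_cst].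
  apply: tvint_le => //; first exact: bm_enorm.
    by apply: bmD; [exact: bm_enorm|exact: bm_cst].
  move=> x Dx; rewrite -{1}(subrK (F x) (u (c x))) (le_trans (enormD _ _))//.
  rewrite addrC lerD2l; apply: enorm_le_max => i.
  by rewrite !mxE distrC cu.
have : d * (C + n%:R * tvr m D + 1) = e by rewrite divfK// gt_eqF.
have := ler_normD (vint m D F - vint m D (fun x => u (c x))) (vint m D (fun x => u (c x))).
rewrite subrK; have := ltW d0; nra.
Qed.

Lemma vint_le_enorm1 m D f G : measurable D -> bm D f -> bmv D G ->
  (forall x, D x -> 0 <= f x) -> (forall x, D x -> enorm (G x) <= 1) ->
  vint m D (fun x => f x *: G x) <= tvint m D f.
Proof.
move=> mD bf bG f0 G1; rewrite (le_trans (ler_norm _))//.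
rewrite (le_trans (vint_le_tvint _ _ _))//; first exact: bmvZf.
apply: tvint_le => //; first by apply: bm_enorm; exact: bmvZf.
by move=> x Dx; rewrite enormZ ger0_norm ?f0// ler_piMr ?f0 ?G1.
Qed.

(** On each piece of a nearly optimal partition, [G] is the direction of the
measure of that piece. *)
Lemma tv_set_polar m D A e : measurable D -> measurable A -> A `<=` D -> 0 < e ->
  exists G, [/\ bmv D G, forall x, enorm (G x) <= 1 &
    tvr m A - e <= vint m D (fun x => \1_A x *: G x)].
Proof.
move=> mD mA AD e0.
have [k [F [mF tF FA hF]]] : exists k (F : 'I_k -> set X), [/\ forall j, measurable (F j),
    trivIset setT F, forall j, F j `<=` A & tvr m A - e < \sum_j enorm (val m (F j))].
  apply: tv_approx; rewrite EFinB fineK ?tv_fin//.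
  by rewrite -(fineK (tv_fin m A)) -EFinB lte_fin gtrBl.
pose w j := (enorm (val m (F j)))^-1 *: val m (F j).
exists (fun x => \sum_j \1_(F j) x *: w j).
have bG : bmv D (fun x => \sum_j \1_(F j) x *: w j).
  apply: (@bmv_sum _ _ _ _ _ _ _ (fun j x => \1_(F j) x *: w j)) => j.
  by apply: bmvZf; [exact: bm_indic|exact: bmv_cst].
split=> //.
- move=> x; have [[j Fx]|nF] := pselect (exists j, F j x).
    rewrite (bigD1 j)//= big1 ?addr0; first by rewrite indicE mem_set// scale1r enorm_normalize.
    move=> i ij; rewrite indicE memNset ?scale0r// => Fix.
    by move/eqP: ij; apply; apply: tF => //; exists x.
  rewrite big1 ?enorm0// => j _; rewrite indicE memNset ?scale0r// => Fx.
  by apply: nF; exists j.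
- rewrite (le_trans (ltW hF))//.
  rewrite (@eq_vint _ _ _ _ _ m D _ (fun x => \sum_j \1_(F j) x *: w j)).
    rewrite (@vint_sum _ _ _ _ _ _ _ m D (fun j x => \1_(F j) x *: w j))//.
      apply: ler_sum => j _; rewrite vint_indic//; last exact: subset_trans (FA j) AD.
      by rewrite dotp_normalize.
    by move=> j; apply: bmvZf; [exact: bm_indic|exact: bmv_cst].
  move=> x Dx; rewrite scaler_sumr; apply: eq_bigr => j _; rewrite scalerA !indicE.
  have [Fx|nFx] := pselect (F j x); last by rewrite (memNset nFx) mulr0.
  by rewrite (mem_set Fx) (mem_set (FA _ _ Fx)) mul1r.
Qed.

(** With [vint_le_enorm1], this makes the integral of [f] against the total
variation the supremum of [vint m D (f *: G)] over fields [G] with values in the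
unit ball. On cells where [f] is almost constant it reduces to [tv_set_polar]. *)
Lemma tvint_polar m D f e : measurable D -> bm D f -> (forall x, D x -> 0 <= f x) ->
  0 < e -> exists G, [/\ bmv D G, forall x, D x -> enorm (G x) <= 1 &
    tvint m D f - e <= vint m D (fun x => f x *: G x)].
Proof.
move=> mD bf f0 e0.
pose d := e / (2 * (2 * tvr m D + 1)).
have d0 : 0 < d by rewrite divr_gt0// mulr_gt0// ltr_wpDl// mulr_ge0// tvr_ge0.
have [N [c [u0 [mc cu0]]]] := bm_cells1 mD bf d0.
pose u i := Num.max (u0 i) 0.
have u_ge0 i : 0 <= u i by rewrite le_max lexx orbT.
have cu x : D x -> u (c x) <= f x <= u (c x) + d.
  move=> Dx; have /andP[h1 h2] := cu0 _ Dx.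
  by rewrite ge_max h1 f0//= (le_trans h2)// lerD2r le_max lexx.
pose A i := D `&` c @^-1` [set i].
(* the error on the i-th cell is multiplied by u i, hence the factor u i + 1 *)
pose d' i := e / (2 * N.+1%:R * (u i + 1)).
have d'0 i : 0 < d' i by rewrite divr_gt0// !mulr_gt0// ltr_wpDl.
have /choice[G hG] : forall i, exists G, [/\ bmv D G, forall x, enorm (G x) <= 1 &
    tvr m (A i) - d' i <= vint m D (fun x => \1_(A i) x *: G x)].
  by move=> i; apply: tv_set_polar => //; [exact: mc|exact: subIsetl].
have bA i : bmv D (fun x => \1_(A i) x *: G i x).
  by apply: bmvZf; [apply: bm_indic; exact: mc|case: (hG i)].
pose H x := \sum_i \1_(A i) x *: G i x.
have HE x : D x -> H x = G (c x) x by exact: (sum_cells c (G ^~ x)).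
have bH : bmv D H by exact: bmv_sum.
have H1 x : D x -> enorm (H x) <= 1 by move=> Dx; rewrite HE//; case: (hG (c x)).
exists H; split=> //.
have bu : bm D (fun x => u (c x)).
  apply: (@bm_eq _ _ _ D (fun x => \sum_i \1_(A i) x *: u i)) => //.
    by move=> x Dx; rewrite (@sum_cells R disp X _ R^o).
  exact: bm_cells_bm.
have h1 : vint m D (fun x => f x *: H x) = vint m D (fun x => u (c x) *: H x) +
    vint m D (fun x => (f x - u (c x)) *: H x).
  rewrite -vintD//; [|exact: bmvZf|by apply: bmvZf => //; exact: bmB].
  by apply: eq_vint => x _; rewrite -scalerDl addrC subrK.
have h2 : - (d * tvr m D) <= vint m D (fun x => (f x - u (c x)) *: H x).
  rewrite lerNl -tvint_cst//.
  have bfu : bm D (fun x => f x - u (c x)) by exact: bmB.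
  apply: (@le_trans _ _ `|vint m D (fun x => (f x - u (c x)) *: H x)|).
    by rewrite -normrN ler_norm.
  rewrite (le_trans (vint_le_tvint _ _ _))//; first exact: bmvZf.
  apply: tvint_le => //; [by apply: bm_enorm; exact: bmvZf|exact: bm_cst|].
  move=> x Dx; rewrite enormZ; have /andP[k1 k2] := cu _ Dx.
  by rewrite ger0_norm ?subr_ge0// -[leRHS]mulr1 ?ler_pM ?enorm_ge0 ?subr_ge0 ?H1// lerBlDl.
have h3 : \sum_i u i * (tvr m (A i) - d' i) <= vint m D (fun x => u (c x) *: H x).
  rewrite (@eq_vint _ _ _ _ _ m D _ (fun x => \sum_i u i *: (\1_(A i) x *: G i x))).
    rewrite (@vint_sum _ _ _ _ _ _ _ m D (fun i x => u i *: (\1_(A i) x *: G i x)))//.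
      apply: ler_sum => i _; rewrite vintZ//; apply: ler_wpM2l => //.
      by case: (hG i).
    by move=> i; apply: bmvZf => //; exact: bm_cst.
  move=> x Dx; rewrite HE//; under eq_bigr do rewrite scalerA mulrC -scalerA.
  by rewrite (sum_cells c (fun i => u i *: G i x)).
have h4 : tvint m D f <= \sum_i u i * tvr m (A i) + d * tvr m D.
  rewrite -tvint_cells// -tvint_cst// -tvintD//; last exact: bm_cst.
  apply: tvint_le => //; first by apply: bmD => //; exact: bm_cst.
  by move=> x Dx; have /andP[] := cu _ Dx.
have h5 : \sum_i u i * d' i <= e / 2.
  apply: (@le_trans _ _ (\sum_(i < N.+1) e / 2 / N.+1%:R)).
    apply: ler_sum => i _; rewrite /d' !invfM mulrC -!mulrA.
    rewrite !ler_wpM2l ?invr_ge0// ?(ltW e0)// -[leRHS]mulr1 ler_wpM2l ?invr_ge0//.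
    by rewrite mulrC ler_pdivrMr ?ltr_wpDl// mul1r lerDl.
  by rewrite sumr_const card_ord -[leLHS]mulr_natr divfK// pnatr_eq0.
have h6 : 2 * (d * tvr m D) <= e / 2.
  have -> : e / 2 = d * (2 * tvr m D + 1).
    rewrite /d invfM !mulrA mulfVK//; have := tvr_ge0 m D; lra.
  nra.
move: h3; under eq_bigr do rewrite mulrBr; rewrite sumrB => h3.
rewrite h1; lra.
Qed.

End tv_integral.

(** * Compact sets whose Borel sets come from continuous functions *)

Section bounded_convergence.
Context {R : realType} {disp : measure_display} {X : measurableType disp}.
Implicit Types (D : set X) (M : R).

Lemma bm_cvg D (f_ : nat -> X -> R) f M :
  (forall k, measurable_fun D (f_ k)) -> (forall k x, D x -> `|f_ k x| <= M) ->
  (forall x, D x -> f_ k x @[k --> \oo] --> f x) -> bm D f.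
Proof.
move=> mf fM ff; split; first exact: measurable_fun_cvg mf ff.
exists M => x Dx; apply: (cvgr_to_le (cvg_norm (ff x Dx))).
by apply: nearW => k; exact: fM.
Qed.

Lemma Rintegral_bounded_cvg_lty (mu : {measure set X -> \bar R}) D
    (f_ : nat -> X -> R) f M : measurable D -> (mu D < +oo)%E ->
  (forall k, measurable_fun D (f_ k)) -> (forall k x, D x -> `|f_ k x| <= M) ->
  (forall x, D x -> f_ k x @[k --> \oo] --> f x) ->
  \int[mu]_(x in D) f_ k x @[k --> \oo] --> \int[mu]_(x in D) f x.
Proof.
move=> mD muD mf fM ff.
have bf := bm_cvg mf fM ff.
have [] := @dominated_convergence _ X R mu D mD (fun k x => (f_ k x)%:E)
  (EFin \o f) (fun=> M%:E).
- by move=> k; exact/measurable_EFinP.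
- by apply/measurable_EFinP; case: bf.
- by apply: aeW => x Dx; apply: cvg_EFin; [exact: nearW|exact: ff].
- by apply: (bm_integrable_lty mD muD); exact: bm_cst.
- by apply: aeW => x k Dx; rewrite lee_fin fM.
move=> intf _ h; apply: fine_cvg; rewrite fineK; first exact: h.
exact: integrable_fin_num.
Qed.

Lemma Rintegral_bounded_cvg (mu : {finite_measure set X -> \bar R}) D
    (f_ : nat -> X -> R) f M : measurable D ->
  (forall k, measurable_fun D (f_ k)) -> (forall k x, D x -> `|f_ k x| <= M) ->
  (forall x, D x -> f_ k x @[k --> \oo] --> f x) ->
  \int[mu]_(x in D) f_ k x @[k --> \oo] --> \int[mu]_(x in D) f x.
Proof.
move=> mD; apply: Rintegral_bounded_cvg_lty => //.
by rewrite ltey_eq fin_num_measure.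
Qed.

Lemma cint_bounded_cvg (nu : {charge set X -> \bar R}) D
    (f_ : nat -> X -> R) f M : measurable D ->
  (forall k, measurable_fun D (f_ k)) -> (forall k x, D x -> `|f_ k x| <= M) ->
  (forall x, D x -> f_ k x @[k --> \oo] --> f x) ->
  cint nu D (f_ k) @[k --> \oo] --> cint nu D f.
Proof.
by move=> mD mf fM ff; apply: cvgB; exact: Rintegral_bounded_cvg mf fM ff.
Qed.

End bounded_convergence.

Section continuity_within.
Context {R : realType} {X : topologicalType} (K : set X).
Implicit Types (f g : X -> R).
Local Notation cts f := {within K, continuous (f : X -> R)}.

Lemma cts_cst (a : R) : cts (fun=> a).
Proof. by move=> x; exact: cvg_cst. Qed.

Lemma ctsD f g : cts f -> cts g -> cts (fun x => f x + g x).
Proof. by move=> cf cg x; apply: cvgD; [exact: cf|exact: cg]. Qed.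

Lemma ctsN f : cts f -> cts (fun x => - f x).
Proof. by move=> cf x; apply: cvgN; exact: cf. Qed.

Lemma ctsB f g : cts f -> cts g -> cts (fun x => f x - g x).
Proof. by move=> cf cg; apply: ctsD => //; exact: ctsN. Qed.

Lemma ctsM f g : cts f -> cts g -> cts (fun x => f x * g x).
Proof. by move=> cf cg x; apply: cvgM; [exact: cf|exact: cg]. Qed.

Lemma cts_norm f : cts f -> cts (fun x => `|f x|).
Proof. by move=> cf x; apply: cvg_norm; exact: cf. Qed.

Lemma cts_comp (Y : topologicalType) (h : R -> Y) f :
  continuous h -> cts f -> {within K, continuous (fun x => h (f x))}.
Proof. by move=> ch cf x; apply: continuous_comp; [exact: cf|exact: ch]. Qed.

Lemma cts_max f g : cts f -> cts g -> cts (fun x => Num.max (f x) (g x)).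
Proof.
move=> cf cg; under eq_fun do rewrite maxr_absE.
apply: ctsM; last exact: cts_cst.
by apply: ctsD; [exact: ctsD|apply: cts_norm; exact: ctsB].
Qed.

Lemma cts_min f g : cts f -> cts g -> cts (fun x => Num.min (f x) (g x)).
Proof.
move=> cf cg; under eq_fun do rewrite minr_absE.
apply: ctsM; last exact: cts_cst.
by apply: ctsB; [exact: ctsD|apply: cts_norm; exact: ctsB].
Qed.

Lemma cts_inv f : cts f -> (forall x, f x != 0) -> cts (fun x => (f x)^-1).
Proof. by move=> cf f0 x; apply: cvgV => //; exact: cf. Qed.

Lemma cts_sum (I : Type) (r : seq I) (f : I -> X -> R) : (forall i, cts (f i)) ->
  cts (fun x => \sum_(i <- r) f i x).
Proof.
move=> cf; elim: r => [|i r IH].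
  by under eq_fun do rewrite big_nil; exact: cts_cst.
by under eq_fun do rewrite big_cons; exact: ctsD.
Qed.

Lemma cts_eq f g : (forall x, K x -> f x = g x) -> cts f -> cts g.
Proof.
move=> fg cf; have := @subspace_eq_continuous _ K _ (f : subspace K -> R) (g : subspace K -> R).
by apply => // x /set_mem Kx; exact: fg.
Qed.

Section vectors.
Context {n : nat}.
Implicit Types F G : X -> 'rV[R]_n.
Local Notation ctv F := {within K, continuous (F : X -> 'rV[R]_n)}.

Lemma ctv_coord F i : ctv F -> cts (fun x => F x 0 i).
Proof.
move=> cF x; apply: (cvg_comp F (fun v : 'rV[R]_n => v 0 i) (cF x)).
exact: coord_continuous.
Qed.

Lemma ctvZ f F : cts f -> ctv F -> ctv (fun x => f x *: F x).
Proof. by move=> cf cF x; apply: cvgZ; [exact: cf|exact: cF]. Qed.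

Lemma ctvD F G : ctv F -> ctv G -> ctv (fun x => F x + G x).
Proof. by move=> cf cg x; apply: cvgD; [exact: cf|exact: cg]. Qed.

Lemma ctv_cst (u : 'rV[R]_n) : ctv (fun=> u).
Proof. by move=> x; exact: cvg_cst. Qed.

Lemma ctv_sum (I : Type) (r : seq I) (F : I -> X -> 'rV[R]_n) : (forall i, ctv (F i)) ->
  ctv (fun x => \sum_(i <- r) F i x).
Proof.
move=> cf; elim: r => [|i r IH].
  by under eq_fun do rewrite big_nil; exact: ctv_cst.
by under eq_fun do rewrite big_cons; exact: ctvD.
Qed.

Lemma ctv_coordP F : ctv F <-> forall i, cts (fun x => F x 0 i).
Proof.
split=> [cF i|cF]; first exact: ctv_coord.
rewrite (_ : F = fun x => \sum_i F x 0 i *: delta_mx 0 i); last first.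
  by apply/funext => x; exact: row_sum_delta.
apply: (@ctv_sum _ _ (fun i x => F x 0 i *: delta_mx 0 i)) => i.
by apply: ctvZ => //; exact: ctv_cst.
Qed.

Lemma cts_dotp F G : ctv F -> ctv G -> cts (fun x => dotp (F x) (G x)).
Proof.
move=> cF cG; apply: (@cts_sum _ _ (fun i x => F x 0 i * G x 0 i)) => i.
by apply: ctsM; exact: ctv_coord.
Qed.

Lemma cts_enorm F : ctv F -> cts (fun x => enorm (F x)).
Proof. by move=> cF; apply: cts_comp; [exact: sqrt_continuous|exact: cts_dotp]. Qed.

Lemma ctv_eq F G : (forall x, K x -> F x = G x) -> ctv F -> ctv G.
Proof.
move=> fg /ctv_coordP cf; apply/ctv_coordP => i; apply: cts_eq (cf i) => x Kx.
by rewrite fg.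
Qed.

End vectors.
End continuity_within.

Section baire_spaces.
Context {R : realType} {disp : measure_display} {X : topMeasurableType disp}.
Local Notation cts K f := {within K, continuous (f : X -> R)}.

Definition pos_sets (K : set X) : set (set X) :=
  [set [set x | K x /\ 0 < f x] | f in [set f : X -> R | cts K f]].

(** What the torus and the slab have in common. On such a set, measures are
determined by their integrals of continuous functions, and no regularity of
measures has to be assumed or proved. *)
Record baire (K : set X) : Prop := Baire {
  baire_compact : compact K ;
  baire_measurable : measurable K ;
  baire_fun : forall f : X -> R, cts K f -> measurable_fun K f ;
  baire_gen : forall S, measurable S -> <<s K, pos_sets K>> (S `&` K) }.

Variables (K : set X) (hK : baire K).
Let mK : measurable K := baire_measurable hK.
Hint Resolve mK : core.

Lemma cts_bm f : cts K f -> bm K f.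
Proof.
move=> cf; split; first exact: (baire_fun hK).
have /compact_bounded[M [_ hM]] := continuous_compact cf (baire_compact hK).
exists (M + 1) => x Kx; apply: (hM (M + 1)); first by rewrite ltrDl.
by exists x.
Qed.

Lemma pos_sets_setI : setI_closed (pos_sets K).
Proof.
move=> _ _ [f cf <-] [g cg <-]; exists (fun x => Num.min (f x) (g x)).
  exact: cts_min.
apply/seteqP; split=> x /=; first by rewrite lt_min => -[Kx /andP[]].
by case=> -[Kx fx] [_ gx]; rewrite lt_min fx gx.
Qed.

Lemma pos_sets_gen_sub S : <<s K, pos_sets K>> S -> S `<=` K.
Proof.
apply: (@smallest_sub _ _ _ [set S | S `<=` K]).
  split=> //; first by move=> A _ x [].
  by move=> A AK x [k _ /AK].
by move=> _ [f _ <-] x [].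
Qed.

Lemma pos_sets_measurable S : pos_sets K S -> measurable S.
Proof.
move=> [f cf <-].
rewrite (_ : [set _ | _] = K `&` f @^-1` `]0, +oo[%classic).
  by apply: (baire_fun hK).
by apply/seteqP; split=> x /=; rewrite in_itv/= andbT.
Qed.

(** The pi-lambda theorem for the generators [f > 0], which are stable under
intersection since [min f g] is continuous. *)
Lemma baire_ind (P : set (set X)) : lambda_system K P -> pos_sets K `<=` P ->
  forall S, measurable S -> S `<=` K -> P S.
Proof.
move=> lP GP S mS SK; have := baire_gen hK mS; rewrite (setIidl SK) => h.
exact: (lambda_system_subset pos_sets_setI lP GP pos_sets_gen_sub).
Qed.

Definition ramp (f : X -> R) (k : nat) (x : X) : R :=
  Num.min 1 (k%:R * Num.max 0 (f x)).

Lemma ramp_cts f k : cts K f -> cts K (ramp f k).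
Proof.
move=> cf; apply: cts_min; first exact: cts_cst.
apply: ctsM; first exact: cts_cst.
by apply: cts_max => //; exact: cts_cst.
Qed.

Lemma ramp_ge0 f k x : 0 <= ramp f k x.
Proof. by rewrite le_min ler01 mulr_ge0// le_max lexx. Qed.

Lemma ramp_le1 f k x : ramp f k x <= 1.
Proof. by rewrite ge_min lexx. Qed.

Lemma ramp_nd f k l x : (k <= l)%N -> ramp f k x <= ramp f l x.
Proof.
move=> kl; rewrite le_min ramp_le1/= ge_min; apply/orP; right.
by rewrite ler_wpM2r ?ler_nat// le_max lexx.
Qed.

Lemma ramp_cvg f x : ramp f k x @[k --> \oo] --> (\1_[set x | 0 < f x] x : R).
Proof.
rewrite indicE; have [fx|fx] := ltP 0 (f x).
  rewrite mem_set//; apply: cvg_near_cst.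
  exists (Num.truncn (f x)^-1).+1 => // k /= hk.
  apply/eqP; rewrite /ramp max_r ?(ltW fx)//.
  rewrite eq_le ge_min lexx/= le_min lexx/= -ler_pdivrMr// mul1r.
  rewrite (le_trans (ltW (truncnS_gt _)))// ler_nat//.
rewrite memNset/=; last by rewrite ltNge fx.
apply: cvg_near_cst; apply: nearW => k.
by rewrite /ramp max_l// mulr0 min_r.
Qed.

(** The sets with this property form a lambda-system. It contains the sets
[f > 0], because the functions [ramp f k] increase to their indicators. *)
Lemma cts_dense_indic (nu : {finite_measure set X -> \bar R}) S (e : R) :
  measurable S -> S `<=` K -> 0 < e ->
  exists f, cts K f /\ \int[nu]_(x in K) `|f x - \1_S x| <= e.
Proof.
move=> mS SK; move: S mS SK e.
pose P (S : set X) := [/\ measurable S, S `<=` K & forall e : R, 0 < e ->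
  exists f, cts K f /\ \int[nu]_(x in K) `|f x - \1_S x| <= e].
have bi S : measurable S -> bm K (\1_S : X -> R) by move=> mS; exact: bm_indic.
have bf f S : cts K f -> measurable S -> bm K (fun x => `|f x - \1_S x|).
  by move=> cf mS; apply: bm_norm; apply: bmB; [exact: cts_bm|exact: bi].
suff h : forall S, measurable S -> S `<=` K -> P S by move=> S mS SK; case: (h S mS SK).
apply: baire_ind; first split.
- by move=> A [].
- split=> // e e0; exists (fun=> 1); split; first exact: cts_cst.
  rewrite (@eq_Rintegral _ _ _ _ _ (fun=> 0)) ?Rintegral_cst// ?mul0r ?(ltW e0)//.
  by move=> x xK; rewrite indicE xK subrr normr0.
- move=> A B BA [mA AK hA] [mB BK hB]; split; first exact: measurableD.
    by move=> x [/AK].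
  move=> e e0; have e20 : 0 < e / 2 by rewrite divr_gt0.
  have [f [cf fA]] := hA _ e20; have [g [cg gB]] := hB _ e20.
  exists (fun x => f x - g x); split; first exact: ctsB.
  rewrite [e]splitr; apply: le_trans (lerD fA gB).
  rewrite -RintegralD//; [|by apply: bm_integrable => //; exact: bf..].
  apply: le_Rintegral => //.
  + by apply: bm_integrable => //; apply: bf; [exact: ctsB|exact: measurableD].
  + by apply: bm_integrable => //; apply: bmD; exact: bf.
  move=> x _; rewrite (_ : _ - _ - _ = (f x - \1_A x) - (g x - \1_B x)) ?ler_normB//.
  rewrite !indicE in_setD.
  have [Bx|Bx] := boolP (x \in B).
    by rewrite (mem_set (BA x (set_mem Bx)))/=; ring.
  by rewrite andbT; case: (x \in A) => /=; ring.
- move=> F ndF hF.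
  have mU : measurable (\bigcup_k F k).
    by apply: bigcup_measurable => k _; case: (hF k).
  split=> //; first by move=> x [k _]; case: (hF k) => _ + _; exact.
  move=> e e0; have e20 : 0 < e / 2 by rewrite divr_gt0.
  have : \int[nu]_(x in K) `|\1_(F k) x - \1_(\bigcup_k F k) x| @[k --> \oo] -->
      \int[nu]_(x in K) (0 : R).
    apply: (@Rintegral_bounded_cvg _ _ _ nu K _ _ 2) => //.
    + move=> k; have [mFk _ _] := hF k.
      by have [] := bm_norm (bmB (bi _ mFk) (bi _ mU)).
    + move=> k x _; rewrite normr_id (le_trans (ler_normB _ _))// !indicE.
      by case: (_ \in _); case: (_ \in _); rewrite ?normr0 ?normr1; lra.
    + move=> x Kx; apply: cvg_near_cst.
      have [[k _ Fkx]|nx] := pselect ((\bigcup_k F k) x).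
        exists k => // l /= kl; have /subsetPset := ndF _ _ kl => /(_ x Fkx) Flx.
        by rewrite !indicE !mem_set// ?subrr ?normr0//; exists k.
      apply: nearW => k; rewrite !indicE !memNset ?subrr ?normr0// => Fkx.
      by apply: nx; exists k.
  rewrite Rintegral_cst// mul0r => /cvgr_lt/(_ _ e20)[k _ /(_ k (leqnn k)) hk].
  have [mFk FkK /(_ _ e20)[f [cf hf]]] := hF k.
  exists f; split=> //; rewrite [e]splitr; apply: le_trans (lerD hf (ltW hk)).
  have b2 : bm K (fun x => `|\1_(F k) x - \1_(\bigcup_k F k) x| : R).
    exact: bm_norm (bmB (bi _ mFk) (bi _ mU)).
  rewrite -RintegralD//; [|by apply: bm_integrable => //; exact: bf|exact: bm_integrable].
  apply: le_Rintegral => //.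
  + by apply: bm_integrable => //; exact: bf.
  + by apply: bm_integrable => //; apply: bmD => //; exact: bf.
  by move=> x _; rewrite -{1}(subrK (\1_(F k) x) (f x)) -addrA ler_normD.
- move=> S GS; have mS := pos_sets_measurable GS; move: GS mS => [f cf <-] mS.
  split=> //; first by move=> x [].
  move=> e e0.
  have : \int[nu]_(x in K) `|ramp f k x - \1_[set x | K x /\ 0 < f x] x| @[k --> \oo] -->
      \int[nu]_(x in K) (0 : R).
    apply: (@Rintegral_bounded_cvg _ _ _ nu K _ _ 2) => //.
    + by move=> k; have [] := bf _ _ (@ramp_cts f k cf) mS.
    + move=> k x _; rewrite normr_id (le_trans (ler_normB _ _))//.
      rewrite ger0_norm ?ramp_ge0//; have := ramp_le1 f k x; rewrite indicE.
      by case: (_ \in _); rewrite ?normr0 ?normr1; lra.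
    + move=> x Kx; have E : \1_[set x | 0 < f x] x = \1_[set x | K x /\ 0 < f x] x :> R.
        by rewrite !indicE; congr (nat_of_bool _)%:R; apply/idP/idP => /set_mem /=;
          rewrite ?inE; [|case].
      rewrite [X in _ --> X](_ : 0 = `|\1_[set x | 0 < f x] x -
        \1_[set x | K x /\ 0 < f x] x|); last by rewrite E subrr normr0.
      by apply: cvg_norm; apply: cvgB; [exact: ramp_cvg|exact: cvg_cst].
  rewrite Rintegral_cst// mul0r => /cvgr_lt/(_ _ e0)[k _ /(_ k (leqnn k)) hk].
  by exists (ramp f k); split; [exact: ramp_cts|exact: ltW].
Qed.

Lemma cts_dense (nu : {finite_measure set X -> \bar R}) f :
  bm K f -> forall e : R, 0 < e ->
  exists g, cts K g /\ \int[nu]_(x in K) `|g x - f x| <= e.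
Proof.
move: f; apply: bm_ind => //.
- by move=> A mA AK e e0; exact: cts_dense_indic.
- move=> a f g bf bg hf hg e e0.
  have e1 : 0 < e / 2 / (`|a| + 1) by rewrite !divr_gt0// ltr_wpDl.
  have e2 : 0 < e / 2 by rewrite divr_gt0.
  have [f' [cf hf']] := hf _ e1; have [g' [cg hg']] := hg _ e2.
  have [bf' bg'] := (cts_bm cf, cts_bm cg).
  have b1 : bm K (fun x => `|f' x - f x|) by apply: bm_norm; exact: bmB.
  have b2 : bm K (fun x => `|g' x - g x|) by apply: bm_norm; exact: bmB.
  exists (fun x => a * f' x + g' x); split.
    by apply: ctsD => //; apply: ctsM => //; exact: cts_cst.
  apply: (@le_trans _ _ (`|a| * (e / 2 / (`|a| + 1)) + e / 2)).
    apply: le_trans (lerD (ler_wpM2l (normr_ge0 a) hf') hg').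
    rewrite -RintegralZl//; last exact: bm_integrable.
    rewrite -RintegralD//; last exact: bm_integrable; last first.
      by apply: (bm_integrable nu mK); exact: bmZ.
    apply: le_Rintegral => //.
    + apply: (bm_integrable nu mK); apply: bm_norm; apply: bmB; apply: bmD => //; exact: bmZ.
    + by apply: (bm_integrable nu mK); apply: bmD => //; exact: bmZ.
    move=> x _; rewrite (_ : _ - _ = a * (f' x - f x) + (g' x - g x)); last by ring.
    by rewrite (le_trans (ler_normD _ _))// normrM.
  rewrite [leRHS]splitr lerD2r mulrCA ler_piMr ?(ltW e2)//.
  by rewrite ler_pdivrMr ?ltr_wpDl// mul1r lerDl.
- move=> f bf hf e e0.
  pose M := fine (nu K); have M0 : 0 <= M by rewrite fine_ge0.
  have e1 : 0 < e / 2 / (M + 1) by rewrite !divr_gt0// ltr_wpDl.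
  have e2 : 0 < e / 2 by rewrite divr_gt0.
  have [g [bg hg fg]] := hf _ e1; have [h [ch gh]] := hg _ e2.
  have bh := cts_bm ch.
  have b1 : bm K (fun x => `|h x - g x|) by apply: bm_norm; exact: bmB.
  exists h; split=> //.
  apply: (@le_trans _ _ (e / 2 + e / 2 / (M + 1) * M)).
    rewrite -Rintegral_cst//; apply: le_trans (lerD gh (lexx _)).
    rewrite -RintegralD//; [|exact: bm_integrable|]; last first.
      by apply: (bm_integrable nu mK); exact: bm_cst.
    apply: le_Rintegral => //.
    + by apply: (bm_integrable nu mK); apply: bm_norm; exact: bmB.
    + by apply: (bm_integrable nu mK); apply: bmD => //; exact: bm_cst.
    move=> x Kx; rewrite (_ : h x - f x = (h x - g x) - (f x - g x)); last by ring.
    by rewrite (le_trans (ler_normB _ _))// lerD2l fg.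
  rewrite [leRHS]splitr lerD2l -mulrA ler_piMr ?(ltW e2)//.
  by rewrite mulrC ler_pdivrMr ?ltr_wpDl// mul1r lerDl.
Qed.

Section vector.
Context {n : nat}.
Implicit Types (m : @vmeasure R n disp X K) (F G : X -> 'rV[R]_n).
Local Notation ctv F := {within K, continuous (F : X -> 'rV[R]_n)}.

Lemma ctv_bmv F : ctv F -> bmv K F.
Proof. by move=> /ctv_coordP cF i; exact: cts_bm. Qed.

Lemma ctv_dense (nu : {finite_measure set X -> \bar R}) G (e : R) :
  bmv K G -> 0 < e ->
  exists F, ctv F /\ \int[nu]_(x in K) enorm (F x - G x) <= e.
Proof.
move=> bG e0; have e1 : 0 < e / n.+1%:R by rewrite divr_gt0.
have /choice[f hf] : forall i, exists g : X -> R,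
    cts K g /\ \int[nu]_(x in K) `|g x - G x 0 i| <= e / n.+1%:R.
  by move=> i; apply: cts_dense => //; exact: bG.
pose F x := \row_i f i x.
have cF : ctv F.
  by apply/ctv_coordP => i; under eq_fun do rewrite mxE; case: (hf i).
exists F; split=> //.
have b1 i : bm K (fun x => `|f i x - G x 0 i|).
  by apply: bm_norm; apply: bmB => //; apply: cts_bm; case: (hf i).
apply: (@le_trans _ _ (\sum_(i < n) e / n.+1%:R)).
  apply: le_trans (ler_sum _ (fun i _ => (hf i).2)).
  rewrite -bm_Rintegral_sum//; apply: le_Rintegral => //.
  + apply: (bm_integrable nu mK); apply: bm_enorm; apply: bmvB => //; exact: ctv_bmv.
  + by apply: (bm_integrable nu mK); exact: bm_sum.
  move=> x _; rewrite (le_trans (enorm_le_sum _))//; apply: ler_sum => i _.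
  by rewrite !mxE.
rewrite sumr_const card_ord -[leLHS]mulr_natr -mulrA ler_piMr ?(ltW e0)//.
by rewrite mulrC ler_pdivrMr// mul1r ler_nat.
Qed.

(** [tvint_polar] with a continuous field: radial projection onto the unit
ball moves an approximation of [G] by no more than its distance to [G]. *)
Lemma tvint_polar_cts m (f : X -> R) (e : R) : bm K f -> (forall x, K x -> 0 <= f x) ->
  0 < e -> exists F, [/\ ctv F, forall x, enorm (F x) <= 1 &
    tvint m K f - e <= vint m K (fun x => f x *: F x)].
Proof.
move=> bf f0 e0; have e2 : 0 < e / 2 by rewrite divr_gt0.
have [G [bG G1 hG]] := tvint_polar m mK bf f0 e2.
have [M0 [M M_ge0 fM]] : exists M0 : R, exists2 M, 0 < M & forall x, K x -> `|f x| <= M.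
  case: bf => _ [M fM]; exists M, (`|M| + 1); first by rewrite ltr_wpDl.
  by move=> x Kx; rewrite (le_trans (fM _ Kx))// (le_trans (ler_norm _))// lerDl.
have e3 : 0 < e / 2 / (2 * M) by rewrite !divr_gt0// mulr_gt0.
have [F0 [cF0 hF0]] := ctv_dense (tv (val m)) bG e3.
pose s x := Num.max 1 (enorm (F0 x)).
have s1 x : 1 <= s x by rewrite le_max lexx.
have s0 x : 0 < s x by exact: lt_le_trans (s1 x).
pose F x := (s x)^-1 *: F0 x.
have cF : ctv F.
  apply: ctvZ => //; apply: cts_inv; last by move=> x; rewrite gt_eqF.
  by apply: cts_max; [exact: cts_cst|exact: cts_enorm].
exists F; split=> //.
  move=> x; rewrite enormZ ger0_norm ?invr_ge0 ?(ltW (s0 x))//.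
  by rewrite ler_pdivrMl// mulr1 le_max lexx orbT.
have FG x : K x -> enorm (F x - G x) <= 2 * enorm (F0 x - G x).
  move=> Kx.
  suff h1 : enorm (F x - F0 x) <= enorm (F0 x - G x).
    have := enormD (F x - F0 x) (F0 x - G x); rewrite subrKA; lra.
  rewrite /F -[X in _ - X]scale1r -scalerBl enormZ.
  have -> : `|(s x)^-1 - 1| * enorm (F0 x) = (1 - (s x)^-1) * enorm (F0 x).
    by rewrite ler0_norm ?opprB// subr_le0 invf_le1.
  have h : enorm (F0 x) - 1 <= enorm (F0 x - G x).
    have := enormD (F0 x - G x) (G x); rewrite subrK.
    have := G1 x Kx; lra.
  have [le1|gt1] := leP (enorm (F0 x)) 1.
    by rewrite /s max_l// invr1 subrr mul0r enorm_ge0.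
  rewrite /s max_r ?(ltW gt1)// mulrBl mul1r mulVf ?gt_eqF//.
  exact: lt_trans gt1.
have bF := ctv_bmv cF.
have bFG : bmv K (fun x => F x - G x) by exact: bmvB.
have -> : vint m K (fun x => f x *: F x) = vint m K (fun x => f x *: G x) +
    vint m K (fun x => f x *: (F x - G x)).
  rewrite -vintD//; try exact: bmvZf.
  by apply: eq_vint => x _; rewrite -scalerDr addrC subrK.
suff : `|vint m K (fun x => f x *: (F x - G x))| <= e / 2.
  by rewrite ler_norml => /andP[h _]; lra.
rewrite (le_trans (vint_le_tvint _ _ _))//; first exact: bmvZf.
have bF0G : bm K (fun x => enorm (F0 x - G x)).
  by apply: bm_enorm; apply: bmvB => //; exact: ctv_bmv.
apply: (@le_trans _ _ (tvint m K (fun x => 2 * M * enorm (F0 x - G x)))).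
  apply: tvint_le => //; [by apply: bm_enorm; exact: bmvZf|exact: bmZ|].
  move=> x Kx; rewrite enormZ (mulrC 2) -mulrA ler_pM ?enorm_ge0//.
    exact: fM.
  exact: FG.
by rewrite tvintZ// -ler_pdivlMl ?mulr_gt0// mulrC.
Qed.

End vector.
End baire_spaces.

(** * Riesz representation of positive functionals *)

Section riesz.
Context {R : realType} {disp : measure_display} {X : topMeasurableType disp}.
Local Notation cts K f := {within K, continuous (f : X -> R)}.

Record pos_functional (K : set X) := PosFunctional {
  pf_fun :> (X -> R) -> R ;
  pf_linear : forall a f g, cts K f -> cts K g ->
    pf_fun (fun x => a * f x + g x) = a * pf_fun f + pf_fun g ;
  pf_pos : forall f, cts K f -> (forall x, K x -> 0 <= f x) -> 0 <= pf_fun f }.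

Section functional.
Variables (K : set X) (L : pos_functional K).
Implicit Types (f g : X -> R).

Lemma pf0 : L (fun=> 0) = 0.
Proof.
have := pf_linear L (-1) (@cts_cst R X K 0) (@cts_cst R X K 0).
by rewrite (_ : (fun x => _) = fun=> 0) ?mulN1r ?addNr//; apply/funext => x; rewrite mulr0 addr0.
Qed.

Lemma pfZ a f : cts K f -> L (fun x => a * f x) = a * L f.
Proof.
move=> cf; rewrite -[RHS]addr0 -pf0 -pf_linear//; last exact: cts_cst.
by congr (L _); apply/funext => x; rewrite addr0.
Qed.

Lemma pfD f g : cts K f -> cts K g -> L (fun x => f x + g x) = L f + L g.
Proof.
move=> cf cg; rewrite -[in RHS](mul1r (L f)) -pf_linear//.
by congr (L _); apply/funext => x; rewrite mul1r.
Qed.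

Lemma pfB f g : cts K f -> cts K g -> L (fun x => f x - g x) = L f - L g.
Proof. by move=> cf cg; rewrite pfD//; [rewrite -mulN1r -pfZ//; congr (_ + L _);
  apply/funext => x; rewrite mulN1r|exact: ctsN]. Qed.

Lemma pf_le f g : cts K f -> cts K g -> (forall x, K x -> f x <= g x) -> L f <= L g.
Proof.
move=> cf cg fg; rewrite -subr_ge0 -pfB//; apply: pf_pos; first exact: ctsB.
by move=> x Kx; rewrite subr_ge0 fg.
Qed.

Lemma pf_sum (I : Type) (r : seq I) (f : I -> X -> R) : (forall i, cts K (f i)) ->
  L (fun x => \sum_(i <- r) f i x) = \sum_(i <- r) L (f i).
Proof.
move=> cf; elim: r => [|i r IH].
  by under eq_fun do rewrite big_nil; rewrite big_nil pf0.
under eq_fun do rewrite big_cons.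
by rewrite big_cons pfD ?IH//; exact: cts_sum.
Qed.

Lemma pf_cst a : L (fun=> a) = a * L (fun=> 1).
Proof.
rewrite -pfZ; last exact: cts_cst.
by congr (L _); apply/funext => x; rewrite mulr1.
Qed.

(** Countable covers by continuous functions, in place of covers by open sets:
they avoid any recourse to functions separating closed sets. *)
Definition cover (E : set X) (h : nat -> X -> R) :=
  [/\ forall k, cts K (h k), forall k x, K x -> 0 <= h k x,
      forall k l x, (k <= l)%N -> K x -> h k x <= h l x &
      forall x, K x -> E x -> exists k, 1 <= h k x].

Definition riesz_outer (E : set X) : \bar R :=
  ereal_inf [set c%:E | c in [set c : R | exists2 h, cover E h & forall k, L (h k) <= c]].

Lemma riesz_outer_le E h c : cover E h -> (forall k, L (h k) <= c) ->
  (riesz_outer E <= c%:E)%E.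
Proof. by move=> ch hc; apply: ereal_inf_lbound; exists c => //; exists h. Qed.

Lemma riesz_outer_ge0 E : (0 <= riesz_outer E)%E.
Proof.
apply: le_ereal_inf_tmp => _ [c [h [ch h0 hnd hE] hc] <-]; rewrite lee_fin.
by apply: le_trans (hc 0%N); apply: pf_pos => // x; exact: h0.
Qed.

Lemma riesz_outer_leT E : (riesz_outer E <= (L (fun=> 1))%:E)%E.
Proof.
apply: (@riesz_outer_le E (fun _ _ => 1)) => //; split=> //.
- by move=> k; exact: cts_cst.
- by move=> x _ _; exists 0%N.
Qed.

Lemma riesz_outer_fin E : riesz_outer E \is a fin_num.
Proof.
by rewrite ge0_fin_numE ?riesz_outer_ge0// (le_lt_trans (riesz_outer_leT E))// ltry.
Qed.

Lemma riesz_outer_approx E (e : R) : 0 < e -> exists h, cover E h /\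
  forall k, L (h k) <= fine (riesz_outer E) + e.
Proof.
move=> e0; have : (riesz_outer E < (fine (riesz_outer E) + e)%:E)%E.
  by rewrite EFinD fineK ?riesz_outer_fin// -{1}(fineK (riesz_outer_fin E))
    -(fineK (riesz_outer_fin E)) -EFinD lte_fin ltrDl.
move=> /ereal_inf_lt[_ [c [h ch hc] <-]]; rewrite lte_fin => hlt.
by exists h; split=> // k; rewrite (le_trans (hc k))// ltW.
Qed.

Lemma riesz_outerS A B : A `<=` B -> (riesz_outer A <= riesz_outer B)%E.
Proof.
move=> AB; apply: le_ereal_inf_tmp => _ [c [h [ch h0 hnd hE] hc] <-].
by apply: (riesz_outer_le _ hc); split=> // x Kx /AB; exact: hE.
Qed.

Lemma riesz_outer_setI E : riesz_outer (E `&` K) = riesz_outer E.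
Proof.
apply/eqP; rewrite eq_le; apply/andP; split; first by apply: riesz_outerS => x [].
apply: le_ereal_inf_tmp => _ [c [h [ch h0 hnd hE] hc] <-].
by apply: (riesz_outer_le _ hc); split=> // x Kx Ex; exact: hE.
Qed.

Lemma riesz_outer0 : riesz_outer set0 = 0%E.
Proof.
apply/eqP; rewrite eq_le riesz_outer_ge0 andbT.
apply: (@riesz_outer_le _ (fun _ _ => 0)); last by move=> k; rewrite pf0.
by split=> // k; exact: cts_cst.
Qed.

(** Covers whose errors sum to [e] are added up, the cover of the [n]-th set being
used from index [n.+1] on, so that all sums are finite. *)
Lemma riesz_outer_sigma_subadditive : sigma_subadditive riesz_outer.
Proof.
move=> F; apply/lee_addgt0Pr => e e0.
have /choice[h hh] : forall n, exists h, cover (F n) h /\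
    forall k, L (h k) <= fine (riesz_outer (F n)) + e / (2 ^ n.+1)%:R.
  by move=> n; apply: riesz_outer_approx; rewrite divr_gt0// ltr0n expn_gt0.
set S := (\sum_(i <oo) _)%E.
have S0 : (0 <= S)%E by apply: nneseries_ge0 => n _ _; exact: riesz_outer_ge0.
case: (leP +oo%E S) => [|Sy]; first by rewrite leye_eq => /eqP ->; rewrite addye ?leey.
rewrite -(fineK (x := S)) ?ge0_fin_numE// -EFinD.
apply: (@riesz_outer_le _ (fun k x => \sum_(n < k) h n k x)).
  split.
  - by move=> k; apply: (@cts_sum _ _ _ _ _ (fun (n : 'I_k) x => h n k x)) => n; case: (hh n) => -[].
  - by move=> k x Kx; apply: sumr_ge0 => n _; case: (hh n) => -[_ + _ _ _]; exact.
  - move=> k l x kl Kx.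
    apply: (@le_trans _ _ (\sum_(n < k) h n l x)).
      by apply: ler_sum => n _; case: (hh n) => -[_ _ + _ _]; exact.
    rewrite -!(big_mkord xpredT (fun n => h n l x)) (big_cat_nat (leq0n k) kl)//= lerDl.
    by apply: sumr_ge0 => n _; case: (hh n) => -[_ + _ _ _]; exact.
  - move=> x Kx [n _ Fx]; have [[_ h0 hnd hE] _] := hh n.
    have [k hk] := hE _ Kx Fx; exists (maxn k n.+1).
    have nlt : (n < maxn k n.+1)%N by rewrite leq_max leqnn orbT.
    rewrite (bigD1 (Ordinal nlt))//= (le_trans hk)//.
    rewrite (le_trans (hnd k (maxn k n.+1) x _ Kx)) ?leq_maxl// lerDl.
    by apply: sumr_ge0 => i _; case: (hh i) => -[_ + _ _ _]; exact.
move=> k; rewrite (@pf_sum _ _ (fun (n : 'I_k) x => h n k x)); last first.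
  by move=> n; case: (hh n) => -[].
apply: (@le_trans _ _ (\sum_(n < k) (fine (riesz_outer (F n)) + e / (2 ^ n.+1)%:R))).
  by apply: ler_sum => n _; case: (hh n).
rewrite big_split/= lerD//.
  rewrite -lee_fin fineK ?ge0_fin_numE// -sumEFin.
  rewrite (eq_bigr (fun n : 'I_k => riesz_outer (F n))); last first.
    by move=> n _; rewrite fineK// riesz_outer_fin.
  rewrite -(big_mkord xpredT (fun n => riesz_outer (F n))).
  by apply: nneseries_lim_ge => n _ _; exact: riesz_outer_ge0.
rewrite -mulr_sumr ler_piMr ?(ltW e0)//.
have -> : \sum_(n < k) (2 ^ n.+1)%:R^-1 = 1 - (2 ^ k)%:R^-1 :> R.
  elim: k => [|k IH]; first by rewrite big_ord0 expn0 invr1 subrr.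
  rewrite big_ord_recr/= IH expnS natrM invfM.
  have : (2 : R) != 0 by []. 
  move: ((2 ^ k)%:R^-1 : R) => z _; lra.
by rewrite gerBl invr_ge0.
Qed.

HB.instance Definition _ := isOuterMeasure.Build R X riesz_outer
  riesz_outer0 riesz_outer_ge0 riesz_outerS riesz_outer_sigma_subadditive.

Hypothesis hK : @baire R disp X K.

(** Dini: by compactness, a cover of [K] exceeds [1 - d] on the whole of [K] from
some index on. *)
Lemma riesz_outer_K : riesz_outer K = (L (fun=> 1))%:E.
Proof.
apply/eqP; rewrite eq_le riesz_outer_leT/=.
apply: le_ereal_inf_tmp => _ [c [h [ch h0 hnd hE] hc] <-]; rewrite lee_fin.
have L1 : 0 <= L (fun=> 1) by apply: pf_pos => //; exact: cts_cst.
apply/ler_addgt0Pr => e e0.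
pose d := e / (L (fun=> 1) + 1).
have d0 : 0 < d by rewrite divr_gt0// ltr_wpDl.
have : \forall k \near \oo, K `<=` [set x | 1 - d < h k x].
  have /compact_near_coveringP/near_covering_withinP := baire_compact hK.
  apply => x Kx; have [k hk] := hE _ Kx Kx.
  have : \forall x' \near x & l \near \oo, (k <= l)%N /\ (K x' -> 1 - d < h k x').
    exists ([set x' | K x' -> 1 - d < h k x'], [set l | (k <= l)%N]); last first.
      by move=> [x' l] /= [].
    split; last by exists k.
    have /subspace_continuousP/(_ x Kx)/cvgr_gt := ch k.
    by apply; rewrite (lt_le_trans _ hk)// gtrBl.
  apply: filterS => -[x' l] /= [kl hx'] Kx'.
  by rewrite (lt_le_trans (hx' Kx'))// hnd.
move=> [k _ /(_ k (leqnn k)) hk].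
have : L (fun=> 1 - d) <= L (h k).
  by apply: pf_le => //; [exact: cts_cst|move=> x /hk /ltW].
rewrite pf_cst => h1.
have h2 := hc k.
have : d * L (fun=> 1) <= e.
  by rewrite /d mulrAC ler_pdivrMr ?ltr_wpDl// ler_wpM2l ?(ltW e0)// lerDl.
lra.
Qed.

(** Caratheodory measurable sets form a sigma-algebra, so it is enough to cut by
[f > 0]. A cover of [E] multiplied by the ramps of [f] covers the part of [E]
where [f > 0], and multiplied by one minus a fixed ramp it covers the rest; a
ramp of large index makes the two values add up to little more than the value of
the given cover. *)
Lemma riesz_cara S : measurable S -> riesz_outer.-caratheodory S.
Proof.
move=> mS.
suff hS : riesz_outer.-caratheodory (S `&` K).
  move=> E; rewrite (hS E) -(riesz_outer_setI (E `&` S)) -(riesz_outer_setI (E `&` ~` S)).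
  rewrite setIA; congr (_ + _)%E; rewrite -[LHS]riesz_outer_setI; congr riesz_outer.
  apply/seteqP; split=> x /=.
    by move=> [[Ex nSK] Kx]; split=> //; split=> // Sx; exact: nSK.
  by move=> [[Ex nS] Kx]; split=> //; split=> // -[].
have := baire_gen hK mS; move: (S `&` K) => {mS}S.
suff gen : @pos_sets R disp X K `<=` riesz_outer.-caratheodory.
  have KC : riesz_outer.-caratheodory K.
    apply: gen; exists (fun=> 1); first exact: cts_cst.
    by apply/seteqP; split=> [x []//|x Kx]; split.
  apply: smallest_sub => //; split.
  - exact: caratheodory_measurable_set0.
  - by move=> A cA; exact: caratheodory_measurable_setD.
  - by move=> A cA; exact: caratheodory_measurable_bigcup.
move=> _ [f cf <-]; apply: le_caratheodory_measurable => E.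
set U := [set x | _].
apply: le_ereal_inf_tmp => _ [c [h [ch h0 hnd hE] hc] <-].
pose g k := ramp f k.
have cg k : cts K (g k) by exact: ramp_cts.
have g0 k x : 0 <= g k x by exact: ramp_ge0.
have g1 k x : 0 <= 1 - g k x by rewrite subr_ge0; exact: ramp_le1.
pose u k := L (fun x => h k x * g k x).
have und k l : (k <= l)%N -> u k <= u l.
  move=> kl; apply: pf_le; [exact: ctsM|exact: ctsM|].
  by move=> x Kx; rewrite ler_pM ?h0 ?hnd//; exact: ramp_nd.
have uc k : u k <= c.
  rewrite (le_trans _ (hc k))//; apply: pf_le => //; first exact: ctsM.
  by move=> x Kx; rewrite ler_piMr ?h0//; exact: ramp_le1.
have supu : has_sup (range u).
  by split; [exists (u 0%N), 0%N|exists c => _ [k _ <-]].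
pose s := sup (range u).
have h1 : (riesz_outer (E `&` U) <= s%:E)%E.
  apply: (@riesz_outer_le _ (fun k x => h k x * g k x)); last first.
    by move=> k; apply: ub_le_sup; [case: supu|exists k].
  split=> //.
  - by move=> k; exact: ctsM.
  - by move=> k x Kx; rewrite mulr_ge0// h0.
  - by move=> k l x kl Kx; rewrite ler_pM ?h0 ?hnd//; exact: ramp_nd.
  - move=> x Kx [Ex [_ fx]]; have [k hk] := hE x Kx Ex.
    exists (maxn k (Num.truncn (f x)^-1).+1); rewrite -[leLHS]mulr1.
    rewrite ler_pM//; first by rewrite (le_trans hk)// hnd// leq_maxl.
    rewrite /g /ramp le_min lexx/= max_r ?(ltW fx)// -ler_pdivrMr// mul1r.
    by rewrite (le_trans (ltW (truncnS_gt _)))// ler_nat leq_maxr.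
have h2 (e : R) : 0 < e -> (riesz_outer (E `&` ~` U) <= (c - s + e)%:E)%E.
  move=> e0; have [_ [j _ <-] hj] := sup_adherent e0 supu.
  apply: (@riesz_outer_le _ (fun k x => h k x * (1 - g j x))).
    split=> //.
    - by move=> k; apply: ctsM => //; apply: ctsB => //; exact: cts_cst.
    - by move=> k x Kx; rewrite mulr_ge0// h0.
    - by move=> k l x kl Kx; rewrite ler_wpM2r// hnd.
    - move=> x Kx [Ex nU]; have [k hk] := hE x Kx Ex; exists k.
      have fx : f x <= 0 by rewrite leNgt; apply/negP => fx; exact: nU.
      by rewrite /g /ramp max_l// mulr0 min_r// subr0 mulr1.
  move=> k; pose l := maxn k j.
  apply: (@le_trans _ _ (L (fun x => h l x * (1 - g j x)))).
    apply: pf_le; [by apply: ctsM => //; apply: ctsB => //; exact: cts_cst..|].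
    by move=> x Kx; rewrite ler_wpM2r// hnd// leq_maxl.
  have -> : L (fun x => h l x * (1 - g j x)) = L (h l) - L (fun x => h l x * g j x).
    rewrite -pfB//; last exact: ctsM.
    by congr (L _); apply/funext => x; rewrite mulrBr mulr1.
  have : u j <= L (fun x => h l x * g j x).
    apply: pf_le; [exact: ctsM..|].
    by move=> x Kx; rewrite ler_wpM2r// hnd// leq_maxr.
  have := hc l; rewrite -/s in hj; lra.
apply/lee_addgt0Pr => e e0.
have := leeD h1 (h2 e e0); rewrite -EFinD => h3.
apply: (le_trans h3); rewrite -EFinD lee_fin; lra.
Qed.

End functional.

Definition riesz_measure (K : set X) (hK : @baire R disp X K) (L : pos_functional K) :
  set X -> \bar R := riesz_outer L.

Section riesz_measure.
Variables (K : set X) (hK : @baire R disp X K) (L : pos_functional K).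
Local Notation mu := (riesz_measure hK L).

Let mu0 : mu set0 = 0%E. Proof. exact: riesz_outer0. Qed.

Let mu_ge0 A : (0 <= mu A)%E. Proof. exact: riesz_outer_ge0. Qed.

Let mu_sigma_additive : semi_sigma_additive mu.
Proof.
move=> F mF tF mU.
apply: (@caratheodory_measure_sigma_additive _ _ (riesz_outer L)) => //.
  by move=> i; exact: (riesz_cara L hK).
exact: (riesz_cara L hK).
Qed.

HB.instance Definition _ := isMeasure.Build _ X R mu mu0 mu_ge0 mu_sigma_additive.

Let mu_fin : fin_num_fun mu. Proof. by move=> A _; exact: riesz_outer_fin. Qed.

HB.instance Definition _ := @Measure_isFinite.Build _ X R mu mu_fin.

Lemma riesz_measure_off A : A `&` K = set0 -> mu A = 0%E.
Proof. by move=> AK; rewrite /riesz_measure -riesz_outer_setI AK riesz_outer0. Qed.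

Let mK := baire_measurable hK.

(** [f] is cut into layers of height [1 / N]. A layer is at most [1 / N] times the
indicator of its superlevel set, and [N] times a layer covers the next
superlevel set. The shift by one index costs one layer, of size [L 1 / N]. *)
Let riesz_le (f : X -> R) : cts K f -> (forall x, K x -> 0 <= f x <= 1) ->
  \int[mu]_(x in K) f x <= L f.
Proof.
move=> cf f01; set c := L (fun=> 1).
have c0 : 0 <= c by apply: pf_pos => //; exact: cts_cst.
apply/ler_addgt0Pr => e e0.
pose N := (Num.truncn (c / e)).+1.
have cN : c / N%:R <= e.
  rewrite ler_pdivrMr// mulrC -ler_pdivrMr//; exact: ltW (truncnS_gt _).
pose F i x := Num.min (f x) (i.+1%:R / N%:R) - Num.min (f x) (i%:R / N%:R).
have cF i : cts K (F i) by apply: ctsB; apply: cts_min => //; exact: cts_cst.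
have iN i : i%:R / N%:R <= i.+1%:R / N%:R :> R by rewrite ler_pM2r ?invr_gt0// ler_nat.
have F0 i x : 0 <= F i x.
  by rewrite subr_ge0 le_min ge_min lexx/= ge_min iN orbT.
have fE x : K x -> f x = \sum_(i < N) F i x.
  move=> Kx; have /andP[fx0 fx1] := f01 _ Kx.
  rewrite -(big_mkord xpredT (fun i => F i x)).
  rewrite (@telescope_sumr _ 0 N (fun i => Num.min (f x) (i%:R / N%:R)))//.
  by rewrite mul0r divff ?pnatr_eq0// (min_l fx1) (min_r fx0) subr0.
pose G i := [set x | K x /\ 0 < f x - i%:R / N%:R].
have mG i : measurable (G i).
  apply: (pos_sets_measurable hK); exists (fun x => f x - i%:R / N%:R) => //.
  by apply: ctsB => //; exact: cts_cst.
have FG i x : K x -> F i x <= N%:R^-1 * \1_(G i) x.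
  move=> Kx; rewrite indicE; have [fx|fx] := ltP (i%:R / N%:R) (f x).
    rewrite mem_set ?mulr1; last by split; rewrite ?subr_gt0.
    rewrite lerBlDr (min_r (ltW fx)) ge_min; apply/orP; right.
    by rewrite -{2}(mul1r N%:R^-1) -mulrDl addrC natr1.
  rewrite memNset ?mulr0; last by rewrite /G/= subr_gt0 ltNge fx => -[].
  by rewrite /F (min_l fx) (min_l (le_trans fx (iN i))) subrr.
have muG i : fine (mu (G i.+1)) <= N%:R * L (F i).
  rewrite -lee_fin fineK ?mu_fin// -pfZ//.
  apply: (@riesz_outer_le _ _ _ (fun _ x => N%:R * F i x)) => //; split=> //.
  - by move=> _; apply: ctsM => //; exact: cts_cst.
  - by move=> _ x Kx; rewrite mulr_ge0.
  - move=> x Kx [_]; rewrite subr_gt0 => fx; exists 0%N.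
    rewrite /F (min_r (ltW fx)) (min_r (le_trans (iN i) (ltW fx))) -mulrBl.
    by rewrite -natrB ?leqnSn// subSnn mul1r divff// pnatr_eq0.
have bF i : bm K (F i) by exact: cts_bm.
have bG i : bm K (fun x => N%:R^-1 * \1_(G i) x) by apply: bmZ; exact: bm_indic.
apply: (@le_trans _ _ (\int[mu]_(x in K) (\sum_(i < N) N%:R^-1 * \1_(G i) x))).
  apply: le_Rintegral => //.
  - by apply: (bm_integrable mu mK); exact: cts_bm.
  - apply: (bm_integrable mu mK).
    by apply: (@bm_sum _ _ _ _ _ _ (fun (i : 'I_N) x => N%:R^-1 * \1_(G i) x)) => i.
  - by move=> x Kx; rewrite fE//; apply: ler_sum => i _; exact: FG.
have -> : \int[mu]_(x in K) (\sum_(i < N) N%:R^-1 * \1_(G i) x) =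
    \sum_(i < N) N%:R^-1 * fine (mu (G i)).
  rewrite (bm_Rintegral_sum mu _ mK (f := fun (i : 'I_N) x => N%:R^-1 * \1_(G i) x))//.
  apply: eq_bigr => i _; rewrite RintegralZl//; last first.
    by apply: (bm_integrable mu mK); exact: bm_indic.
  by rewrite /Rintegral integral_indic// (_ : G i `&` K = G i)//; apply/setIidPl => x [].
rewrite big_ord_recl/= addrC lerD//; last first.
  rewrite (le_trans _ cN)// mulrC ler_pM2r ?invr_gt0//.
  by rewrite -lee_fin fineK ?mu_fin// riesz_outer_leT.
apply: (@le_trans _ _ (\sum_(i < N.-1) L (F i))).
  by apply: ler_sum => i _; rewrite ler_pdivrMl.
rewrite -(@pf_sum _ L _ _ (fun (i : 'I_N.-1) => F i))//.
apply: pf_le => //; first exact: (@cts_sum _ _ _ _ _ (fun (i : 'I_N.-1) => F i)).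
by move=> x Kx; rewrite fE// [leRHS]big_ord_recr/= lerDl.
Qed.

(** The inequality [riesz_le] for [1 - f] is the converse inequality for [f]; an
affine change of the values of [f] reduces to functions between 0 and 1. *)
Lemma riesz_integral (f : X -> R) : cts K f -> \int[mu]_(x in K) f x = L f.
Proof.
have muK : fine (mu K) = L (fun=> 1) by have /(congr1 fine) := riesz_outer_K L hK.
have int01 g : cts K g -> (forall x, K x -> 0 <= g x <= 1) -> \int[mu]_(x in K) g x = L g.
  move=> cg g01; apply/eqP; rewrite eq_le riesz_le//=.
  have cg' : cts K (fun x => 1 - g x) by apply: ctsB => //; exact: cts_cst.
  have : \int[mu]_(x in K) (1 - g x) <= L (fun x => 1 - g x).
    apply: riesz_le => // x Kx; have /andP[h1 h2] := g01 _ Kx.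
    by rewrite subr_ge0 h2 gerBl.
  rewrite RintegralB//; last 2 first.
  - by apply: (bm_integrable mu mK); exact: bm_cst.
  - by apply: (bm_integrable mu mK); exact: cts_bm.
  rewrite pfB//; last exact: cts_cst.
  by rewrite Rintegral_cst// mul1r muK lerD2l lerN2.
move=> cf; have [_ [M0 fM0]] := cts_bm hK cf.
pose M := `|M0| + 1; have M_gt0 : 0 < M by rewrite ltr_wpDl.
have fM x : K x -> `|f x| <= M.
  by move=> Kx; rewrite (le_trans (fM0 _ Kx))// (le_trans (ler_norm _))// lerDl.
pose g x := (2 * M)^-1 * f x + 2^-1.
have cg : cts K g.
  by apply: ctsD; [apply: ctsM => //; exact: cts_cst|exact: cts_cst].
have M2 : 2 * M != 0 by rewrite mulf_neq0// gt_eqF.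
have fE : f = (fun x => (2 * M) * g x + (- M)).
  apply/funext => x; rewrite /g mulrDr mulVKf// mulrAC divff// mul1r.
  by rewrite addrK.
have g01 x : K x -> 0 <= g x <= 1.
  move=> Kx; have := fM _ Kx; rewrite ler_norml => /andP[h1 h2].
  rewrite /g -(ler_pM2l (x := 2 * M)) ?mulr_gt0// mulr0.
  rewrite -[X in _ && X](ler_pM2l (x := 2 * M)) ?mulr_gt0// mulr1 mulrDr mulVKf//.
  by rewrite mulrAC divff// mul1r; apply/andP; split; lra.
rewrite fE pf_linear//; last exact: cts_cst.
rewrite RintegralD//; last 2 first.
- by apply: (bm_integrable mu mK); apply: bmZ; exact: cts_bm.
- by apply: (bm_integrable mu mK); exact: bm_cst.
rewrite RintegralZl//; last by apply: (bm_integrable mu mK); exact: cts_bm.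
by rewrite int01// Rintegral_cst// pf_cst muK.
Qed.

End riesz_measure.
End riesz.

(** * Weak-* limits along ultrafilters *)

(** The image ultrafilter contains a compact interval. *)
Lemma ultra_bounded_cvg {R : realType} (Y : Type) (F : set_system Y) {UF : UltraFilter F}
    (g : Y -> R) (C : R) : (\forall y \near F, `|g y| <= C) -> cvg (g y @[y --> F]).
Proof.
move=> gC.
have FI : (g @ F) [set` `[- C, C]].
  by apply: filterS gC => y /=; rewrite in_itv/= ler_norml.
have [l [_ cl]] := @segment_compact R (- C) C (g @ F) _ FI.
apply/cvg_ex; exists l => A Al.
have [//|FnA] := in_ultra_setVsetC (g @^-1` A) UF.
by have [z []] := cl (~` A) A FnA Al.
Qed.

Section alaoglu.
Context {R : realType} (n : nat) {disp : measure_display}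
  {X : topMeasurableType disp} (K : set X).
Hypothesis hK : @baire R disp X K.
Local Notation cts K f := {within K, continuous (f : X -> R)}.
Local Notation ctv F := {within K, continuous (F : X -> 'rV[R]_n)}.
Let mK := baire_measurable hK.

(** The integral against a charge may be computed from any decomposition into a
difference of finite measures. This matters for limits, which do not keep the
parts of a Jordan decomposition mutually singular. *)
Lemma cint_diff (nu : {charge set X -> \bar R}) (m1 m2 : {finite_measure set X -> \bar R})
    (D : set X) f : measurable D ->
  (forall A, measurable A -> A `<=` D -> nu A = (m1 A - m2 A)%E) -> bm D f ->
  cint nu D f = \int[m1]_(x in D) f x - \int[m2]_(x in D) f x.
Proof.
move=> mD nuE bf.
pose J := fine (jordan_pos (svalP (hahn_sig nu)) D) +
  fine (jordan_neg (svalP (hahn_sig nu)) D).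
pose C := J + (fine (m1 D) + fine (m2 D)).
have J0 : 0 <= J by rewrite addr_ge0// fine_ge0.
have C0 : 0 <= fine (m1 D) + fine (m2 D) by rewrite addr_ge0// fine_ge0.
apply: (@bm_functional_eq _ _ _ D (cint nu D)
  (fun f => \int[m1]_(x in D) f x - \int[m2]_(x in D) f x) C) => //.
- by move=> a g h bg bh; exact: cintZD.
- move=> a g h bg bh.
  have lin (mu : {finite_measure set X -> \bar R}) :
      \int[mu]_(x in D) (a * g x + h x) =
      a * \int[mu]_(x in D) g x + \int[mu]_(x in D) h x.
    rewrite RintegralD ?RintegralZl//; apply: (bm_integrable mu mD) => //.
    exact: bmZ.
  by rewrite !lin; ring.
- move=> g M M0 bg gM; rewrite (le_trans (cint_bound nu mD bg gM))// ler_wpM2l//.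
  by rewrite /C lerDl.
- move=> g M M0 bg gM; rewrite (le_trans (ler_normB _ _))//.
  apply: (@le_trans _ _ (M * (fine (m1 D) + fine (m2 D)))).
    by rewrite mulrDr lerD// Rintegral_sup_le.
  by rewrite ler_wpM2l// lerDr.
- move=> A mA AD; rewrite cint_indic// (setIidl AD) nuE//.
  rewrite /Rintegral !integral_indic// (setIidl AD) fineB//; exact: fin_num_measure.
Qed.

Lemma jordan_le_tv (m : @vmeasure R n disp X K) i :
  fine (jordan_pos (svalP (hahn_sig (vcomp m i))) K) <= tvr m K /\
  fine (jordan_neg (svalP (hahn_sig (vcomp m i))) K) <= tvr m K.
Proof.
have [[mP _] [mN _] _ _] := svalP (hahn_sig (vcomp m i)).
have h A : measurable A -> `|val m (K `&` A) 0 i| <= tvr m K.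
  move=> mA; have mKA : measurable (K `&` A) by exact: measurableI.
  rewrite (le_trans (enorm_comp _ _))// -lee_fin fineK ?tv_fin//.
  by rewrite (le_trans (enorm_le_tv m mKA))// tv_mono.
split.
  rewrite jordan_posE cjordan_posE /crestr0 mem_set//= /crestr.
  by rewrite (le_trans (ler_norm _))// h.
rewrite jordan_negE cjordan_negE /crestr0 mem_set//= /crestr /=.
by rewrite (le_trans (ler_norm _))// normrN h.
Qed.

Section limit_functional.
Variables (Y : Type) (F : set_system Y) (UF : UltraFilter F).
Variables (mu : Y -> {finite_measure set X -> \bar R}) (M : R).
Hypothesis muM : \forall y \near F, fine (mu y K) <= M.

Definition limit_fun (f : X -> R) : R := lim (\int[mu y]_(x in K) f x @[y --> F]).

Lemma limit_fun_cvg f : cts K f ->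
  \int[mu y]_(x in K) f x @[y --> F] --> limit_fun f.
Proof.
move=> cf; have [_ [C fC]] := cts_bm hK cf.
apply: (@ultra_bounded_cvg _ _ _ _ _ (`|C| * M)).
apply: filterS muM => y yM.
rewrite (@le_trans _ _ (`|C| * fine (mu y K)))//; last by rewrite ler_wpM2l.
apply: Rintegral_sup_le => //; first exact: cts_bm.
by move=> x Kx; rewrite (le_trans (fC x Kx))// ler_norm.
Qed.

Let limit_linear a f g : cts K f -> cts K g ->
  limit_fun (fun x => a * f x + g x) = a * limit_fun f + limit_fun g.
Proof.
move=> cf cg; apply: cvg_lim => //.
rewrite (_ : (fun y => _) = fun y => a * \int[mu y]_(x in K) f x + \int[mu y]_(x in K) g x).
  apply: cvgD; last exact: limit_fun_cvg.
  by apply: cvgM; [exact: cvg_cst|exact: limit_fun_cvg].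
apply/funext => y; rewrite RintegralD ?RintegralZl//; apply: (bm_integrable (mu y) mK).
- exact: cts_bm.
- by apply: bmZ; exact: cts_bm.
- exact: cts_bm.
Qed.

Let limit_pos f : cts K f -> (forall x, K x -> 0 <= f x) -> 0 <= limit_fun f.
Proof.
move=> cf f0; apply: (cvgr_to_ge (limit_fun_cvg cf)); apply: nearW => y.
exact: Rintegral_ge0.
Qed.

Definition limit_functional : pos_functional K := PosFunctional limit_linear limit_pos.

End limit_functional.

Section charge_to_vmeasure.
Variable nu : 'I_n -> {charge set X -> \bar R}.
Hypothesis nu_off : forall i A, measurable A -> A `&` K = set0 -> nu i A = 0%E.

(* vector measures vanish by convention on sets that are not measurable *)
Let f (A : set X) : 'rV[R]_n :=
  if `[< measurable A >] then \row_i fine (nu i A) else 0.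

Let fE A i : measurable A -> (f A 0 i)%:E = nu i A.
Proof.
by move=> mA; rewrite /f asboolT// mxE fineK//; exact: fin_num_measure.
Qed.

Lemma vmeasure_of_charges_subproof : f \in vmeasure_pred K.
Proof.
apply/asboolP; split.
- apply/rowP => i; apply: EFin_inj; rewrite fE// mxE.
  exact: charge0.
- move=> i F mF tF mU; rewrite /component fE//.
  have := @charge_semi_sigma_additive _ _ _ (nu i) F mF tF mU.
  by under eq_fun do under eq_bigr do rewrite -fE//.
- move=> A mA AK; apply/rowP => i; apply: EFin_inj; rewrite fE// mxE.
  exact: nu_off.
- by move=> A mA; rewrite /f asboolF.
Qed.

Definition vmeasure_of_charges : @vmeasure R n disp X K :=
  exist _ f vmeasure_of_charges_subproof.

Lemma vmeasure_of_chargesE i A : measurable A ->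
  vcomp vmeasure_of_charges i A = nu i A.
Proof. by move=> mA; rewrite -fE. Qed.

End charge_to_vmeasure.

(** The positive and negative parts of each component converge separately to
positive functionals, so that only the representation of positive functionals is
used. *)
Lemma alaoglu (Y : Type) (F : set_system Y) {UF : UltraFilter F}
    (m : Y -> @vmeasure R n disp X K) (M : R) :
  (\forall y \near F, tvr (m y) K <= M) ->
  exists m' : @vmeasure R n disp X K, forall G, ctv G ->
    vint (m y) K G @[y --> F] --> vint m' K G.
Proof.
move=> mM.
pose jp i y : {finite_measure set X -> \bar R} := jordan_pos (svalP (hahn_sig (vcomp (m y) i))).
pose jn i y : {finite_measure set X -> \bar R} := jordan_neg (svalP (hahn_sig (vcomp (m y) i))).
have hp i : \forall y \near F, fine (jp i y K) <= M.
  by apply: filterS mM => y; apply: le_trans; case: (jordan_le_tv (m y) i).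
have hn i : \forall y \near F, fine (jn i y K) <= M.
  by apply: filterS mM => y; apply: le_trans; case: (jordan_le_tv (m y) i).
pose Lp i := limit_functional UF (hp i).
pose Ln i := limit_functional UF (hn i).
pose mp i : {finite_measure set X -> \bar R} := riesz_measure hK (Lp i).
pose mn i : {finite_measure set X -> \bar R} := riesz_measure hK (Ln i).
pose nu i : {charge set X -> \bar R} :=
  cadd (charge_of_finite_measure (mp i)) (cscale (-1) (charge_of_finite_measure (mn i))).
have nuE i A : nu i A = (mp i A - mn i A)%E.
  by rewrite /nu /= /cadd /= cscaleN1.
have nu_off i A : measurable A -> A `&` K = set0 -> nu i A = 0%E.
  move=> mA AK; rewrite nuE /mp /mn /= !riesz_measure_off//.
  by rewrite sube0.
exists (vmeasure_of_charges nu_off) => G cG.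
apply: cvg_sumr => i.
have cGi : cts K (fun x => G x 0 i) by exact: ctv_coord.
rewrite (@cint_diff _ (mp i) (mn i))//; last 2 first.
- by move=> A mA AK; rewrite -nuE; exact: vmeasure_of_chargesE.
- exact: cts_bm.
rewrite /mp /mn /= !riesz_integral//.
exact: (cvgB (limit_fun_cvg UF (hp i) cGi) (limit_fun_cvg UF (hn i) cGi)).
Qed.

End alaoglu.

(** * The torus and the density of continuously differentiable fields *)

Section torus_topology.
Local Open Scope quotient_scope.
Context {R : realType} {d : nat}.
Local Notation torus := (torus R d).
Local Notation pi := (@torus_pi R d).
Implicit Types (x y z : 'rV[R]_d).

Lemma torus_piP x y : lattice_eq x y -> pi x = pi y.
Proof. by move=> xy; apply/eqmodP. Qed.

Lemma torus_pi_eq x y : pi x = pi y -> lattice_eq x y.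
Proof. by move/eqmodP. Qed.

Lemma torus_reprK (q : torus) : pi (repr q) = q.
Proof. exact: reprK. Qed.

Lemma lattice_eq_repr y : lattice_eq (repr (pi y)) y.
Proof. by apply: torus_pi_eq; rewrite torus_reprK. Qed.

Definition periodic_fun {Z : Type} (h : 'rV[R]_d -> Z) := forall x y, lattice_eq x y -> h x = h y.

Lemma periodic_repr {Z : Type} (h : 'rV[R]_d -> Z) y : periodic_fun h ->
  h (repr (pi y)) = h y.
Proof. by move=> hp; apply: hp; exact: lattice_eq_repr. Qed.

Lemma torus_pi_continuous : continuous pi.
Proof. exact: (@pi_continuous _ {eq_quot (lattice_eq_rel R d)}). Qed.

Lemma continuous_torus {Z : topologicalType} (f : torus -> Z) :
  continuous f <-> continuous (f \o pi).
Proof. exact: (@quotient_continuous _ {eq_quot (lattice_eq_rel R d)} Z f). Qed.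

Lemma continuous_repr {Z : topologicalType} (h : 'rV[R]_d -> Z) :
  periodic_fun h -> continuous h -> continuous (h \o (repr : torus -> _)).
Proof.
move=> hp ch; apply/continuous_torus.
by rewrite (_ : _ \o pi = h)//; apply/funext => y /=; exact: periodic_repr.
Qed.

(** The torus is the image of the closed unit cube. *)
Lemma torus_compact : compact [set: torus].
Proof.
have cI : compact [set v : 'rV[R]_d | forall i, `[0, 1]%classic (v ord0 i)].
  by apply: (@rV_compact R d (fun=> `[0, 1]%classic)) => i; exact: segment_compact.
have -> : [set: torus] = pi @` [set v : 'rV[R]_d | forall i, `[0, 1]%classic (v ord0 i)].
  apply/seteqP; split=> // q _.
  pose y := repr q.
  exists (\row_i (y 0 i - (Num.floor (y 0 i))%:~R)).
    move=> i /=; rewrite mxE in_itv/=; have /andP[h1 h2] := floor_itv (y 0 i).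
    by rewrite subr_ge0 h1/= lerBlDr addrC; move: h2; rewrite intrD => /ltW.
  rewrite -(torus_reprK q); apply: torus_piP; apply/forallP => i.
  by rewrite mxE addrAC subrr add0r rpredN intr_int.
apply: continuous_compact => //.
by apply: continuous_subspaceT; exact: torus_pi_continuous.
Qed.

Lemma torus_open (U : set torus) : open U <-> open (pi @^-1` U).
Proof. by []. Qed.

(** The distance to the complement, truncated at 1 to be defined when the
complement is empty, is positive exactly on the open set. *)
Lemma torus_open_pos (U : set torus) : open U ->
  exists2 f : torus -> R, continuous f & U = [set q | 0 < f q].
Proof.
move=> oU; pose C := [set z | ~ U (pi z)].
pose E y := [set r : R | r = 1 \/ exists2 z, C z & r = `|y - z|].
have E0 y : has_inf (E y).
  by split; [exists 1; left|exists 0 => _ [->//|[z _ ->]]].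
pose g y := inf (E y).
have gp : periodic_fun g.
  suff h x y : lattice_eq x y -> E y `<=` E x.
    move=> x y xy; rewrite /g; congr inf; apply/seteqP; split; apply: h => //.
    by apply: torus_pi_eq; rewrite (torus_piP xy).
  move=> xy r [->|[z Cz ->]]; [by left|right; exists (z + (x - y))].
    rewrite /C/= (torus_piP (y := z))//; apply/forallP => i.
    rewrite !mxE addrAC subrr add0r.
    by move/forallP: xy => /(_ i).
  by congr (`|_|); apply/rowP => i; rewrite !mxE; ring.
have glip x y : g x <= g y + `|x - y|.
  rewrite -lerBlDr; apply: lb_le_inf; first by case: (E0 y).
  move=> r [->|[z Cz ->]]; rewrite lerBlDr.
    rewrite (@le_trans _ _ 1) ?lerDl//; apply: ge_inf; first by case: (E0 x).
    by left.
  apply: (@le_trans _ _ `|x - z|).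
    by apply: ge_inf; [case: (E0 x)|right; exists z].
  by rewrite [leRHS]addrC; have := ler_normD (x - y) (y - z); rewrite subrKA.
have cg : continuous g.
  move=> x A /nbhs_ballP[e e0 eA]; apply/nbhs_ballP; exists e => // y.
  rewrite -ball_normE /= => xy; apply: eA; rewrite -ball_normE /=.
  have h1 := glip x y; have h2 := glip y x; rewrite distrC in h2.
  by rewrite ltr_norml; apply/andP; split; lra.
exists (g \o (repr : torus -> _)); first exact: continuous_repr.
apply/seteqP; split=> q /=.
  rewrite -{1}(torus_reprK q) => Uq.
  have /nbhs_ballP[e e0 he] : nbhs (repr q) (pi @^-1` U).
    by apply: open_nbhs_nbhs; split=> //; exact/torus_open.
  have e1 : 0 < Num.min 1 e by rewrite lt_min ltr01.
  apply: (lt_le_trans e1); apply: lb_le_inf; first by case: (E0 (repr q)).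
  move=> r [->|[z Cz ->]]; first by rewrite ge_min lexx.
  rewrite ge_min; apply/orP; right; rewrite leNgt; apply/negP => hz.
  by apply: Cz; apply: he; rewrite -ball_normE.
move=> g0; apply: contrapT => nU.
have : g (repr q) <= `|repr q - repr q|.
  apply: ge_inf; first by case: (E0 (repr q)).
  by right; exists (repr q) => //; rewrite /C /= torus_reprK.
by rewrite subrr normr0 leNgt g0.
Qed.

Lemma torus_measurable_fun (f : torus -> R) : continuous f -> measurable_fun setT f.
Proof.
move=> cf; apply: (measurability _ (RGenOpens.measurableE R)) => //.
move=> _ [_ [a [b ->] <-]]; rewrite setTI; apply: sub_sigma_algebra.
by move/continuousP: cf; apply; exact: interval_open.
Qed.

Lemma torus_baire : @baire R _ torus setT.
Proof.
split.
- exact: torus_compact.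
- exact: measurableT.
- move=> f cf; apply: torus_measurable_fun.
  by apply/continuous_subspace_setT.
- move=> S mS; rewrite setIT; move: S mS; apply: smallest_sub.
    exact: smallest_sigma_algebra.
  move=> U oU; apply: sub_sigma_algebra.
  have [f cf ->] := torus_open_pos oU.
  exists f; first exact: continuous_subspaceT.
  by apply/seteqP; split=> q /=; [case|].
Qed.

Lemma continuous_bmv {n : nat} (F : torus -> 'rV[R]_n) : continuous F -> bmv setT F.
Proof. by move=> cF; apply: (ctv_bmv torus_baire); exact: continuous_subspaceT. Qed.

End torus_topology.

Section smooth_density.
Local Open Scope quotient_scope.
Context {R : realType} {d : nat}.
Local Notation torus := (torus R d).
Local Notation pi := (@torus_pi R d).
Local Notation e_ j := (delta_mx 0 j : 'rV[R]_d).
Implicit Types (x y z : 'rV[R]_d) (h : 'rV[R]_d -> R).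

Definition C1_periodic h := [/\ periodic_fun h, continuous h &
  forall j, (forall y, derivable h y (e_ j)) /\ continuous (fun y => 'D_(e_ j) h y)].

Lemma C1p_cst (a : R) : C1_periodic (fun=> a).
Proof.
split=> //; first by move=> y; exact: (@cvg_cst _ _ _ (nbhs y)).
move=> j; split; first by move=> y; exact: derivable_cst.
rewrite (_ : (fun y => 'D_(e_ j) (fun=> a) y) = fun=> 0);
  first by move=> y; exact: (@cvg_cst _ _ _ (nbhs y)).
by apply/funext => y; exact: derive_cst.
Qed.

Lemma C1pD h k : C1_periodic h -> C1_periodic k -> C1_periodic (fun y => h y + k y).
Proof.
move=> [hp hc hd] [kp kc kd]; split.
- by move=> x y xy; rewrite (hp _ _ xy) (kp _ _ xy).
- by move=> y; exact: (cvgD (hc y) (kc y)).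
- move=> j; have [dh ch] := hd j; have [dk ck] := kd j; split.
    by move=> y; exact: derivableD.
  rewrite (_ : (fun y => _) = fun y => 'D_(e_ j) h y + 'D_(e_ j) k y).
    by move=> y; exact: (cvgD (ch y) (ck y)).
  by apply/funext => y; rewrite -deriveD.
Qed.

Lemma C1pM h k : C1_periodic h -> C1_periodic k -> C1_periodic (fun y => h y * k y).
Proof.
move=> [hp hc hd] [kp kc kd]; split.
- by move=> x y xy; rewrite (hp _ _ xy) (kp _ _ xy).
- by move=> y; exact: (cvgM (hc y) (kc y)).
- move=> j; have [dh ch] := hd j; have [dk ck] := kd j; split.
    by move=> y; exact: derivableM.
  rewrite (_ : (fun y => _) = fun y => h y * 'D_(e_ j) k y + k y * 'D_(e_ j) h y).
    by move=> y; exact: (cvgD (cvgM (hc y) (ck y)) (cvgM (kc y) (ch y))).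
  by apply/funext => y; rewrite [LHS]deriveM.
Qed.

Lemma C1pV h : C1_periodic h -> (forall y, h y != 0) -> C1_periodic (fun y => (h y)^-1).
Proof.
move=> [hp hc hd] h0; split.
- by move=> x y xy; rewrite (hp _ _ xy).
- by move=> y; exact: (cvgV (h0 y) (hc y)).
- move=> j; have [dh ch] := hd j; split.
    by move=> y; exact: derivableV.
  rewrite (_ : (fun y => _) = fun y => - ((h y)^-1 * (h y)^-1) * 'D_(e_ j) h y).
    move=> y; have hV : (h z)^-1 @[z --> y] --> (h y)^-1 by exact: (cvgV (h0 y) (hc y)).
    exact: (cvgM (cvgN (cvgM hV hV)) (ch y)).
  apply/funext => y; rewrite [LHS]deriveV//.
  by rewrite /GRing.scale /= -expr2 exprVn.
Qed.

Lemma C1p_sum (I : Type) (r : seq I) (h : I -> 'rV[R]_d -> R) :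
  (forall i, C1_periodic (h i)) -> C1_periodic (fun y => \sum_(i <- r) h i y).
Proof.
move=> ch; elim: r => [|i r IH].
  by under eq_fun do rewrite big_nil; exact: C1p_cst.
by under eq_fun do rewrite big_cons; exact: C1pD.
Qed.

Lemma C1p_prod (I : Type) (r : seq I) (h : I -> 'rV[R]_d -> R) :
  (forall i, C1_periodic (h i)) -> C1_periodic (fun y => \prod_(i <- r) h i y).
Proof.
move=> ch; elim: r => [|i r IH].
  by under eq_fun do rewrite big_nil; exact: C1p_cst.
by under eq_fun do rewrite big_cons; exact: C1pM.
Qed.

Lemma C1pX h n : C1_periodic h -> C1_periodic (fun y => h y ^+ n).
Proof.
move=> ch; elim: n => [|n IH]; first exact: C1p_cst.
by under eq_fun do rewrite exprS; exact: C1pM.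
Qed.

Lemma C1p_Ck1 (h : 'rV[R]_d -> 'rV[R]_d) : (forall i, C1_periodic (fun y => h y 0 i)) ->
  Ck 1 (h \o (repr : torus -> _)).
Proof.
move=> hC.
have hp : periodic_fun h.
  by move=> x y xy; apply/rowP => i; case: (hC i) => /(_ _ _ xy).
have coordc (f : 'rV[R]_d -> 'rV[R]_d) : (forall i, continuous (fun y => f y 0 i)) -> continuous f.
  move=> fc; apply/continuous_subspace_setT/ctv_coordP => i.
  exact: (iffLR (continuous_subspace_setT _) (fc i)).
have hc : continuous h by apply: coordc => i; case: (hC i).
have hE : (h \o (repr : torus -> _)) \o pi = h.
  by apply/funext => y /=; exact: periodic_repr.
split; first exact: continuous_repr.
move=> j; rewrite /partial hE.
have dh y : derivable h y (e_ j).
  by apply/derivable_mxP => i k; rewrite ord1; case: (hC k) => _ _ /(_ j)[].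
split=> //; split=> //.
apply: (@continuous_repr R d _ (fun y => 'D_(e_ j) h y)).
  move=> x y xy.
  change (lim ((fun t => t^-1 *: (h (t *: e_ j + x) - h x)) @ 0^') =
    lim ((fun t => t^-1 *: (h (t *: e_ j + y) - h y)) @ 0^')).
  suff -> : (fun t : R => t^-1 *: (h (t *: e_ j + x) - h x)) =
    (fun t : R => t^-1 *: (h (t *: e_ j + y) - h y)) by [].
  apply/funext => t; rewrite (hp _ _ xy) (hp _ (t *: e_ j + y))//.
  apply/forallP => i; rewrite !mxE opprD addrACA subrr add0r.
  by move/forallP: xy.
apply: coordc => i.
rewrite (_ : (fun y => _) = fun y => 'D_(e_ j) (fun x => h x 0 i) y).
  by case: (hC i) => _ _ /(_ j)[].
by apply/funext => y; rewrite derive_mx// mxE.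
Qed.

Lemma cos_sin_2piz (k : int) :
  cos (2 * trigo.pi * k%:~R) = 1 :> R /\ sin (2 * trigo.pi * k%:~R) = 0 :> R.
Proof.
have h (m : nat) : cos (2 * trigo.pi * m%:R) = 1 :> R /\ sin (2 * trigo.pi * m%:R) = 0 :> R.
  have -> : 2 * trigo.pi * m%:R = 0 + trigo.pi *+ 2 *+ m :> R.
    by rewrite add0r mulr_natr mulr_natl.
  by rewrite (periodicn (@cosD2pi R)) (periodicn (@sinD2pi R)) cos0 sin0.
case: k => m; first exact: h.
by rewrite NegzE mulrNz mulrN cosN sinN; have [-> ->] := h m.+1; rewrite oppr0.
Qed.

Lemma cos2pi_eq1_int (t : R) : cos (2 * trigo.pi * t) = 1 -> t \is a Num.int.
Proof.
move=> ct; have /andP[h1 h2] := floor_itv t.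
set k := Num.floor t in h1 h2; rewrite intrD in h2.
pose s := t - k%:~R.
have s0 : 0 <= s by rewrite subr_ge0.
have s1 : s < 1 by rewrite ltrBlDl.
have cs : cos (2 * trigo.pi * s) = 1.
  have [ck sk] := cos_sin_2piz k.
  by rewrite /s mulrBr cosB ck sk mulr0 addr0 mulr1.
have pi0 := @pi_gt0 R.
suff s_eq0 : s = 0.
  by rewrite -(subrK k%:~R t) -/s s_eq0 add0r intr_int.
have h (u : R) : 0 <= u <= 2^-1 -> cos (2 * trigo.pi * u) = 1 -> u = 0.
  move=> /andP[u0 u1] cu.
  have u2 : 2 * trigo.pi * u \in `[0, trigo.pi].
    by rewrite in_itv/=; apply/andP; split; nra.
  have z2 : (0 : R) \in `[0, trigo.pi] by rewrite in_itv/= lexx ltW.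
  have /eqP : 2 * trigo.pi * u = 0 by apply: (cos_inj u2 z2); rewrite cos0.
  by rewrite !mulf_eq0 (gt_eqF pi0) pnatr_eq0/= => /eqP.
have [sle|sgt] := leP s 2^-1; first by apply: h => //; rewrite s0.
have : 1 - s = 0.
  apply: h; first by apply/andP; split; lra.
  have [] := cos_sin_2piz 1; rewrite mulr1z mulr1 => c1 s1'.
  by rewrite mulrBr mulr1 cosB cs c1 s1' mul0r addr0 mulr1.
lra.
Qed.

Definition cosc (i : 'I_d) y : R := cos (2 * trigo.pi * y 0 i).
Definition sinc (i : 'I_d) y : R := sin (2 * trigo.pi * y 0 i).

Let angleE x y i : lattice_eq x y -> exists k : int,
  2 * trigo.pi * x 0 i = 2 * trigo.pi * y 0 i + 2 * trigo.pi * k%:~R.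
Proof.
move=> /forallP/(_ i)/intrP[k hk]; exists k.
by rewrite -mulrDr -hk addrC subrK.
Qed.

Lemma derivable_coord2pi y v i : is_derive y v (fun y => 2 * trigo.pi * y 0 i) (2 * trigo.pi * v 0 i).
Proof.
apply: (@is_deriveZ _ _ _ (fun y : 'rV[R]_d => y 0 i) (2 * trigo.pi) y v (v 0 i)).
have /derivable_mxP h := @derivable_id R 'rV[R]_d y v.
apply: DeriveDef; first exact: (h 0 i).
have := derive_mx (@derivable_id R 'rV[R]_d y v).
by rewrite derive_id => /matrixP/(_ 0 i); rewrite mxE.
Qed.

Lemma derive_line (u : 'rV[R]_d -> R) y v :
  'D_1 (fun t : R => u (t *: v + y)) 0 = 'D_v u y.
Proof.
change (lim ((fun t : R => t^-1 *: (u ((t *: 1 + 0) *: v + y) - u (0 *: v + y))) @ 0^') =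
  lim ((fun t : R => t^-1 *: (u (t *: v + y) - u y)) @ 0^')).
suff -> : (fun t : R => t^-1 *: (u ((t *: 1 + 0) *: v + y) - u (0 *: v + y))) =
  (fun t : R => t^-1 *: (u (t *: v + y) - u y)) by [].
by apply/funext => t; rewrite addr0 scale0r add0r [t *: 1]mulr1.
Qed.

(** Directional derivatives are derivatives along a line, which reduces this chain
rule to the one in a single variable. *)
Lemma is_derive_comp1 (f : R -> R) (u : 'rV[R]_d -> R) y v (a b : R) :
  is_derive (u y) 1 f a -> is_derive y v u b -> is_derive y v (f \o u) (a * b).
Proof.
move=> [df Df] [du Du].
have u1 : derivable (fun t : R => u (t *: v + y)) 0 1 := iffLR (derivable1P u y v) du.
have uE : 'D_1 (fun t : R => u (t *: v + y)) 0 = b.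
  by rewrite -Du derive_line.
have f1 : is_derive (u (0 *: v + y)) 1 f a.
  by rewrite scale0r add0r; exact: DeriveDef.
have [dc Dc] := is_derive1_comp f1 (DeriveDef u1 uE).
apply: DeriveDef; first by apply/derivable1P; exact: dc.
by rewrite -Dc (derive_line (f \o u)).
Qed.

Let C1p_angle (f g : R -> R) i : (forall t : R, is_derive t 1 f (g t)) ->
  continuous f -> continuous g ->
  (forall t (k : int), f (t + 2 * trigo.pi * k%:~R) = f t) ->
  C1_periodic (fun y => f (2 * trigo.pi * y 0 i)).
Proof.
move=> fg cf cg fp.
have ca : continuous (fun y : 'rV[R]_d => 2 * trigo.pi * y 0 i).
  by move=> y; exact: (cvgM (cvg_cst (2 * trigo.pi)) (@coord_continuous R 1 d 0 i y)).
have dE y j := is_derive_comp1 (fg (2 * trigo.pi * y 0 i)) (derivable_coord2pi y (e_ j) i).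
split.
- by move=> x y xy; have [k ->] := angleE i xy; rewrite fp.
- move=> y; exact: (cvg_comp _ _ (ca y) (cf _)).
- move=> j; split; first by move=> y; case: (dE y j).
  rewrite (_ : (fun y => _) = fun y => g (2 * trigo.pi * y 0 i) *
    (2 * trigo.pi * (e_ j) 0 i)).
    move=> y; have h : (fun z : 'rV[R]_d => g (2 * trigo.pi * z 0 i)) @ y -->
      g (2 * trigo.pi * y 0 i).
      exact: (cvg_comp _ _ (ca y) (cg _)).
    exact: (cvgM h (cvg_cst _)).
  by apply/funext => y; have [_ <-] := dE y j.
Qed.

Lemma C1p_cosc i : C1_periodic (cosc i).
Proof.
apply: (@C1p_angle (@cos R) (fun t => - sin t)).
- exact: continuous_cos.
- by move=> t; exact: (cvgN (@continuous_sin R t)).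
- by move=> t k; have [ck sk] := cos_sin_2piz k; rewrite cosD ck sk mulr1 mulr0 subr0.
Qed.

Lemma C1p_sinc i : C1_periodic (sinc i).
Proof.
apply: (@C1p_angle (@sin R) (@cos R)).
- exact: continuous_sin.
- exact: continuous_cos.
- by move=> t k; have [ck sk] := cos_sin_2piz k; rewrite sinD ck sk mulr1 mulr0 addr0.
Qed.

(** Each factor equals [(1 + cos (2 pi (y i - z i))) / 2], in a form that shows its
smoothness in [y]. Hence the kernel lies between 0 and 1, and equals 1 only for
equal points of the torus. *)
Definition kern y z : R :=
  \prod_i ((1 + cosc i y * cosc i z + sinc i y * sinc i z) / 2).

Let factorE y z i : (1 + cosc i y * cosc i z + sinc i y * sinc i z) / 2 =
  (1 + cos (2 * trigo.pi * (y 0 i - z 0 i))) / 2.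
Proof. by rewrite mulrBr cosB addrA. Qed.

Let factor01 y z i : 0 <= (1 + cosc i y * cosc i z + sinc i y * sinc i z) / 2 <= 1.
Proof.
rewrite factorE; have := cos_geN1 (2 * trigo.pi * (y 0 i - z 0 i)).
have := cos_le1 (2 * trigo.pi * (y 0 i - z 0 i)); move: (cos _) => c; lra.
Qed.

Lemma kern_ge0 y z : 0 <= kern y z.
Proof. by apply: prodr_ge0 => i _; case/andP: (factor01 y z i). Qed.

Lemma kern_eq1 y : kern y y = 1.
Proof.
rewrite /kern big1// => i _; rewrite factorE subrr mulr0 cos0.
by rewrite divff.
Qed.

Lemma kern_lt1 y z : ~~ lattice_eq y z -> kern y z < 1.
Proof.
rewrite negb_forall => /existsP[i yz]; rewrite /kern (bigD1 i)//=.
set p := \prod_(j | _) _.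
have p1 : p <= 1 by apply: prodr_ile1 => j _; exact: factor01.
have p0 : 0 <= p by apply: prodr_ge0 => j _; case/andP: (factor01 y z j).
have /andP[f0 f1] := factor01 y z i.
apply: (le_lt_trans (ler_piMr f0 p1)); rewrite lt_neqAle f1 andbT.
apply/eqP => f_eq1; move/negP: yz; apply; apply: cos2pi_eq1_int.
move: f_eq1; rewrite factorE; move: (cos _) => c; lra.
Qed.

Lemma C1p_kern z : C1_periodic (kern ^~ z).
Proof.
apply: (@C1p_prod _ _ (fun i y => (1 + cosc i y * cosc i z + sinc i y * sinc i z) / 2)) => i.
apply: C1pM; last exact: C1p_cst.
apply: C1pD; last by apply: C1pM; [exact: C1p_sinc|exact: C1p_cst].
by apply: C1pD; [exact: C1p_cst|apply: C1pM; [exact: C1p_cosc|exact: C1p_cst]].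
Qed.

Lemma kern_continuous2 :
  continuous (fun p : torus * torus => kern (repr p.1) (repr p.2)).
Proof.
have cf (h : 'rV[R]_d -> R) : C1_periodic h -> continuous (fun p : torus * torus => h (repr p.1)).
  move=> [hp hc _] p; have c := continuous_repr hp hc.
  apply: (@continuous_comp (torus * torus)%type torus R fst (h \o repr)).
    exact: cvg_fst.
  exact: c.
have cs (h : 'rV[R]_d -> R) : C1_periodic h -> continuous (fun p : torus * torus => h (repr p.2)).
  move=> [hp hc _] p; have c := continuous_repr hp hc.
  apply: (@continuous_comp (torus * torus)%type torus R snd (h \o repr)).
    exact: cvg_snd.
  exact: c.
suff h (r : seq 'I_d) : continuous (fun p : torus * torus =>
    \prod_(i <- r) ((1 + cosc i (repr p.1) * cosc i (repr p.2) +
      sinc i (repr p.1) * sinc i (repr p.2)) / 2)) by exact: h.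
elim: r => [|i r IH] p.
  by under eq_fun do rewrite big_nil; exact: cvg_cst.
rewrite (_ : (fun p => _) = fun p : torus * torus =>
    (1 + cosc i (repr p.1) * cosc i (repr p.2) + sinc i (repr p.1) * sinc i (repr p.2)) / 2 *
    \prod_(i <- r) ((1 + cosc i (repr p.1) * cosc i (repr p.2) +
      sinc i (repr p.1) * sinc i (repr p.2)) / 2)); last first.
  by apply/funext => q; rewrite big_cons.
have c1 := cf _ (C1p_cosc i) p; have c2 := cs _ (C1p_cosc i) p.
have s1 := cf _ (C1p_sinc i) p; have s2 := cs _ (C1p_sinc i) p.
apply: (cvgM _ (IH p)).
apply: cvgM; last exact: cvg_cst.
apply: cvgD; last exact: (cvgM s1 s2).
by apply: cvgD; [exact: cvg_cst|exact: (cvgM c1 c2)].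
Qed.

End smooth_density.

Section C1_density.
Local Open Scope quotient_scope.
Context {R : realType} {d : nat}.
Local Notation torus := (torus R d).
Local Notation pi := (@torus_pi R d).

(** The weighted means of the values of [F] at the points of a net, with weights
proportional to a high power of the kernel, approximate [F] uniformly, since the
weights concentrate near the point. *)
Lemma C1_dense (F : torus -> 'rV[R]_d) (e : R) : continuous F -> 0 < e ->
  exists G : torus -> 'rV[R]_d, Ck 1 G /\ forall x i, `|F x 0 i - G x 0 i| <= e.
Proof.
move=> cF e0.
have cFi i : continuous (fun x => F x 0 i).
  by apply/continuous_subspace_setT; apply: ctv_coord; exact: continuous_subspaceT.
have cF1 i : continuous (fun p : torus * torus => F p.1 0 i).
  move=> p; apply: (@continuous_comp (torus * torus)%type torus R fst (fun x => F x 0 i)).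
    exact: cvg_fst.
  exact: cFi.
have cF2 i : continuous (fun p : torus * torus => F p.2 0 i).
  move=> p; apply: (@continuous_comp (torus * torus)%type torus R snd (fun x => F x 0 i)).
    exact: cvg_snd.
  exact: cFi.
pose k (x z : torus) := kern (repr x) (repr z).
have k0 x z : 0 <= k x z by exact: kern_ge0.
have k1 x : k x x = 1 by exact: kern_eq1.
pose close x z := forall i, `|F x 0 i - F z 0 i| < e / 2.
(* away from the diagonal the kernel is bounded by some q < 1 *)
have [q [q0 q1 hq]] : exists q : R, [/\ 0 < q, q < 1 & forall x z, close x z \/ k x z <= q].
  have : \forall n \near \oo, [set: torus * torus] `<=`
      [set p | close p.1 p.2 \/ k p.1 p.2 < 1 - n.+2%:R^-1].
    have /compact_near_coveringP : compact [set: torus * torus].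
      by rewrite -setXTT; apply: compact_setX; exact: torus_compact.
    apply => -[x z] _.
    have [c|nc] := pselect (close x z).
      have : \forall p \near (x, z), close p.1 p.2.
        have h i : \forall p \near (x, z), `|F p.1 0 i - F p.2 0 i| < e / 2.
          have : `|F p.1 0 i - F p.2 0 i| @[p --> (x, z)] --> `|F x 0 i - F z 0 i|.
            exact: (cvg_norm (cvgB (cF1 i (x, z)) (cF2 i (x, z)))).
          by move/cvgr_lt; apply.
        exact: (filter_forall _ h).
      move=> hn.
      exists ([set p | close p.1 p.2], setT) => /=; first by split=> //; exact: filterT.
      by move=> [p n] /= [hp _]; left.
    have kxz : k x z < 1.
      apply: kern_lt1; apply/negP => /torus_piP; rewrite !torus_reprK => xz.
      by apply: nc => i; rewrite xz subrr normr0 divr_gt0.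
    have [N [_ hN]] : exists N : nat, True /\ forall n, (N <= n)%N ->
        (1 + k x z) / 2 < 1 - n.+2%:R^-1.
      exists (Num.truncn (2 / (1 - k x z))); split=> // n nN.
      have kx0 : 0 < 1 - k x z by rewrite subr_gt0.
      have h : 2 / (1 - k x z) < n.+2%:R.
        by rewrite (lt_le_trans (truncnS_gt _))// ler_nat ltnS (leq_trans nN).
      have : n.+2%:R^-1 < (1 - k x z) / 2.
        by rewrite -[ltRHS]invrK ltf_pV2 ?posrE ?invr_gt0 ?divr_gt0// invf_div.
      by move: (n.+2%:R^-1 : R) (k x z) => w v; lra.
    exists ([set p | k p.1 p.2 < (1 + k x z) / 2], [set n | (N <= n)%N]) => /=.
      split; last by exists N.
      have /cvgr_lt := @kern_continuous2 R d (x, z); apply.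
      by rewrite /= -/(k x z); lra.
    move=> [p n] /= [hp hn]; right; rewrite (lt_trans hp)//; exact: hN.
  move=> [n _ /(_ n (leqnn n)) hn]; exists (1 - n.+2%:R^-1).
  have h2 : 0 < n.+2%:R^-1 :> R by rewrite invr_gt0.
  have h3 : n.+2%:R^-1 < 1 :> R by rewrite invf_lt1// ltr1n.
  split; [by rewrite subr_gt0|by rewrite gtrBl|].
  by move=> x z; have [|/ltW] := hn (x, z) I; [left|right].
have [q' [qq' q'1]] : exists q' : R, q < q' /\ q' < 1.
  by exists ((1 + q) / 2); split; lra.
have q'0 : 0 < q' by exact: lt_trans qq'.
(* some point of the net has a kernel value above q' > q, so the points far
   from x get weights at most (q / q') ^ N *)
have [D hD] : exists D : seq torus, forall x, exists2 z, z \in D & q' < k x z.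
  have := @torus_compact R d; rewrite compact_cover => cc.
  have [|x _|D _ hD] := cc torus setT (fun z => [set x | q' < k x z]).
  - move=> z _; have [kp kc _] := C1p_kern (repr z).
    have ck := continuous_repr kp kc.
    rewrite (_ : [set x | _] = (kern ^~ (repr z) \o (repr : torus -> _)) @^-1` [set t | q' < t])//.
    by move/continuousP: ck; apply; exact: open_gt.
  - by exists x => //=; rewrite k1.
  - by exists (finmap.enum_fset D) => x; have [z /= zD hz] := hD x I; exists z.
have [M M0 FM] : exists2 M : R, 0 < M & forall x i, `|F x 0 i| <= M.
  have h i : exists M : R, forall x, `|F x 0 i| <= M.
    have [_ [M hM]] := cts_bm torus_baire (continuous_subspaceT (cFi i)).
    by exists M => x; exact: hM.
  have [Mi hMi] := choice h.
  exists (1 + \sum_i `|Mi i|); first by rewrite ltr_pwDl// sumr_ge0.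
  move=> x i; rewrite (le_trans (hMi i x))// (le_trans (ler_norm _))//.
  by rewrite (bigD1 i)//= addrCA lerDl addr_ge0// sumr_ge0.
pose n := size D.
have [N hN] : exists N : nat, 2 * M * (n%:R * (q / q') ^+ N) <= e / 2.
  have r1 : `|q / q'| < 1 by rewrite ger0_norm ?divr_ge0 ?(ltW q0) ?(ltW q'0)// ltr_pdivrMr// mul1r.
  have h : 2 * M * (n%:R * (q / q') ^+ N) @[N --> \oo] --> (0 : R).
    rewrite -(mulr0 (2 * M)) -(mulr0 n%:R).
    by apply: cvgMl_tmp; apply: cvgMl_tmp; exact: cvg_expr.
  have e20 : 0 < e / 2 by rewrite divr_gt0.
  by move/cvgr_le: h => /(_ _ e20)[N _ /(_ N (leqnn N)) hN]; exists N.
pose S y := \sum_(z <- D) kern y (repr z) ^+ N.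
have Sge y : q' ^+ N <= S y.
  have [z zD hz] := hD (pi y).
  rewrite /S (perm_big _ (perm_to_rem zD)) big_cons.
  rewrite (@le_trans _ _ (kern y (repr z) ^+ N)) ?lerDl ?sumr_ge0//; last first.
    by move=> w _; rewrite exprn_ge0// kern_ge0.
  have [kp _ _] := C1p_kern (repr z); rewrite -(periodic_repr y kp).
  by rewrite lerXn2r ?nnegrE ?(ltW q'0) ?kern_ge0// ltW.
have S0 y : 0 < S y by rewrite (lt_le_trans _ (Sge y))// exprn_gt0.
pose h y := \sum_(z <- D) (kern y (repr z) ^+ N / S y) *: F z.
exists (h \o (repr : torus -> _)); split.
  apply: C1p_Ck1 => i.
  under eq_fun do (rewrite summxE; under eq_bigr do rewrite mxE).
  apply: (@C1p_sum R d _ _ (fun (z : torus) y => kern y (repr z) ^+ N / S y * F z 0 i)) => z.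
  apply: C1pM; last exact: C1p_cst.
  apply: C1pM; first by apply: C1pX; exact: C1p_kern.
  apply: C1pV; last by move=> y; rewrite gt_eqF.
  by apply: (@C1p_sum R d _ _ (fun (z : torus) y => kern y (repr z) ^+ N)) => w; apply: C1pX; exact: C1p_kern.
move=> x i; rewrite /h /= summxE.
have Sx := S0 (repr x).
have -> : F x 0 i = \sum_(z <- D) kern (repr x) (repr z) ^+ N / S (repr x) * F x 0 i.
  by rewrite -mulr_suml -mulr_suml divff ?mul1r// gt_eqF.
rewrite -sumrB (le_trans (ler_norm_sum _ _ _))//.
apply: (@le_trans _ _ (\sum_(z <- D) (kern (repr x) (repr z) ^+ N / S (repr x) * (e / 2) +
    (q / q') ^+ N * (2 * M)))).
  apply: ler_sum => z _; rewrite !mxE -mulrBr normrM ger0_norm; last first.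
    by rewrite divr_ge0 ?exprn_ge0 ?kern_ge0 ?ltW.
  have w0 : 0 <= kern (repr x) (repr z) ^+ N / S (repr x).
    by rewrite divr_ge0 ?exprn_ge0 ?kern_ge0 ?ltW.
  have [c|kq] := hq x z.
    rewrite (@le_trans _ _ (kern (repr x) (repr z) ^+ N / S (repr x) * (e / 2)))//.
      by rewrite ler_wpM2l// ltW.
    by rewrite lerDl mulr_ge0 ?mulr_ge0 ?exprn_ge0 ?divr_ge0 ?ltW.
  rewrite (@le_trans _ _ ((q / q') ^+ N * (2 * M)))//; last first.
    by rewrite lerDr mulr_ge0// divr_ge0// ltW.
  rewrite ler_pM//; last first.
    by rewrite (le_trans (ler_normB _ _))// mulr2n mulrDl !mul1r lerD.
  rewrite expr_div_n ler_pM ?exprn_ge0 ?invr_ge0 ?kern_ge0 ?(ltW Sx)//.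
    by rewrite lerXn2r ?nnegrE ?kern_ge0 ?(ltW q0).
  by rewrite lef_pV2 ?posrE ?exprn_gt0.
rewrite big_split/= -mulr_suml -mulr_suml divff ?gt_eqF// mul1r.
rewrite big_const_seq count_predT iter_addr_0 -/n -[X in _ + X]mulr_natl.
by move: hN; move: ((q / q') ^+ N) (n%:R : R) => w p hN; lra.
Qed.

End C1_density.

(** * The space-time slab *)

Section slab.
Context {R : realType} {d : nat} (T : R).
Local Notation torus := (torus R d).
Local Notation Q := (R * torus)%type.
Local Notation slab := (@slab R d T).
Implicit Types (f : Q -> R) (F : Q -> 'rV[R]_d).

Lemma slab_compact : compact slab.
Proof. by apply: compact_setX; [exact: segment_compact|exact: torus_compact]. Qed.

Lemma slab_measurable : measurable slab.
Proof. by apply: measurableX; [exact: measurable_itv|exact: measurableT]. Qed.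

Lemma slabE q : slab q <-> 0 <= q.1 <= T.
Proof. by rewrite /Defs.slab /=; split=> [[]|h]; rewrite ?in_itv//=; split; rewrite ?in_itv. Qed.

Lemma slice_cvg {Z : topologicalType} (f : Q -> Z) (q : Q) : {within slab, continuous f} -> slab q ->
  forall {I : Type} (E : set_system I) {FE : Filter E} (t : I -> R) (x : I -> torus),
  (forall i, 0 <= t i <= T) -> t i @[i --> E] --> q.1 -> x i @[i --> E] --> q.2 ->
  f (t i, x i) @[i --> E] --> f q.
Proof.
move=> /subspace_continuousP cf sq I E FE t x tT tq xq.
have h : (t i, x i) @[i --> E] --> within slab (nbhs q).
  move=> A /= nA; have := @cvg_pair _ _ _ E (nbhs q.1) (nbhs q.2) FE _ _ t x tq xq.
  move=> /(_ _ _ [set p | slab p -> A p] nA) h.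
  change (\forall i \near E, A (t i, x i)).
  have {}h : \forall i \near E, slab (t i, x i) -> A (t i, x i) := h.
  by apply: filterS h => i; apply; apply/slabE; exact: tT.
exact: (cvg_trans (cvg_app f h) (cf q sq)).
Qed.

Lemma slice_cts {Z : topologicalType} (f : Q -> Z) t : {within slab, continuous f} -> 0 <= t <= T ->
  continuous (fun x => f (t, x)).
Proof.
move=> cf tT x.
apply: (@slice_cvg _ f (t, x) cf _ _ (nbhs x) _ (fun=> t) id) => //.
exact: cvg_cst.
Qed.

(** Freezing the time at the left end of the cells of length [1 / n.+1] gives
functions that are measurable, as countable gluings of functions of space, and
converge pointwise. *)
Lemma slab_measurable_fun f : {within slab, continuous f} -> measurable_fun slab f.
Proof.
move=> cf.
pose I n k : set R := `[0, T]%classic `&` `[k%:R / n.+1%:R, k.+1%:R / n.+1%:R[%classic.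
pose g n (t : R) : R := (Num.truncn (t * n.+1%:R))%:R / n.+1%:R.
have gI n k t : 0 <= t <= T -> (`[k%:R / n.+1%:R, k.+1%:R / n.+1%:R[%classic t <->
    Num.truncn (t * n.+1%:R) = k).
  move=> /andP[t0 _].
  have tn0 : 0 <= t * n.+1%:R by rewrite mulr_ge0.
  rewrite /= in_itv/= ler_pdivrMr// ltr_pdivlMr//; split=> [h|<-]; last exact: truncn_itv.
  by apply/eqP; rewrite truncn_eq.
have gle n t : 0 <= t <= T -> 0 <= g n t <= t /\ t - g n t <= n.+1%:R^-1.
  move=> tT; have /(gI n _ t tT) : Num.truncn (t * n.+1%:R) = Num.truncn (t * n.+1%:R) by [].
  rewrite /= in_itv/= => /andP[h1 h2]; split; first by rewrite divr_ge0//= h1.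
  by rewrite lerBlDl; apply: (le_trans (ltW h2)); rewrite /g -natr1 mulrDl mul1r.
apply: (@measurable_fun_cvg _ _ _ _ (fun n q => f (g n q.1, q.2))).
- move=> n _ Y mY.
  have -> : slab `&` (fun q => f (g n q.1, q.2)) @^-1` Y =
    \bigcup_k ((I n k) `*` ((fun x => f (k%:R / n.+1%:R, x)) @^-1` Y)).
    apply/seteqP; split=> -[t x] /=.
      move=> [/slabE/= tT Yx]; exists (Num.truncn (t * n.+1%:R)) => //.
      by split=> //; split; [rewrite /= in_itv|exact/gI].
    by move=> [k _ [[tT /= tk] Yx]]; split=> //; rewrite /g (iffLR (gI n k t tT)).
  apply: bigcup_measurable => k _.
  have [kT|kT] := leP (k%:R / n.+1%:R) T.
    apply: measurableX; first by apply: measurableI; exact: measurable_itv.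
    rewrite -[X in measurable X]setTI.
    apply: torus_measurable_fun => //; apply: slice_cts => //.
    by rewrite divr_ge0.
  rewrite [X in X `*` _](_ : _ = set0) ?set0X//.
  apply/seteqP; split=> // t [] /=; rewrite !in_itv/= => /andP[_ tT] /andP[h _].
  by have := lt_le_trans (lt_le_trans kT h) tT; rewrite ltxx.
- move=> q sq; have /slabE qT := sq.
  have -> : f q = f (q.1, q.2) by rewrite -surjective_pairing.
  apply: (@slice_cvg _ f (q.1, q.2) cf _ _ \oo _ (fun n => g n q.1) (fun=> q.2)) => //=.
  + move=> n; have [/andP[h1 h2] _] := gle n _ qT; rewrite h1/= (le_trans h2)//.
    by case/andP: qT.
  + apply/cvgrPdist_le => e e0.
    near=> n; have [/andP[h1 h2] h3] := gle n _ qT.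
    rewrite ger0_norm ?subr_ge0// (le_trans h3)//.
    by near: n; exact: filterS (fun _ => @ltW _ _ _ _) (near_infty_natSinv_lt (PosNum e0)).
  + exact: cvg_cst.
Unshelve. all: by end_near. Qed.

Lemma gen_pullback {Y : Type} (h : Q -> Y) (G : set (set Y)) :
  (forall U, G U -> <<s slab, @pos_sets R _ Q slab>> (h @^-1` U `&` slab)) ->
  forall U, <<s G>> U -> <<s slab, @pos_sets R _ Q slab>> (h @^-1` U `&` slab).
Proof.
move=> hG; apply: smallest_sub; last exact: hG.
split.
- by rewrite preimage_set0 set0I; exact: sigma_algebra0.
- move=> U hU.
  rewrite (_ : _ `&` _ = slab `\` (h @^-1` U `&` slab)); first exact: sigma_algebraCD.
  by rewrite setDIr setDv setU0 setTD setIC.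
- move=> U hU; rewrite preimage_bigcup setI_bigcupl; exact: sigma_algebra_bigcup.
Qed.

(** The Borel sets of the product are generated by half spaces in time and by
cylinders over open sets of the torus, which are both positivity sets of
continuous functions. *)
Lemma slab_baire : @baire R _ Q slab.
Proof.
split.
- exact: slab_compact.
- exact: slab_measurable.
- exact: slab_measurable_fun.
have h1 : forall Y : set R, measurable Y -> <<s slab, @pos_sets R _ Q slab>> (fst @^-1` Y `&` slab).
  move=> Y mY; have {mY} : measurable (Y : set (measurableTypeR R)) by [].
  rewrite (RGenOInfty.measurableE R); move: Y; apply: gen_pullback => _ [x ->].
  apply: sub_sigma_algebra.
  exists (fun q => q.1 - x).
    apply: ctsB; last exact: cts_cst.
    by apply: continuous_subspaceT => q; exact: cvg_fst.
  by apply/seteqP; split=> q /=; rewrite subr_gt0 in_itv/= andbT => -[].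
have h2 : forall Y : set torus, measurable Y -> <<s slab, @pos_sets R _ Q slab>> (snd @^-1` Y `&` slab).
  move=> Y; rewrite /measurable /=; move: Y; apply: gen_pullback => U oU.
  apply: sub_sigma_algebra.
  have [f cf ->] := torus_open_pos oU.
  exists (fun q => f q.2).
    apply: continuous_subspaceT => q; apply: continuous_comp; [exact: cvg_snd|exact: cf].
  by apply/seteqP; split=> q /= [].
move=> S; rewrite /measurable /=; move: S; apply: (@gen_pullback _ id).
by move=> _ [] [Y mY <-]; rewrite setTI; [exact: h1|exact: h2].
Qed.

Lemma slab_bmv F : {within slab, continuous F} -> bmv slab F.
Proof. by move=> cF; apply: (ctv_bmv _ cF); exact: slab_baire. Qed.

(** Compactness makes continuity in time uniform in space and time. *)
Lemma slab_unif F (e : R) : {within slab, continuous F} -> 0 < e ->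
  exists2 r : R, 0 < r & forall s t x, 0 <= s <= T -> 0 <= t <= T -> `|s - t| < r ->
    forall i, `|F (s, x) 0 i - F (t, x) 0 i| <= e.
Proof.
move=> cF e0; have e2 : 0 < e / 2 by rewrite divr_gt0.
have : \forall r \near (0 : R), slab `<=` (fun q => forall s i, 0 <= s <= T ->
    `|s - q.1| < `|r| -> `|F (s, q.2) 0 i - F q 0 i| <= e).
  have /compact_near_coveringP/near_covering_withinP cK := slab_compact.
  apply: (cK R (nbhs (0 : R)) (fun r q => forall s i, 0 <= s <= T ->
    `|s - q.1| < `|r| -> `|F (s, q.2) 0 i - F q 0 i| <= e)) => q sq.
  have h : \forall p \near q, slab p -> forall i, `|F q 0 i - F p 0 i| < e / 2.
    have /subspace_continuousP/(_ q sq) cq := cF.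
    suff : \forall p \near within slab (nbhs q), forall i, `|F q 0 i - F p 0 i| < e / 2 by [].
    apply: filter_forall => i; have := @ctv_coord R _ slab d F i cF.
    by move=> /subspace_continuousP/(_ q sq)/cvgrPdist_lt/(_ _ e2).
  have [[U V] /= [/nbhs_ballP[r r0 rU] nV] UV] := h.
  exists ([set p | ball q.1 (r / 2) p.1 /\ V p.2], [set k | `|k| < r / 2]).
    split => /=.
      exists (ball q.1 (r / 2), V); last by [].
      by split=> //=; apply: nbhsx_ballx; rewrite divr_gt0.
    apply/(nbhs_ballP (0 : R)); exists (r / 2); first by rewrite /= divr_gt0.
    by move=> k; rewrite -ball_normE /= sub0r normrN.
  move=> [p k] /= [[p1 p2] kr] sp s i sT sk.
  move: p1; rewrite -ball_normE /= => p1; rewrite /= in r0.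
  have h1 : `|F q 0 i - F p 0 i| < e / 2.
    have := UV (p.1, p.2); rewrite -surjective_pairing; apply => //; split=> //=.
    by apply: rU; rewrite -ball_normE /=; lra.
  have h2 : `|F q 0 i - F (s, p.2) 0 i| < e / 2.
    apply: (UV (s, p.2)); last exact/slabE.
    split=> //=; apply: rU; rewrite -ball_normE /=.
    rewrite distrC in p1.
    have := ler_normD (s - p.1) (p.1 - q.1); rewrite subrKA distrC; lra.
  rewrite distrC in h2.
  have := ler_normD (F (s, p.2) 0 i - F q 0 i) (F q 0 i - F p 0 i).
  rewrite subrKA; lra.
move=> /nbhs_ballP[r r0 hr]; exists (r / 2); first by rewrite divr_gt0.
move=> s t x sT tT st i.
apply: (hr (r / 2) _ (t, x)) => //.
- by rewrite -ball_normE /= sub0r normrN ger0_norm ?ltW ?divr_gt0//; rewrite /= in r0; lra.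
- have r2 : 0 <= r / 2 by apply: divr_ge0 => //; exact: ltW.
  by rewrite /= (ger0_norm r2).
Qed.

End slab.

(** * Time integrals and weakly continuous paths of measures *)

Section time_integrals.
Context {R : realType}.
Implicit Types (s t a M : R) (k l : R -> R).
Local Notation I t := (`[0, t]%classic : set R).

Definition tint t k : R := \int[lebesgue_measure]_(s in I t) k s.

Lemma leb_itv_lty t : (lebesgue_measure (I t) < +oo)%E.
Proof.
rewrite lebesgue_measure_itv /=; case: ifP => // _.
by rewrite -EFinB ltry.
Qed.

Lemma leb_itv t : 0 <= t -> fine (lebesgue_measure (I t)) = t.
Proof.
move=> t0; rewrite lebesgue_measure_itv /= lte_fin.
by case: ltgtP t0 => //= t0 _; rewrite oppr0 addr0.
Qed.

Lemma bm_tint t k : bm (I t) k -> lebesgue_measure.-integrable (I t) (EFin \o k).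
Proof. by move=> bk; apply: bm_integrable_lty => //; exact: leb_itv_lty. Qed.

Lemma eq_tint t k l : (forall s, 0 <= s <= t -> k s = l s) -> tint t k = tint t l.
Proof. by move=> kl; apply: eq_Rintegral => s /set_mem; rewrite /= in_itv => /kl. Qed.

Lemma tintD t k l : bm (I t) k -> bm (I t) l -> tint t (fun s => k s + l s) = tint t k + tint t l.
Proof. by move=> bk bl; apply: RintegralD => //; exact: bm_tint. Qed.

Lemma tintB t k l : bm (I t) k -> bm (I t) l -> tint t (fun s => k s - l s) = tint t k - tint t l.
Proof. by move=> bk bl; apply: RintegralB => //; exact: bm_tint. Qed.

Lemma tintZ t a k : bm (I t) k -> tint t (fun s => a * k s) = a * tint t k.
Proof. by move=> bk; apply: RintegralZl => //; exact: bm_tint. Qed.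

Lemma tint0 t : tint t (fun=> 0) = 0.
Proof. by rewrite /tint Rintegral_cst// mul0r. Qed.

Lemma tint_sum (J : Type) (r : seq J) t (k_ : J -> R -> R) : (forall j, bm (I t) (k_ j)) ->
  tint t (fun s => \sum_(j <- r) k_ j s) = \sum_(j <- r) tint t (k_ j).
Proof.
move=> bk; elim: r => [|j r IH].
  by rewrite big_nil -[RHS](tint0 t); apply: eq_tint => s _; rewrite big_nil.
rewrite big_cons -IH -tintD//; last exact: bm_sum.
by apply: eq_tint => s _; rewrite big_cons.
Qed.

Lemma tint_le t k l : bm (I t) k -> bm (I t) l -> (forall s, 0 <= s <= t -> k s <= l s) ->
  tint t k <= tint t l.
Proof.
move=> bk bl kl; apply: le_Rintegral; [by []|exact: bm_tint|exact: bm_tint|].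
by move=> s /=; rewrite in_itv => /kl.
Qed.

Lemma tint_bound t k M : 0 <= t -> bm (I t) k -> (forall s, 0 <= s <= t -> `|k s| <= M) ->
  `|tint t k| <= M * t.
Proof.
move=> t0 bk kM; rewrite (le_trans (le_normr_Rintegral _ _))//; first exact: bm_tint.
rewrite -[X in _ * X](leb_itv t0) -Rintegral_cst//; apply: le_Rintegral; first by [].
- by apply: bm_tint; exact: bm_norm.
- by apply: bm_tint; exact: bm_cst.
by move=> s /=; rewrite in_itv => /kM.
Qed.

Lemma tint_bounded_cvg t (k_ : nat -> R -> R) k M :
  (forall n, measurable_fun (I t) (k_ n)) -> (forall n s, 0 <= s <= t -> `|k_ n s| <= M) ->
  (forall s, 0 <= s <= t -> k_ n s @[n --> \oo] --> k s) ->
  tint t (k_ n) @[n --> \oo] --> tint t k.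
Proof.
move=> mk kM kk; apply: (@Rintegral_bounded_cvg_lty _ _ _ _ _ _ _ M); [by []|exact: leb_itv_lty|exact: mk| |].
- by move=> n s /=; rewrite in_itv; exact: kM.
- by move=> s /=; rewrite in_itv; exact: kk.
Qed.

Lemma bm_itv s t k : s <= t -> bm (I t) k -> bm (I s) k.
Proof.
move=> st; apply: bm_sub => // u /=; rewrite !in_itv/= => /andP[-> us].
exact: le_trans us st.
Qed.

Lemma tint_incr s t k M : 0 <= s <= t -> bm (I t) k -> (forall u, 0 <= u <= t -> `|k u| <= M) ->
  `|tint t k - tint s k| <= M * (t - s).
Proof.
move=> /andP[s0 st] bk kM; pose J : set R := `]s, t]%classic.
have E : I t = I s `|` J.
  apply/seteqP; split=> u /=; rewrite !in_itv/=.
    by move=> /andP[-> ut]; have [us|us] := leP u s; [left|right; rewrite /J /= in_itv/= us].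
  rewrite /J /= in_itv/= => -[/andP[-> us]|/andP[su ->]]; first by rewrite (le_trans us st).
  by rewrite (le_trans s0 (ltW su)).
have dIJ : [disjoint I s & J].
  apply/disj_setPLR => u /=; rewrite /J /= !in_itv/= => /andP[_ us].
  by rewrite ltNge us.
have mJ : measurable J by exact: measurable_itv.
have bJ : bm J k.
  by apply: bm_sub bk => // u Ju; rewrite E; right.
rewrite /tint E Rintegral_setU//; last by rewrite -E; exact: bm_tint.
rewrite addrAC subrr add0r.
have lJ : (lebesgue_measure J = (t - s)%:E)%E.
  rewrite lebesgue_measure_itv /= lte_fin.
  by case: ltgtP st => //= h _; rewrite h subrr.
have lJoo : (lebesgue_measure J < +oo)%E by rewrite lJ ltry.
have iJ l : bm J l -> lebesgue_measure.-integrable J (EFin \o l).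
  by move=> bl; apply: bm_integrable_lty.
rewrite (le_trans (le_normr_Rintegral _ _))//; first exact: iJ.
rewrite (_ : t - s = fine (lebesgue_measure J)); last by rewrite lJ.
rewrite -Rintegral_cst//; apply: le_Rintegral => //.
- by apply: iJ; exact: bm_norm.
- by apply: iJ; exact: bm_cst.
by move=> u Ju; apply: kM; have : I t u by [rewrite E; right]; rewrite /= in_itv.
Qed.

Lemma cts_bm_itv t k : {within I t, continuous k} -> bm (I t) k.
Proof.
move=> ck; split.
  exact: subspace_continuous_measurable_fun.
have [M [_ hM]] := compact_bounded (continuous_compact ck (@segment_compact R 0 t)).
by exists (M + 1) => s Is; apply: (hM (M + 1)); [rewrite ltrDl|exists s].
Qed.

(** Along any filter, pointwise convergence of an equicontinuous family on a
compact interval is uniform, so time integrals converge. *)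
Lemma tint_equicont_cvg t (Y : Type) (E : set_system Y) {FE : ProperFilter E}
    (k_ : Y -> R -> R) k : 0 <= t ->
  (\forall y \near E, {within I t, continuous (k_ y)}) ->
  (forall s (e : R), 0 <= s <= t -> 0 < e -> exists2 r : R, 0 < r &
     \forall y \near E, forall s', 0 <= s' <= t -> `|s - s'| < r -> `|k_ y s - k_ y s'| <= e) ->
  (forall s, 0 <= s <= t -> k_ y s @[y --> E] --> k s) ->
  {within I t, continuous k} /\ tint t (k_ y) @[y --> E] --> tint t k.
Proof.
move=> t0 ck_ eqk kk.
have eqk' s (e : R) : 0 <= s <= t -> 0 < e -> exists2 r : R, 0 < r & forall s',
     0 <= s' <= t -> `|s - s'| < r -> `|k s - k s'| <= e.
  move=> st e0; have [r r0 hr] := eqk s e st e0; exists r => // s' s't ss'.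
  apply: (cvgr_to_le (cvg_norm (cvgB (kk s st) (kk s' s't)))).
  by apply: filterS hr => y; apply.
have ck : {within I t, continuous k}.
  apply/subspace_continuousP => s /=; rewrite in_itv/= => st.
  apply/cvgrPdist_le => e e0; have [r r0 hr] := eqk' _ _ st e0.
  apply/nbhs_ballP; exists r => //= s'; rewrite -ball_normE /= => ss'.
  by rewrite in_itv => /= s't; apply: hr.
split=> //; apply/cvgrPdist_le => e e0.
have e1 : 0 < e / (t + 1) by rewrite divr_gt0// ltr_wpDl.
have e3 : 0 < e / (t + 1) / 3 by rewrite divr_gt0.
have : \forall y \near E, I t `<=` (fun s => `|k s - k_ y s| <= e / (t + 1)).
  have /compact_near_coveringP/near_covering_withinP cK := @segment_compact R 0 t.
  apply: (cK Y E (fun y s => `|k s - k_ y s| <= e / (t + 1))) => s /=.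
  rewrite in_itv/= => st.
  have [r r0 hr] := eqk _ _ st e3; have [r' r'0 hr'] := eqk' _ _ st e3.
  have /cvgrPdist_le/(_ _ e3) hs := kk s st.
  exists (ball s (Num.min r r'), [set y | (forall s', 0 <= s' <= t -> `|s - s'| < r ->
     `|k_ y s - k_ y s'| <= e / (t + 1) / 3) /\ `|k s - k_ y s| <= e / (t + 1) / 3]).
    split=> /=; last exact: filterI.
    by apply: nbhsx_ballx; rewrite lt_min r0.
  move=> [s' y] /= [+ [h1 h2]]; rewrite -ball_normE /= lt_min => /andP[sr sr'].
  rewrite in_itv/= => s't.
  have h3 := h1 _ s't sr; have := hr' _ s't sr'; rewrite distrC => h4.
  have := ler_normD (k s' - k s) (k s - k_ y s); rewrite subrKA => h5.
  have := ler_normD (k s' - k_ y s) (k_ y s - k_ y s'); rewrite subrKA => h6.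
  by move: h2 h3 h4 h5 h6; move: (e / (t + 1)) => w; lra.
move=> hE; apply: filterS2 hE ck_ => y hy cy.
have bk := cts_bm_itv ck; have by_ := cts_bm_itv cy.
rewrite -tintB//; apply: (le_trans (tint_bound t0 (M := e / (t + 1)) _ _)).
- exact: bmB.
- by move=> s st; apply: hy; rewrite /= in_itv.
- by rewrite -mulrA ler_piMr ?(ltW e0)// mulrC ler_pdivrMr ?ltr_wpDl// mul1r lerDl.
Qed.

End time_integrals.

Section weak_topology.
Context {R : realType} {n : nat} {disp : measure_display} {X : topMeasurableType disp}.
Variable K : set X.
Local Notation V := (@vmeasure R n disp X K).

(** The weak-* topology is the initial topology of the pairings with continuous
fields. *)
Lemma vm_cvgP {Y : Type} (E : set_system Y) {FE : Filter E} (m_ : Y -> V) (m : V) :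
  m_ y @[y --> E] --> m <->
  forall G : X -> 'rV[R]_n, {within K, continuous G} ->
    vint (m_ y) K G @[y --> E] --> vint m K G.
Proof.
split=> [mm G cG|h].
  have h : pairing (m_ y) @[y --> E] --> pairing m.
    apply: (cvg_comp m_ (@pairing R n disp X K) mm).
    exact: (@initial_continuous V _ (@pairing R n disp X K)).
  have /cvg_sup/(_ (exist _ G cG)) := h.
  move=> hG W nW; apply: (hG [set g | W (g (exist _ G cG))]).
  exact: (@initial_continuous (forall i : test_fun n K, R) R (fun g => g (exist _ G cG)) (pairing m) W nW).
have hp : pairing (m_ y) @[y --> E] --> pairing m.
  apply/cvg_sup => -[G cG] W [U] [[U'] oU <-] Um UW.
  have hG := h G cG; have : nbhs (vint m K G) U' by exact: open_nbhs_nbhs.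
  move=> /hG hU; change (\forall y \near E, W (pairing (m_ y))).
  have {}hU : \forall y \near E, U' (vint (m_ y) K G) := hU.
  by apply: filterS hU => y yU; exact: UW.
move=> A; rewrite nbhsE => -[U [[W oW <-] Wm] UA].
have : nbhs (pairing m) W by exact: open_nbhs_nbhs.
move=> /hp hW; change (\forall y \near E, A (m_ y)).
have {}hW : \forall y \near E, W (pairing (m_ y)) := hW.
by apply: filterS hW => y Wy; exact: UA.
Qed.

Lemma vint_bounded_cvg (m : V) D (F_ : nat -> X -> 'rV[R]_n) (F : X -> 'rV[R]_n) (N : R) : measurable D ->
  (forall k, bmv D (F_ k)) -> (forall k x i, D x -> `|F_ k x 0 i| <= N) ->
  (forall x i, D x -> F_ k x 0 i @[k --> \oo] --> F x 0 i) ->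
  vint m D (F_ k) @[k --> \oo] --> vint m D F.
Proof.
move=> mD bF FN FF; apply: cvg_sumr => i.
apply: (@cint_bounded_cvg _ _ _ _ _ _ _ N) => //.
- by move=> k; case: (bF k i).
- by move=> k x; exact: FN.
- by move=> x; exact: FF.
Qed.

Lemma vint_indic_delta (m : V) D A i : measurable D -> measurable A -> A `<=` D ->
  vint m D (fun x => \1_A x *: delta_mx 0 i) = val m A 0 i.
Proof.
move=> mD mA AD; rewrite vint_indic// /dotp (bigD1 i)//= big1 ?addr0.
  by rewrite mxE !eqxx mul1r.
by move=> j ji; rewrite mxE eqxx (negbTE ji) mul0r.
Qed.

Lemma vm_setD (m : V) A A' : measurable A -> measurable A' -> A' `<=` A ->
  val m (A `\` A') = val m A - val m A'.
Proof.
move=> mA mA' AA'; rewrite -{2}(setDUK AA') vm_setU//.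
- by rewrite addrAC subrr add0r.
- exact: measurableD.
- by apply/seteqP; split=> // x [A'x []].
Qed.

Lemma vm_cvg_nd (m : V) (A : (set X)^nat) i : (forall k, measurable (A k)) ->
  nondecreasing_seq A -> val m (A k) 0 i @[k --> \oo] --> val m (\bigcup_k A k) 0 i.
Proof.
move=> mA ndA.
rewrite -(vint_indic_delta m i measurableT (bigcup_measurable (fun k _ => mA k)))//.
under eq_cvg do rewrite -(vint_indic_delta m i measurableT (mA _))//.
apply: (@vint_bounded_cvg _ _ _ _ 1) => //.
- by move=> k; apply: bmvZf; [exact: bm_indic|exact: bmv_cst].
- move=> k x j _; rewrite !mxE indicE.
  by case: (_ \in _) (_ && _) => -[]; rewrite ?mul1r ?mul0r ?normr0 ?normr1.
move=> x j _; apply: cvg_near_cst.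
have [[k _ Akx]|nx] := pselect ((\bigcup_k A k) x).
  exists k => // l /= kl; have /subsetPset := ndA _ _ kl => /(_ x Akx) Alx.
  by apply/eqP; rewrite !indicE !mem_set//; exists k.
apply: nearW => k; apply/eqP; rewrite !indicE !memNset//.
by move=> Akx; apply: nx; exists k.
Qed.

End weak_topology.

Section measure_paths.
Context {R : realType} {d : nat} (T : R).
Local Notation torus := (torus R d).
Local Notation Q := (R * torus)%type.
Local Notation slab := (@slab R d T).
Local Notation M := (@vmeasure R d _ torus setT).
Local Notation I t := (`[0, t]%classic : set R).
Implicit Types (B : R -> M) (F G : Q -> 'rV[R]_d) (phi : torus -> 'rV[R]_d).

Definition weakly_continuous B := forall phi, continuous phi ->
  {within I T, continuous (fun t => vint (B t) setT phi)}.

Lemma weakly_continuousP B : {within I T, continuous B} <-> weakly_continuous B.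
Proof.
split=> [cB phi cphi|wB].
  apply/subspace_continuousP => t It.
  have /subspace_continuousP/(_ t It)/vm_cvgP := cB.
  by apply; exact: continuous_subspaceT.
apply/subspace_continuousP => t It; apply/vm_cvgP => G cG.
have {}cG : continuous (G : torus -> _) by apply/continuous_subspace_setT.
by have /subspace_continuousP/(_ t It) := wB _ cG.
Qed.

Definition tv_bounded B (C : R) := forall t, 0 <= t <= T -> tvr (B t) setT <= C.

(** The field may move with the path, since by [slab_unif] it moves uniformly and
the masses are bounded; only its value at the base time is paired with the
increment of the measure. *)
Lemma slice_pair_equicont (Y : Type) (E : set_system Y) {FE : Filter E} (B : Y -> R -> M)
    (C : R) F s :
  (\forall y \near E, tv_bounded (B y) C) ->
  (forall phi (e : R), continuous phi -> 0 < e -> exists2 r : R, 0 < r &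
     \forall y \near E, forall s', 0 <= s' <= T -> `|s - s'| < r ->
       `|vint (B y s) setT phi - vint (B y s') setT phi| <= e) ->
  {within slab, continuous F} -> 0 <= s <= T -> forall (e : R), 0 < e -> exists2 r : R, 0 < r &
     \forall y \near E, forall s', 0 <= s' <= T -> `|s - s'| < r ->
       `|vint (B y s) setT (fun x => F (s, x)) - vint (B y s') setT (fun x => F (s', x))| <= e.
Proof.
move=> BC Beq cF sT e e0.
have e2 : 0 < e / 2 by rewrite divr_gt0.
have e3 : 0 < e / 2 / (d%:R * `|C| + 1) by rewrite divr_gt0// ltr_wpDl// mulr_ge0.
have [r r0 hr] := Beq _ _ (slice_cts cF sT) e2.
have [r' r'0 hr'] := slab_unif cF e3.
exists (Num.min r r'); first by rewrite lt_min r0.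
apply: filterS2 BC hr => y yC yr s' s'T; rewrite lt_min => /andP[sr sr'].
have bF u : 0 <= u <= T -> bmv setT (fun x => F (u, x)).
  by move=> uT; apply: continuous_bmv; exact: slice_cts.
have h1 := yr _ s'T sr.
have h2 : `|vint (B y s') setT (fun x => F (s, x)) - vint (B y s') setT (fun x => F (s', x))| <= e / 2.
  rewrite -vintB//; [|exact: bF..].
  rewrite (le_trans (vint_le_tvint _ _ _))//; first by apply: bmvB; exact: bF.
  apply: (@le_trans _ _ (tvint (B y s') setT (fun=> d%:R * (e / 2 / (d%:R * `|C| + 1))))).
    apply: tvint_le => //; [|exact: bm_cst|].
      by apply: bm_enorm; apply: bmvB; exact: bF.
    by move=> x _; apply: enorm_le_max => i; rewrite !mxE; exact: hr'.
  rewrite tvint_cst// mulrAC -mulrA.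
  apply: (@le_trans _ _ (e / 2 / (d%:R * `|C| + 1) * (d%:R * `|C|))).
    rewrite [leLHS](_ : _ = e / 2 / (d%:R * `|C| + 1) * (d%:R * tvr (B y s') setT)); last by ring.
    by rewrite ler_pM2l// ler_wpM2l// (le_trans (yC _ s'T))// ler_norm.
  by rewrite -mulrA ler_piMr ?(ltW e2)// mulrC ler_pdivrMr ?mul1r ?lerDl// ltr_wpDl// mulr_ge0.
have := ler_normD (vint (B y s) setT (fun x => F (s, x)) - vint (B y s') setT (fun x => F (s, x)))
 (vint (B y s') setT (fun x => F (s, x)) - vint (B y s') setT (fun x => F (s', x))).
rewrite subrKA => h3; apply: (le_trans h3); rewrite [e]splitr; exact: lerD.
Qed.

Section one_path.
Variables (B : R -> M) (C : R).
Hypotheses (wB : weakly_continuous B) (BC : tv_bounded B C).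

Lemma slice_pair_cts F : {within slab, continuous F} ->
  {within I T, continuous (fun t => vint (B t) setT (fun x => F (t, x)))}.
Proof.
move=> cF; apply/subspace_continuousP => s /=; rewrite in_itv/= => sT.
apply/cvgrPdist_le => e e0.
have [|phi e' cphi e'0|r r0] := @slice_pair_equicont unit (globally [set: unit]) _ (fun=> B) C F s _ _ cF sT e e0.
- by move=> y _.
- have /subspace_continuousP/(_ s)/= := wB cphi; rewrite in_itv/= => /(_ sT)/cvgrPdist_le/(_ _ e'0).
  move=> /nbhs_ballP[r /= r0 hr]; exists r => // y _ s' s'T ss'.
  by apply: hr; rewrite /= ?in_itv// -ball_normE.
move=> /(_ tt Logic.I) hr; apply/nbhs_ballP; exists r => //= s'; rewrite -ball_normE /= => ss'.
by rewrite in_itv => /= s't; apply: hr.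
Qed.

Lemma slice_bmv F t : {within slab, continuous F} -> 0 <= t <= T ->
  bmv setT (fun x => F (t, x)).
Proof.
by move=> cF tT; apply: continuous_bmv; exact: slice_cts.
Qed.

Lemma vmeasure_slice_le t (A : set torus) i : 0 <= t <= T -> measurable A ->
  `|val (B t) A 0 i| <= C.
Proof.
move=> tT mA; rewrite (le_trans (enorm_comp _ _))// (le_trans _ (BC tT))//.
by rewrite -lee_fin fineK ?tv_fin// (le_trans (enorm_le_tv _ mA))// tv_mono.
Qed.

(** For the sets [f > 0] this is a limit of continuous functions of time; the
other Borel sets follow by [baire_ind]. *)
Lemma measurable_slice (S : set Q) i : measurable S ->
  measurable_fun (I T) (fun t => val (B t) (xsection S t) 0 i).
Proof.
move=> mS.
have sE (A : set Q) t : 0 <= t <= T -> xsection (A `&` slab) t = xsection A t.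
  move=> tT; rewrite xsectionI [X in _ `&` X](_ : _ = setT) ?setIT//.
  by apply/seteqP; split=> // x _; apply/xsectionP/slabE.
apply: (@eq_measurable_fun _ _ _ _ _ (fun t => val (B t) (xsection (S `&` slab) t) 0 i)).
  by move=> t /set_mem; rewrite /= in_itv/= => tT; rewrite sE.
have mSs : measurable (S `&` slab) by apply: measurableI => //; exact: slab_measurable.
pose P (A : set Q) := measurable A /\ measurable_fun (I T) (fun t => val (B t) (xsection A t) 0 i).
suff : P (S `&` slab) by case.
move: (S `&` slab) mSs (@subIsetr _ S slab).
pose P' (A : set Q) := P A /\ A `<=` slab.
suff h : forall A, measurable A -> A `<=` slab -> P' A by move=> A mA /(h A mA)[].
apply: (baire_ind (slab_baire T)); first split.
- by move=> A [].
- split=> //; split; first exact: slab_measurable.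
  apply: (@eq_measurable_fun _ _ _ _ _ (fun t => vint (B t) setT (fun x => delta_mx 0 i))).
    move=> t /set_mem; rewrite /= in_itv/= => tT.
    rewrite -(vint_indic_delta _ i measurableT (measurable_xsection t (slab_measurable T)))//.
    apply: eq_vint => x _; rewrite indicE mem_set ?scale1r//.
    by apply/xsectionP/slabE.
  have ce : continuous (fun _ : torus => delta_mx 0 i : 'rV[R]_d) by exact: cst_continuous.
  exact: (subspace_continuous_measurable_fun (measurable_itv _) (wB ce)).
- move=> A A' AA' [[mA PA] As] [[mA' PA'] A's]; split; last by move=> q [/As].
  split; first exact: measurableD.
  apply: (@eq_measurable_fun _ _ _ _ _ (fun t => val (B t) (xsection A t) 0 i - val (B t) (xsection A' t) 0 i)).
    move=> t _; rewrite xsectionD.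
    have mx (U : set Q) : measurable U -> measurable (xsection U t) by exact: measurable_xsection.
    rewrite vm_setD ?mxE//; [exact: mx|exact: mx|].
    by move=> x /xsectionP/AA' ?; exact/xsectionP.
  exact: measurable_funB.
- move=> A ndA hA; have mA k : measurable (A k) by case: (hA k) => -[].
  split; last by move=> q [k _]; case: (hA k) => _; apply.
  split; first exact: bigcup_measurable.
  apply: (@measurable_fun_cvg _ _ _ _ (fun k t => val (B t) (xsection (A k) t) 0 i)).
    by move=> k; case: (hA k) => -[].
  move=> t _; rewrite xsection_bigcup; apply: vm_cvg_nd.
    by move=> k; exact: measurable_xsection.
  by move=> k l kl; apply/subsetPset/le_xsection/subsetPset; exact: ndA.
- move=> A GA; have mA := pos_sets_measurable (slab_baire T) GA.
  move: GA mA => [f cf <-] mA; split; last by move=> q [].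
  have cr k : {within slab, continuous (fun q : Q => ramp f k q *: delta_mx 0 i : 'rV[R]_d)}.
    by apply: (@ctvZ R Q slab d (ramp f k)); [exact: ramp_cts|exact: ctv_cst].
  split=> //.
  apply: (@measurable_fun_cvg _ _ _ _ (fun k t => vint (B t) setT (fun x => ramp f k (t, x) *: delta_mx 0 i))).
    move=> k; apply: subspace_continuous_measurable_fun => //.
    exact: (slice_pair_cts (cr k)).
  move=> t; rewrite /= in_itv/= => tT.
  rewrite -(vint_indic_delta _ i measurableT (measurable_xsection t mA))//.
  apply: (@vint_bounded_cvg _ _ _ _ _ _ _ _ _ 1) => //.
  + by move=> k; exact: (slice_bmv (cr k) tT).
  + move=> k x j _; rewrite !mxE normrM ger0_norm ?ramp_ge0//.
    rewrite -[leRHS]mulr1 ler_pM ?ramp_ge0 ?ramp_le1//.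
    by case: (_ && _); rewrite ?normr0 ?normr1.
  + move=> x j _; rewrite !mxE; under eq_cvg do rewrite !mxE.
    apply: cvgM; last exact: cvg_cst.
    rewrite (_ : \1_(xsection _ t) x = \1_[set q | 0 < f q] (t, x)); first exact: ramp_cvg.
    rewrite !indicE mem_xsection; congr (nat_of_bool _)%:R; apply/idP/idP => /set_mem /=.
      by case=> _ fx; rewrite inE.
    by move=> fx; rewrite inE; split=> //; exact/slabE.
Qed.

End one_path.
End measure_paths.

(** * Disintegration and Fubini *)

Section disintegration.
Context {R : realType} {d : nat} (T : R).
Local Notation torus := (torus R d).
Local Notation Q := (R * torus)%type.
Local Notation slab := (@slab R d T).
Local Notation M := (@vmeasure R d _ torus setT).
Local Notation MQ := (@vmeasure R d _ Q slab).
Local Notation I t := (`[0, t]%classic : set R).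
Local Notation e_ i := (delta_mx 0 i : 'rV[R]_d).
Implicit Types (F : Q -> 'rV[R]_d) (f : Q -> R) (mu : MQ).

Lemma bm_slice f t : bm slab f -> 0 <= t <= T -> bm setT (fun x => f (t, x)).
Proof.
move=> [mf [N fN]] tT; split; last first.
  by exists N => x _; apply: fN; exact/slabE.
apply: (measurable_comp (@slab_measurable R d T) _ mf (pair1_measurable t)).
by move=> _ [x _ <-]; exact/slabE.
Qed.

Lemma vint_le_sup (m : M) (F : torus -> 'rV[R]_d) N : bmv setT F -> (forall x, enorm (F x) <= N) ->
  `|vint m setT F| <= N * tvr m setT.
Proof.
move=> bF FN; rewrite (le_trans (vint_le_tvint _ _ _))// -tvint_cst//.
by apply: tvint_le => //; [exact: bm_enorm|exact: bm_cst].
Qed.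

Lemma enorm_delta i (a : R) : enorm (a *: e_ i) = `|a|.
Proof.
suff h : enorm (e_ i) = 1 by rewrite enormZ h mulr1.
rewrite /enorm /dotp (bigD1 i)//= big1 ?addr0; first by rewrite mxE !eqxx mulr1 sqrtr1.
by move=> j ji; rewrite mxE eqxx (negbTE ji) mul0r.
Qed.

Variables (B : R -> M) (C : R).
Hypotheses (wB : weakly_continuous T B) (BC : tv_bounded T B C) (T0 : 0 <= T).

Let C0 : 0 <= C.
Proof. by apply: le_trans (BC (t := 0) _); [exact: tvr_ge0|rewrite lexx]. Qed.

Let comp_int i f t := vint (B t) setT (fun x => f (t, x) *: e_ i).

Let comp_bmv i f t : bm slab f -> 0 <= t <= T -> bmv setT (fun x => f (t, x) *: e_ i).
Proof. by move=> bf tT; apply: bmvZf; [exact: bm_slice|exact: bmv_cst]. Qed.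

Let comp_bound i f N t : bm slab f -> (forall q, slab q -> `|f q| <= N) -> 0 <= t <= T ->
  `|comp_int i f t| <= N * C.
Proof.
move=> bf fN tT; have fN' x : enorm (f (t, x) *: e_ i) <= N.
  by rewrite enorm_delta; apply: fN; exact/slabE.
rewrite (le_trans (vint_le_sup _ (comp_bmv i bf tT) fN'))// ler_wpM2l ?BC//.
by rewrite (le_trans _ (fN' point))// enorm_ge0.
Qed.

Let comp_lin i a f g t : bm slab f -> bm slab g -> 0 <= t <= T ->
  comp_int i (fun q => a * f q + g q) t = a * comp_int i f t + comp_int i g t.
Proof.
move=> bf bg tT; rewrite /comp_int -vintZD//; [|exact: comp_bmv..].
by apply: eq_vint => x _; rewrite scalerDl scalerA.
Qed.

Let comp_indic i (A : set Q) t : measurable A ->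
  comp_int i \1_A t = val (B t) (xsection A t) 0 i.
Proof.
move=> mA; rewrite -(vint_indic_delta _ i measurableT (measurable_xsection t mA))//.
by apply: eq_vint => x _; rewrite !indicE mem_xsection.
Qed.

Let comp_bm i f : bm slab f -> bm (I T) (comp_int i f).
Proof.
move=> bf; split; last first.
  have [_ [N fN]] := bf; exists (N * C) => t; rewrite /= in_itv/= => tT.
  exact: comp_bound.
move: f bf; apply: (bm_ind (@slab_measurable R d T)).
- move=> A mA _; apply: (@eq_measurable_fun _ _ _ _ _ (fun t => val (B t) (xsection A t) 0 i)).
    by move=> t _; rewrite comp_indic.
  exact: (measurable_slice wB BC).
- move=> a f g bf bg mf mg.
  apply: (@eq_measurable_fun _ _ _ _ _ (fun t => a * comp_int i f t + comp_int i g t)).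
    by move=> t /set_mem; rewrite /= in_itv/= => tT; rewrite comp_lin.
  by apply: measurable_funD => //; apply: measurable_funM.
- move=> f bf hf.
  have /choice[g hg] : forall k : nat, exists g, [/\ bm slab g,
      measurable_fun (I T) (comp_int i g) & forall q, slab q -> `|f q - g q| <= k.+1%:R^-1].
    by move=> k; apply: hf.
  apply: (@measurable_fun_cvg _ _ _ _ (fun k => comp_int i (g k))).
    by move=> k; case: (hg k).
  move=> t; rewrite /= in_itv/= => tT; apply/cvgrPdist_le => e e0.
  have e1 : 0 < e / (C + 1) by rewrite divr_gt0// ltr_wpDl.
  near=> k; have [bg _ fg] := hg k.
  have -> : comp_int i f t - comp_int i (g k) t = comp_int i (fun q => -1 * g k q + f q) t.
    by rewrite comp_lin// mulN1r addrC.
  apply: (le_trans (@comp_bound i _ (e / (C + 1)) t _ _ tT)).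
  + by apply: bmD => //; exact: bmZ.
  + move=> q sq; rewrite mulN1r addrC (le_trans (fg _ sq))// ltW//.
    by near: k; exact: near_infty_natSinv_lt (PosNum e1).
  + by rewrite -mulrA ler_piMr ?(ltW e0)// mulrC ler_pdivrMr ?ltr_wpDl// mul1r lerDl.
Unshelve. all: by end_near. Qed.

Lemma slice_val_bm (A : set Q) i : measurable A ->
  bm (I T) (fun t => val (B t) (xsection A t) 0 i).
Proof.
move=> mA; split; first exact: (measurable_slice wB BC).
exists C => t; rewrite /= in_itv/= => tT; apply: (vmeasure_slice_le BC) => //.
exact: measurable_xsection.
Qed.

(** Fubini: both sides are functionals of each component of [F] controlled by the
sup norm, and they agree on indicators by definition of a disintegration. *)
Lemma disintegrates_vint mu F : disintegrates mu B -> bmv slab F ->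
  vint mu slab F = tint T (fun t => vint (B t) setT (fun x => F (t, x))).
Proof.
move=> dmu bF; have mS := @slab_measurable R d T.
have comp i f : bm slab f -> vint mu slab (fun q => f q *: e_ i) = tint T (comp_int i f).
  have [C1 C10 hC1] := vint_bound mu mS.
  move: f; apply: (@bm_functional_eq _ _ _ slab (fun f => vint mu slab (fun q => f q *: e_ i))
    (fun f => tint T (comp_int i f)) (C1 + C * T)) => //.
  - move=> a f g bf bg; rewrite -vintZD//; [|by apply: bmvZf => //; exact: bmv_cst..].
    by apply: eq_vint => x _; rewrite scalerDl scalerA.
  - move=> a f g bf bg.
    have [bf' bg'] := (comp_bm i bf, comp_bm i bg).
    rewrite -(tintZ a bf') -(tintD (bmZ a bf') bg').
    by apply: eq_tint => t tT; exact: comp_lin.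
  - move=> f N N0 bf fN.
    apply: (@le_trans _ _ (N * C1)); last by rewrite ler_wpM2l// lerDl mulr_ge0.
    apply: hC1; first by apply: bmvZf => //; exact: bmv_cst.
    move=> q j sq; rewrite (le_trans (enorm_comp _ _))// enorm_delta; exact: fN.
  - move=> f N N0 bf fN.
    apply: (@le_trans _ _ (N * (C * T))); last by rewrite ler_wpM2l// lerDr.
    rewrite mulrA; apply: tint_bound => //; first exact: comp_bm.
    by move=> s sT; exact: comp_bound.
  - move=> A mA As; rewrite (@vint_indic_delta R d _ Q slab)// dmu//.
    by apply: eq_tint => t tT; rewrite comp_indic.
have sumE (q : Q) : F q = \sum_i F q 0 i *: e_ i by exact: row_delta.
have -> : vint mu slab F = vint mu slab (fun q => \sum_i F q 0 i *: e_ i).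
  by apply: eq_vint => q _; exact: sumE.
rewrite (@vint_sum _ _ _ Q slab _ _ mu slab (fun i q => F q 0 i *: e_ i))//; last first.
  by move=> i; apply: bmvZf; [exact: bF|exact: bmv_cst].
transitivity (\sum_i tint T (comp_int i (fun q => F q 0 i))).
  by apply: eq_bigr => i _; apply: comp; exact: bF.
rewrite -(tint_sum _ (k_ := fun i => comp_int i (fun q => F q 0 i))); last first.
  by move=> i; apply: comp_bm; exact: bF.
apply: eq_tint => t tT.
rewrite -(@vint_sum _ _ _ _ _ _ _ (B t) setT (fun i x => F (t, x) 0 i *: e_ i))//.
  by apply: eq_vint => x _; rewrite -sumE.
by move=> i; exact: (comp_bmv i (bF i) tT).
Qed.

Let path_set (A : set Q) : 'rV[R]_d :=
  if `[< measurable A >] then \row_i tint T (fun t => val (B t) (xsection A t) 0 i) else 0.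

Let path_setE A i : measurable A ->
  path_set A 0 i = tint T (fun t => val (B t) (xsection A t) 0 i).
Proof. by move=> mA; rewrite /path_set asboolT// mxE. Qed.

Let path_setU A A' : measurable A -> measurable A' -> A `&` A' = set0 ->
  path_set (A `|` A') = path_set A + path_set A'.
Proof.
move=> mA mA' AA'; apply/rowP => i.
rewrite mxE !path_setE//; last exact: measurableU.
rewrite -tintD; [|exact: slice_val_bm..].
apply: eq_tint => t tT; rewrite xsectionE preimage_setU -!xsectionE vm_setU ?mxE//; [exact: measurable_xsection..|].
by rewrite -xsectionI AA' xsection0.
Qed.

Let path_is_vmeasure : path_set \in vmeasure_pred slab.
Proof.
apply/asboolP.
have p0 : path_set set0 = 0.
  apply/rowP => i; rewrite path_setE// mxE.
  rewrite -[RHS](tint0 T).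
  by apply: eq_tint => t _; rewrite xsection0 vm_set0 mxE.
split=> //.
- move=> i F mF tF mU.
  have mUn n : measurable (\big[setU/set0]_(j < n) F j) by exact: bigsetU_measurable.
  have sumE n : \sum_(0 <= j < n) component path_set i (F j) =
      (path_set (\big[setU/set0]_(j < n) F j) 0 i)%:E :> \bar R.
    rewrite /component sumEFin; congr (_%:E).
    elim: n => [|n IH]; first by rewrite big_geq// big_ord0 p0 mxE.
    rewrite big_nat_recr//= IH big_ord_recr/= path_setU ?mxE//; first exact: mUn.
    apply/seteqP; split=> // q; rewrite -bigcup_mkord => -[[k /= kn Fk] Fn].
    have kE := tF k n Logic.I Logic.I (ex_intro _ q (conj Fk Fn)).
    by rewrite kE ltnn in kn.
  under eq_fun do rewrite sumE.
  apply: cvg_EFin; first exact: nearW.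
  rewrite /component path_setE//.
  rewrite (_ : fine \o _ = fun n => tint T (fun t =>
    val (B t) (xsection (\big[setU/set0]_(j < n) F j) t) 0 i)); last first.
    by apply/funext => n /=; rewrite path_setE//; exact: mUn.
  apply: (@tint_bounded_cvg _ _ _ _ C).
  + by move=> n; case: (slice_val_bm i (mUn n)).
  + move=> n t tT; apply: (vmeasure_slice_le BC) => //; exact: measurable_xsection.
  + move=> t tT.
    have -> : xsection (\bigcup_n F n) t = \bigcup_n xsection (\big[setU/set0]_(j < n) F j) t.
      rewrite -xsection_bigcup; congr (xsection _ t); apply/seteqP; split=> q.
        move=> [k _ Fk]; exists k.+1 => //; rewrite big_ord_recr; right; exact: Fk.
      by move=> [n _ Uq]; exact: (bigsetU_bigcup Uq).
    apply: vm_cvg_nd; first by move=> n; exact: measurable_xsection.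
    move=> n m nm; apply/subsetPset/le_xsection; exact: subset_bigsetU.
- move=> A mA AK; apply/rowP => i; rewrite path_setE// mxE.
  rewrite -[RHS](tint0 T).
  apply: eq_tint => t tT; rewrite (_ : xsection A t = set0) ?vm_set0 ?mxE//.
  apply/seteqP; split=> // x /xsectionP Ax.
  have : (A `&` slab) (t, x) by split=> //; exact/slabE.
  by rewrite AK.
- by move=> A mA; rewrite /path_set asboolF.
Qed.

Lemma path_disintegration : exists mu : MQ, disintegrates mu B.
Proof.
pose mu : MQ := exist _ path_set path_is_vmeasure.
by exists mu => A i mA; exact: (path_setE i mA).
Qed.

End disintegration.

(** * Lower semicontinuity of the mass *)

Section running_max.
Context {R : realType}.
Implicit Types (h : nat -> R -> R) (s e : R).

Fixpoint running_max h (k : nat) s : R :=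
  if k is k'.+1 then Num.max (running_max h k' s) (h k s) else h 0 s.

Lemma running_max_ge h j k s : (j <= k)%N -> h j s <= running_max h k s.
Proof.
elim: k => [|k IH]; first by rewrite leqn0 => /eqP ->.
rewrite leq_eqVlt => /predU1P[->|/IH jk] /=; first by rewrite le_max lexx orbT.
by rewrite le_max jk.
Qed.

Lemma running_max_le h k s M : (forall j, h j s <= M) -> running_max h k s <= M.
Proof. by move=> hM; elim: k => [|k IH] /=; [exact: hM|rewrite ge_max IH hM]. Qed.

Lemma dist_max (a a' b b' e : R) : `|a - a'| <= e -> `|b - b'| <= e ->
  `|Num.max a b - Num.max a' b'| <= e.
Proof.
by rewrite !ler_norml => /andP[? ?] /andP[? ?]; rewrite /Num.max;
  case: ltP => ?; case: ltP => ?; apply/andP; split; lra.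
Qed.

End running_max.

Section variation_in_time.
Context {R : realType} {d : nat} (T : R).
Local Notation torus := (torus R d).
Local Notation Q := (R * torus)%type.
Local Notation slab := (@slab R d T).
Local Notation M := (@vmeasure R d _ torus setT).
Local Notation I t := (`[0, t]%classic : set R).
Variables (f : Q -> R).
Hypotheses (cf : {within slab, continuous f}) (f0 : forall q, slab q -> 0 <= f q).

Definition mass_at (m : M) (s : R) : R := tvint m setT (fun x => f (s, x)).
Definition pair_at (phi : torus -> 'rV[R]_d) (m : M) (s : R) : R :=
  vint m setT (fun x => f (s, x) *: phi x).

Let f0' s x : 0 <= s <= T -> 0 <= f (s, x).
Proof. by move=> sT; apply: f0; exact/slabE. Qed.

Let bf s : 0 <= s <= T -> bm setT (fun x => f (s, x)).
Proof. by move=> sT; apply: bm_slice sT; apply: cts_bm cf; exact: slab_baire. Qed.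

Let cphi (phi : torus -> 'rV[R]_d) : continuous phi -> {within slab, continuous (fun q : Q => f q *: phi q.2)}.
Proof.
move=> cp; apply: (@ctvZ R Q slab d f (fun q => phi q.2)) => //.
by apply: continuous_subspaceT => q; apply: continuous_comp; [exact: cvg_snd|exact: cp].
Qed.

Lemma pair_le_mass phi m s : continuous phi -> (forall x, enorm (phi x) <= 1) -> 0 <= s <= T ->
  pair_at phi m s <= mass_at m s.
Proof.
move=> cp p1 sT; apply: vint_le_enorm1 => //.
- exact: bf.
- by exact: continuous_bmv.
- by move=> x _; exact: f0'.
Qed.

Section path.
Variables (B : R -> M) (C : R).
Hypotheses (wB : weakly_continuous T B) (BC : tv_bounded T B C).

Lemma pair_at_cts phi : continuous phi -> {within I T, continuous (fun s => pair_at phi (B s) s)}.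
Proof. by move=> cp; exact: (slice_pair_cts wB BC (cphi cp)). Qed.

(** A lower semicontinuous function of time is the supremum of countably many of
the continuous functions below it: a field that is good at time [s] for some
margin stays good on a rational interval around [s]. *)
Lemma mass_at_sup : exists phi_ : nat -> torus -> 'rV[R]_d,
  [/\ forall k, continuous (phi_ k), forall k x, enorm (phi_ k x) <= 1 &
   forall s (e : R), 0 <= s <= T -> 0 < e ->
     exists k, mass_at (B s) s - e <= pair_at (phi_ k) (B s) s].
Proof.
pose good (phi : torus -> 'rV[R]_d) := continuous phi /\ forall x, enorm (phi x) <= 1.
(* [w] is a rational time interval together with a rational threshold *)
pose above (w : rat * rat * rat) (phi : torus -> 'rV[R]_d) := forall s, 0 <= s <= T ->
  ratr w.1.1 < s < ratr w.1.2 -> ratr w.2 < pair_at phi (B s) s.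
have good0 : good (fun=> 0).
  by split=> [|x]; [exact: cst_continuous|rewrite enorm0].
have /choice[psi hpsi] : forall w, exists phi, good phi /\
    ((exists phi', good phi' /\ above w phi') -> above w phi).
  move=> w; have [[phi [gphi aphi]]|nphi] := pselect (exists phi', good phi' /\ above w phi').
    by exists phi.
  by exists (fun=> 0).
pose phi_ (k : nat) := if unpickle k is Some w then psi w else fun=> 0.
have gphi k : good (phi_ k).
  by rewrite /phi_; case: unpickle => [w|//]; case: (hpsi w).
exists phi_; split; [by move=> k; case: (gphi k)|by move=> k; case: (gphi k)|].
move=> s e sT e0; have e2 : 0 < e / 2 by rewrite divr_gt0.
have [F [cF F1 hF]] := tvint_polar_cts torus_baire (B s) (bf sT) (fun x _ => f0' x sT) e2.
have {}cF : continuous (F : torus -> _) by apply/continuous_subspace_setT.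
have [q /=] := @rat_in_itvoo R (mass_at (B s) s - e) (mass_at (B s) s - e / 2) ltac:(lra).
rewrite in_itv/= => /andP[q1 q2].
have qF : ratr q < pair_at F (B s) s by exact: lt_le_trans hF.
have /subspace_continuousP/(_ s) := pair_at_cts cF.
rewrite /= in_itv/= => /(_ sT)/cvgr_gt/(_ _ qF)/nbhs_ballP[r /= r0 hr].
have [p1 /=] := @rat_in_itvoo R (s - r) s ltac:(lra).
have [p2 /=] := @rat_in_itvoo R s (s + r) ltac:(lra).
rewrite !in_itv/= => /andP[p21 p22] /andP[p11 p12].
exists (pickle (p1, p2, q)); rewrite /phi_ pickleK.
have /= := (hpsi (p1, p2, q)).2; move=> h.
have : above (p1, p2, q) (psi (p1, p2, q)).
  apply: h; exists F; split=> // s' s'T /= /andP[h1 h2].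
  apply: hr; last by rewrite /= in_itv.
  by rewrite -ball_normE /= ltr_norml; apply/andP; split; lra.
move=> /(_ s sT); rewrite /= p12 p21 => /(_ isT) h1.
by rewrite (le_trans (ltW q1))// ltW.
Qed.

(** Running maxima turn the supremum into a monotone limit. *)
Lemma mass_at_approx : exists phi_ : nat -> torus -> 'rV[R]_d,
  [/\ forall k, continuous (phi_ k), forall k x, enorm (phi_ k x) <= 1 &
   forall s, 0 <= s <= T ->
     running_max (fun j s => pair_at (phi_ j) (B s) s) k s @[k --> \oo] --> mass_at (B s) s].
Proof.
have [phi_ [cp p1 hp]] := mass_at_sup; exists phi_; split=> // s sT.
apply/cvgrPdist_le => e e0; have [k hk] := hp s e sT e0.
exists k => // l /= kl; rewrite ger0_norm ?subr_ge0.
  rewrite lerBlDr -lerBlDl (le_trans hk)//.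
  exact: (running_max_ge (fun j s => pair_at (phi_ j) (B s) s)).
by apply: running_max_le => j; exact: pair_le_mass.
Qed.

Lemma running_max_cts (h : nat -> R -> R) k : (forall j, {within I T, continuous (h j)}) ->
  {within I T, continuous (running_max h k)}.
Proof. by move=> ch; elim: k => [|k IH] /=; [exact: ch|exact: cts_max]. Qed.

Lemma mass_at_bm : bm (I T) (fun s => mass_at (B s) s).
Proof.
have [phi_ [cp p1 hp]] := mass_at_approx.
have [_ [N fN]] := cts_bm (slab_baire T) cf.
split.
  apply: (@measurable_fun_cvg _ _ _ _ (running_max (fun j s => pair_at (phi_ j) (B s) s))).
    move=> k; apply: subspace_continuous_measurable_fun => //.
    by apply: running_max_cts => j; exact: pair_at_cts.
  by move=> s; rewrite /= in_itv/=; exact: hp.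
exists (N * C) => s; rewrite /= in_itv/= => sT.
rewrite ger0_norm; last by apply: tvint_ge0 => x _; exact: f0'.
have fN' x : f (s, x) <= N by rewrite (le_trans (ler_norm _))// fN//; exact/slabE.
apply: (@le_trans _ _ (N * tvr (B s) setT)).
  by rewrite -tvint_cst//; apply: tvint_le => //; [exact: bf|exact: bm_cst].
by rewrite ler_wpM2l ?BC// (le_trans (f0' point sT)).
Qed.

End path.

Section limit.
Context (Y : Type) (E : set_system Y) {FE : ProperFilter E} (B_ : Y -> R -> M) (B : R -> M) (C : R).
Hypothesis T0 : 0 <= T.
Hypothesis wB_ : \forall y \near E, weakly_continuous T (B_ y).
Hypothesis BC_ : \forall y \near E, tv_bounded T (B_ y) C.
Hypothesis Beq : forall s phi (e : R), 0 <= s <= T -> continuous phi -> 0 < e ->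
  exists2 r : R, 0 < r & \forall y \near E, forall s', 0 <= s' <= T -> `|s - s'| < r ->
    `|vint (B_ y s) setT phi - vint (B_ y s') setT phi| <= e.
Hypothesis Bcvg : forall s phi, 0 <= s <= T -> continuous phi ->
  vint (B_ y s) setT phi @[y --> E] --> vint (B s) setT phi.

Lemma path_limit_cts : weakly_continuous T B.
Proof.
move=> phi cp.
apply: (@tint_equicont_cvg _ T Y E FE (fun y s => vint (B_ y s) setT phi) _ T0 _ _ _).1.
- by apply: filterS wB_ => y; apply.
- by move=> s e sT e0; exact: Beq.
- by move=> s sT; exact: Bcvg.
Qed.

Lemma path_limit_bounded : tv_bounded T B C.
Proof.
move=> t tT; apply/ler_addgt0Pr => e e0.
have [F [cF F1 hF]] := tvint_polar_cts torus_baire (B t) (bm_cst setT 1) (fun x _ => ler01) e0.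
have {}cF : continuous (F : torus -> _) by apply/continuous_subspace_setT.
rewrite tvint_cst// mul1r in hF.
rewrite -lerBlDr (le_trans hF)//.
under eq_vint do rewrite scale1r.
apply: (cvgr_to_le (Bcvg tT cF)); apply: filterS BC_ => y yC.
rewrite (le_trans _ (yC t tT))// (le_trans (ler_norm _))//.
rewrite -[leRHS]mul1r; apply: vint_le_sup => //.
by exact: continuous_bmv.
Qed.

Let wB := path_limit_cts.
Let BC := path_limit_bounded.

Lemma vint_slice_limit (F : Q -> 'rV[R]_d) t : {within slab, continuous F} -> 0 <= t <= T ->
  tint t (fun s => vint (B_ y s) setT (fun x => F (s, x))) @[y --> E] -->
  tint t (fun s => vint (B s) setT (fun x => F (s, x))).
Proof.
move=> cF tT; have /andP[t0 tleT] := tT.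
have sub s : 0 <= s <= t -> 0 <= s <= T by move=> /andP[-> st]; rewrite (le_trans st).
apply: (@tint_equicont_cvg _ t Y E FE (fun y s => vint (B_ y s) setT (fun x => F (s, x))) _ t0 _ _ _).2.
- apply: filterS2 wB_ BC_ => y wy yC.
  apply: continuous_subspaceW (slice_pair_cts wy yC cF) => s /=; rewrite !in_itv/=.
  exact: sub.
- move=> s e /sub sT e0.
  have [|r r0 hr] := @slice_pair_equicont _ _ T Y E _ B_ C F s BC_ _ cF sT e e0.
    by move=> phi e' cp e'0; exact: Beq.
  by exists r => //; apply: filterS hr => y hy s' /sub s'T; exact: hy.
- by move=> s /sub sT; apply: Bcvg => //; exact: slice_cts.
Qed.

(** A finite running maximum of pairings nearly attains the integral of the limit
mass; it passes to the limit by equicontinuity, and stays below the mass along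
the given paths. *)
Lemma mass_time_limit t (e : R) : 0 <= t <= T -> 0 < e -> \forall y \near E,
  tint t (fun s => mass_at (B s) s) - e <= tint t (fun s => mass_at (B_ y s) s).
Proof.
move=> tT e0; have /andP[t0 tleT] := tT; have e2 : 0 < e / 2 by rewrite divr_gt0.
have sub s : 0 <= s <= t -> 0 <= s <= T by move=> /andP[-> st]; rewrite (le_trans st).
have [phi_ [cp p1 hp]] := mass_at_approx wB BC.
pose h y j s := pair_at (phi_ j) (B_ y s) s.
pose h' j s := pair_at (phi_ j) (B s) s.
have [_ [N gN]] := mass_at_bm wB BC.
have : tint t (running_max h' k) @[k --> \oo] --> tint t (fun s => mass_at (B s) s).
  have [_ [N0 hN0]] := cts_bm_itv (pair_at_cts wB BC (cp 0)).
  apply: (@tint_bounded_cvg _ _ _ _ (`|N| + `|N0|)).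
  - move=> k.
    have ck : {within I T, continuous (running_max h' k)}.
      by apply: running_max_cts => j; exact: pair_at_cts wB BC _ (cp j).
    by case: (bm_itv tleT (cts_bm_itv ck)).
  - move=> k s /sub sT.
    have up : running_max h' k s <= N.
      apply: running_max_le => j; rewrite (le_trans (pair_le_mass _ (cp j) (p1 j) sT))//.
      by rewrite (le_trans (ler_norm _))// gN//= in_itv.
    have lo : - N0 <= running_max h' k s.
      apply: le_trans (running_max_ge h' s (leq0n k)).
      by have := hN0 s; rewrite /= in_itv/= => /(_ sT); rewrite ler_norml => /andP[].
    have := ler_norm N; have := ler_norm N0; have := normr_ge0 N; have := normr_ge0 N0.
    by move=> *; rewrite ler_norml; apply/andP; split; lra.
  - by move=> s /sub sT; exact: hp.
move=> /cvgrPdist_le/(_ _ e2)[k _ /(_ k (leqnn k)) hk].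
have hc y : weakly_continuous T (B_ y) -> tv_bounded T (B_ y) C ->
    {within I t, continuous (running_max (h y) k)}.
  move=> wy yC.
  have ck : {within I T, continuous (running_max (h y) k)}.
    by apply: running_max_cts => j; exact: pair_at_cts wy yC _ (cp j).
  by apply: continuous_subspaceW ck => s /=; rewrite !in_itv/=; exact: sub.
have : tint t (running_max (h y) k) @[y --> E] --> tint t (running_max h' k).
  apply: (@tint_equicont_cvg _ t Y E FE (fun y => running_max (h y) k) _ t0 _ _ _).2.
  - by apply: filterS2 wB_ BC_ => y; exact: hc.
  - move=> s e' /sub sT e'0.
    have hj j : exists2 r : R, 0 < r & \forall y \near E, forall s', 0 <= s' <= T ->
        `|s - s'| < r -> `|h y j s - h y j s'| <= e'.
      apply: (@slice_pair_equicont _ _ T Y E _ B_ C (fun q => f q *: phi_ j q.2) s BC_ _ (cphi (cp j)) sT e' e'0).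
      by move=> phi e'' cphi' e''0; exact: Beq.
    suff [r r0 hr] : exists2 r : R, 0 < r & \forall y \near E, forall s', 0 <= s' <= T ->
        `|s - s'| < r -> `|running_max (h y) k s - running_max (h y) k s'| <= e'.
      by exists r => //; apply: filterS hr => y hy s' /sub s'T; exact: hy.
    clear hk hc; elim: k => [|k [r r0 IH]] /=; first exact: hj.
    have [r' r'0 hr'] := hj k.+1; exists (Num.min r r'); first by rewrite lt_min r0.
    apply: filterS2 IH hr' => y y1 y2 s' s'T; rewrite lt_min => /andP[sr sr'].
    by apply: dist_max; [exact: y1|exact: y2].
  - move=> s /sub sT.
    have hj j : h y j s @[y --> E] --> h' j s.
      apply: Bcvg => //; exact: (slice_cts (cphi (cp j)) sT).
    clear hk hc; elim: k => [|k IH] /=; first exact: hj.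
    apply/cvgrPdist_le => e' e'0.
    move/cvgrPdist_le: IH => /(_ _ e'0) h1; have /cvgrPdist_le/(_ _ e'0) h2 := hj k.+1.
    by apply: filterS2 h1 h2 => y y1 y2; exact: dist_max.
move=> /cvgrPdist_le/(_ _ e2) hy.
apply: filterS3 hy wB_ BC_ => y {}hy wy yC.
have hle : tint t (running_max (h y) k) <= tint t (fun s => mass_at (B_ y s) s).
  apply: tint_le.
  - exact: cts_bm_itv (hc y wy yC).
  - by apply: bm_itv tleT _; exact: mass_at_bm wy yC.
  - by move=> s /sub sT; apply: running_max_le => j; exact: pair_le_mass.
move: hk hy hle; move: (tint t (fun s => mass_at (B s) s)) (tint t (running_max h' k))
  (tint t (running_max (h y) k)) (tint t (fun s => mass_at (B_ y s) s)) => x1 x2 x3 x4.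
by rewrite !ler_norml => /andP[_ h1] /andP[_ h2] h3; lra.
Qed.

(** A supremum of pairings is lower semicontinuous. *)
Lemma mass_limit t (e : R) : 0 <= t <= T -> 0 < e -> \forall y \near E,
  mass_at (B t) t - e <= mass_at (B_ y t) t.
Proof.
move=> tT e0; have e2 : 0 < e / 2 by rewrite divr_gt0.
have [F [cF F1 hF]] := tvint_polar_cts torus_baire (B t) (bf tT) (fun x _ => f0' x tT) e2.
have {}cF : continuous (F : torus -> _) by apply/continuous_subspace_setT.
have /cvgrPdist_le/(_ _ e2) := Bcvg tT (slice_cts (cphi cF) tT).
apply: filterS => y; rewrite ler_norml => /andP[_ h].
apply: le_trans (pair_le_mass (B_ y t) cF F1 tT).
by move: hF h; rewrite /mass_at /pair_at /=; lra.
Qed.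

End limit.
End variation_in_time.

(** * Time cutoffs *)

Section cutoffs.
Context {R : realType} {d : nat} (T : R).
Local Notation torus := (torus R d).
Local Notation Q := (R * torus)%type.
Local Notation slab := (@slab R d T).
Local Notation MQ := (@vmeasure R d _ Q slab).

Definition cutoff (k a s : R) : R := Num.min 1 (Num.max 0 (1 - (s - a) * k)).

Lemma cutoff01 k a s : 0 <= cutoff k a s <= 1.
Proof. by rewrite /cutoff le_min ler01 le_max lexx ge_min lexx. Qed.

Lemma cutoff1 k a s : 0 <= k -> s <= a -> cutoff k a s = 1.
Proof.
move=> k0 sa; have h : 1 <= 1 - (s - a) * k by rewrite lerDl -mulNr opprB mulr_ge0// subr_ge0.
by rewrite /cutoff max_r ?min_l// (le_trans ler01).
Qed.

Lemma cutoff0 k a s : 1 <= (s - a) * k -> cutoff k a s = 0.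
Proof. by move=> h; rewrite /cutoff max_l ?min_r ?subr_le0. Qed.

Definition step (a s : R) : R := \1_[set u : R | u <= a] s.

Lemma stepE a s : step a s = (s <= a)%R%:R.
Proof. by rewrite /step indicE; congr (nat_of_bool _)%:R; apply/idP/idP; rewrite inE. Qed.

(** Consecutive cutoffs interlace with consecutive steps, so the two averages
differ by a telescoping sum. *)
Lemma cutoff_step (N : nat) (k t s : R) : 0 < k -> (0 < N)%N ->
  `|N%:R^-1 * \sum_(j < N) cutoff k (t + j%:R / k) s - N%:R^-1 * \sum_(j < N) step (t + j%:R / k) s|
    <= N%:R^-1.
Proof.
move=> k0 N0; have N0' : (0 : R) < N%:R by rewrite ltr0n.
rewrite -mulrBr normrM ger0_norm ?invr_ge0 ?ler0n// ler_piMr ?invr_ge0 ?ler0n//.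
have h1 j : step (t + j%:R / k) s <= cutoff k (t + j%:R / k) s.
  rewrite stepE; case: (leP s) => h; first by rewrite cutoff1// ltW.
  by case/andP: (cutoff01 k (t + j%:R / k) s).
have h2 j : cutoff k (t + j%:R / k) s <= step (t + j.+1%:R / k) s.
  rewrite stepE; case: (leP s) => h; first by case/andP: (cutoff01 k (t + j%:R / k) s).
  rewrite cutoff0// -ler_pdivrMr// mul1r.
  by move: h; rewrite -natr1 mulrDl mul1r; move: (j%:R / k) => w; lra.
rewrite -sumrB ger0_norm; last by apply: sumr_ge0 => j _; rewrite subr_ge0.
apply: (@le_trans _ _ (\sum_(0 <= j < N) (step (t + j.+1%:R / k) s - step (t + j%:R / k) s))).
  by rewrite big_mkord; apply: ler_sum => j _; rewrite lerD2r.
rewrite (telescope_sumr (fun j => step (t + j%:R / k) s))// !stepE.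
by case: (s <= _)%R; case: (s <= _)%R; rewrite ?subrr ?subr0 ?sub0r ?lerN10 ?ler01// (le_trans (lerN10 R)).
Qed.

Lemma cutoff_cts k a : continuous (cutoff k a).
Proof.
apply/continuous_subspace_setT; apply: cts_min; first exact: cts_cst.
apply: cts_max; first exact: cts_cst.
apply: ctsB; first exact: cts_cst.
apply: ctsM; last exact: cts_cst.
by apply: ctsB; [apply: continuous_subspaceT => x; exact: cvg_id|exact: cts_cst].
Qed.

Let node (N : nat) (t : R) (j : nat) : R := t + j%:R / (N.+1%:R * N.+1%:R).

Let node_ge N t j : t <= node N t j.
Proof. by rewrite lerDl divr_ge0// mulr_ge0. Qed.

Let node_le N t (j : 'I_N.+1) : node N t j - t <= N.+1%:R^-1.
Proof.
rewrite addrAC subrr add0r ler_pdivrMr ?mulr_gt0// mulrA mulVf ?pnatr_eq0// mul1r ler_nat.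
exact: ltnW.
Qed.

(** With the slope [N.+1 ^ 2] the [N.+1] nodes [t + j / N.+1 ^ 2] stay within
[1 / N.+1] of [t], while by [cutoff_step] the averages of cutoffs and of steps
differ by at most [1 / N.+1]. *)
Definition avg_cutoff N t s : R :=
  N.+1%:R^-1 * \sum_(j < N.+1) cutoff (N.+1%:R * N.+1%:R) (node N t j) s.
Definition avg_step N t s : R := N.+1%:R^-1 * \sum_(j < N.+1) step (node N t j) s.

Lemma avg_cutoff_step N t s : `|avg_cutoff N t s - avg_step N t s| <= N.+1%:R^-1.
Proof. by apply: cutoff_step => //; rewrite mulr_gt0. Qed.

Lemma avg_cutoff_cts N t : continuous (avg_cutoff N t).
Proof.
apply/continuous_subspace_setT; apply: ctsM; first exact: cts_cst.
apply: (@cts_sum _ _ _ _ _ (fun (j : 'I_N.+1) s => cutoff (N.+1%:R * N.+1%:R) (node N t j) s)) => j.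
by apply: continuous_subspaceT; exact: cutoff_cts.
Qed.

Lemma avg_cutoff_le1 N t s : `|avg_cutoff N t s| <= 1.
Proof.
rewrite normrM ger0_norm ?invr_ge0 ?ler0n// ler_pdivrMl// mulr1.
rewrite ger0_norm; last by apply: sumr_ge0 => j _; case/andP: (cutoff01 (N.+1%:R * N.+1%:R) (node N t j) s).
apply: (@le_trans _ _ (\sum_(j < N.+1) 1)); last by rewrite sumr_const card_ord.
by apply: ler_sum => j _; case/andP: (cutoff01 (N.+1%:R * N.+1%:R) (node N t j) s).
Qed.

Lemma avg_cutoff_cvg t s : avg_cutoff N t s @[N --> \oo] --> step t s.
Proof.
rewrite stepE; case: (leP s) => st.
  apply: cvg_near_cst; apply: nearW => N; apply/eqP.
  rewrite /avg_cutoff (eq_bigr (fun=> 1)); last first.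
    by move=> j _; apply: cutoff1; rewrite ?mulr_ge0// (le_trans st).
  by rewrite sumr_const card_ord mulVf// pnatr_eq0.
have st0 : 0 < s - t by rewrite subr_gt0.
apply: cvg_near_cst; have /= := near_infty_natSinv_lt (PosNum st0).
apply: filterS => N /= hN; apply/eqP; rewrite /avg_cutoff big1 ?mulr0// => j _; apply: cutoff0.
have NN0 : (0 : R) < N.+1%:R * N.+1%:R by rewrite mulr_gt0.
rewrite -ler_pdivrMr// mul1r opprD addrA lerBrDr; apply: le_trans (ltW hN).
rewrite -[X in X + _]mul1r -mulrDl ler_pdivrMr// mulrA mulVf ?pnatr_eq0// mul1r.
by rewrite addrC natr1 ler_nat.
Qed.

Section averaging.
Variables (H : Q -> 'rV[R]_d) (M : R).
Hypotheses (cH : {within slab, continuous H}) (M0 : 0 <= M).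
Hypothesis HM : forall q, slab q -> enorm (H q) <= M.
Implicit Types (m : MQ).

Let mS := @slab_measurable R d T.
Let bH : bmv slab H := ctv_bmv (slab_baire T) cH.

Let bstep a : bm slab (fun q : Q => step a q.1).
Proof.
split; last by exists 1 => q _; rewrite stepE; case: (q.1 <= a)%R; rewrite ?normr0 ?normr1.
apply: (@measurable_funS _ _ _ _ setT) => //.
apply: (measurableT_comp (f := step a)); last exact: measurable_fst.
by apply: measurable_indic; rewrite -set_itvNyc; exact: measurable_itv.
Qed.

Let bstepH a : bmv slab (fun q : Q => step a q.1 *: H q).
Proof. exact: bmvZf. Qed.

Let cavgH N t : {within slab, continuous (fun q : Q => avg_cutoff N t q.1 *: H q)}.
Proof.
apply: (@ctvZ R Q slab d (fun q : Q => avg_cutoff N t q.1)) => //.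
apply: continuous_subspaceT => q; apply: (@continuous_comp Q R R fst); first exact: cvg_fst.
exact: avg_cutoff_cts.
Qed.

(* the steps at nodes beyond [T] agree on the slab with the step at [T] *)
Let vint_step m a : 0 <= a ->
  vint m (`[0, Num.min T a]%classic `*` setT) H = vint m slab (fun q => step a q.1 *: H q).
Proof.
move=> a0; have sub : `[0, Num.min T a]%classic `*` setT `<=` slab.
  move=> q /= []; rewrite in_itv/= le_min => /andP[q0 /andP[qT _]] _.
  by apply/slabE; rewrite q0.
rewrite (vint_sub _ _ sub); apply: eq_vint => q /slabE/andP[q0 qT]; congr (_ *: _).
rewrite /step !indicE; congr (nat_of_bool _)%:R; apply/idP/idP; rewrite !inE/= in_itv/= le_min.
  by case=> /andP[_ /andP[]].
by move=> qa; rewrite q0 qT qa.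
Qed.

Let vint_avg_step m N t : vint m slab (fun q => avg_step N t q.1 *: H q) =
  N.+1%:R^-1 * \sum_(j < N.+1) vint m slab (fun q => step (node N t j) q.1 *: H q).
Proof.
pose F (j : 'I_N.+1) (q : Q) := step (node N t j) q.1 *: H q.
have bF j : bmv slab (F j) by exact: bstepH.
rewrite -(@vint_sum _ _ _ Q slab _ _ m slab F)// -vintZ//; last exact: bmv_sum.
by apply: eq_vint => q _; rewrite /F -scaler_suml scalerA.
Qed.

(** The average of the inequalities at the nodes has [avg_step] in front of [H];
[avg_cutoff] replaces it at the cost of [1 / N.+1] times the mass. *)
Lemma vint_avg_cutoff_le m (Phi : R -> R) (c E0 t : R) N : 0 <= t <= T ->
  (forall a, 0 <= a <= T -> Phi a + vint m (`[0, a]%classic `*` setT) H <= E0) ->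
  (forall j : 'I_N.+1, c <= Phi (Num.min T (node N t j))) ->
  c + vint m slab (fun q => avg_cutoff N t q.1 *: H q) <= E0 + N.+1%:R^-1 * M * tvr m slab.
Proof.
move=> /andP[t0 tT] hE hc.
have hstep (j : 'I_N.+1) : c + vint m slab (fun q => step (node N t j) q.1 *: H q) <= E0.
  have n0 := le_trans t0 (node_ge N t j).
  rewrite -vint_step//; apply: le_trans (hE (Num.min T (node N t j)) _); first by rewrite lerD2r.
  by rewrite ge_min lexx le_min n0 (le_trans t0).
have bstp : bmv slab (fun q => avg_step N t q.1 *: H q).
  apply: bmvZf => //; apply: bmZ.
  by apply: (@bm_sum _ _ _ _ _ _ (fun (j : 'I_N.+1) (q : Q) => step (node N t j) q.1)).
have bcut := ctv_bmv (slab_baire T) (@cavgH N t).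
have h1 : c + vint m slab (fun q => avg_step N t q.1 *: H q) <= E0.
  rewrite vint_avg_step -lerBrDl ler_pdivrMl//.
  apply: (@le_trans _ _ (\sum_(j < N.+1) (E0 - c))).
    by apply: ler_sum => j _; rewrite lerBrDl.
  by rewrite sumr_const card_ord -[leLHS]mulr_natl.
have h2 : vint m slab (fun q => avg_cutoff N t q.1 *: H q) -
    vint m slab (fun q => avg_step N t q.1 *: H q) <= N.+1%:R^-1 * M * tvr m slab.
  rewrite -vintB//; apply: (le_trans (ler_norm _)); apply: (le_trans (vint_le_tvint _ mS _)).
    exact: bmvB.
  rewrite -tvint_cst//; apply: tvint_le => //; [by apply: bm_enorm; exact: bmvB|exact: bm_cst|].
  move=> q sq; rewrite -scalerBl enormZ ler_pM ?enorm_ge0//; [exact: avg_cutoff_step|exact: HM].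
by have := lerD h1 h2; rewrite addrACA subrr addr0.
Qed.

Lemma vint_avg_cutoff_cvg m t : 0 <= t <= T ->
  vint m slab (fun q => avg_cutoff N t q.1 *: H q) @[N --> \oo] -->
  vint m (`[0, t]%classic `*` setT) H.
Proof.
move=> /andP[t0 tT]; rewrite -[X in `[0, X]](min_r tT) vint_step//.
apply: (@vint_bounded_cvg _ _ _ _ _ _ _ _ _ M) => //.
- by move=> N; exact: (ctv_bmv (slab_baire T) (@cavgH N t)).
- move=> N q i sq; rewrite mxE normrM -[leRHS]mul1r ler_pM ?avg_cutoff_le1//.
  by rewrite (le_trans (enorm_comp _ _))// HM.
- move=> q i sq; rewrite mxE; under eq_cvg do rewrite mxE.
  by apply: cvgM; [exact: avg_cutoff_cvg|exact: cvg_cst].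
Qed.

(** The pairing with the closed time interval from 0 to [t] is not weak-*
continuous, whereas the pairing with [avg_cutoff] is. The lower semicontinuity of
[Phi] from the right at [t] compensates for the use of later times. *)
Lemma cutoff_limit (Y : Type) (E : set_system Y) (FE : ProperFilter E)
    (Phi_ : Y -> R -> R) (Phi : R -> R) (P_ : Y -> MQ) (P : MQ) (K2 : R) (E0 t : R) :
  (\forall y \near E, tvr (P_ y) slab <= K2) ->
  (forall G : Q -> 'rV[R]_d, {within slab, continuous G} ->
     vint (P_ y) slab G @[y --> E] --> vint P slab G) ->
  (forall a (e : R), 0 <= a <= T -> 0 < e -> \forall y \near E, Phi a - e <= Phi_ y a) ->
  (forall (e : R), 0 < e -> exists2 r : R, 0 < r & forall a, t <= a <= T -> a - t < r ->
     Phi t - e <= Phi a) ->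
  0 <= t <= T ->
  (\forall y \near E, forall a, 0 <= a <= T ->
     Phi_ y a + vint (P_ y) (`[0, a]%classic `*` setT) H <= E0) ->
  Phi t + vint P (`[0, t]%classic `*` setT) H <= E0.
Proof.
move=> PK PP Phil Phis tT hineq; have /andP[t0 tleT] := tT.
apply/ler_addgt0Pr => e e0; have e2 : 0 < e / 2 by rewrite divr_gt0.
have [r r0 hr] := Phis _ e2; set c := Phi t - e / 2 - e / 2.
pose w N : R := N.+1%:R^-1.
have wcvg : w N @[N --> \oo] --> (0 : R).
  apply/cvgrPdist_lt => u u0; apply: filterS (near_infty_natSinv_lt (PosNum u0)) => N hN.
  by rewrite sub0r normrN ger0_norm ?invr_ge0.
have h N : w N < r ->
    c + vint P slab (fun q => avg_cutoff N t q.1 *: H q) <= E0 + w N * M * `|K2|.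
  move=> Nr; rewrite -lerBrDl; apply: (cvgr_to_le (PP _ (@cavgH N t))).
  have hn : \forall y \near E, forall j : 'I_N.+1, c <= Phi_ y (Num.min T (node N t j)).
    apply: filter_forall => j; have nt := node_ge N t j.
    have mT : t <= Num.min T (node N t j) <= T by rewrite ge_min lexx le_min tleT nt.
    have m0 : 0 <= Num.min T (node N t j) <= T by rewrite ge_min lexx le_min !(le_trans t0).
    apply: filterS (Phil _ _ m0 e2) => y; apply: le_trans; rewrite lerD2r; apply: hr => //.
    by apply: le_lt_trans Nr; apply: le_trans (node_le t j); rewrite lerD2r ge_min lexx orbT.
  apply: filterS3 PK hineq hn => y yK yE yc; rewrite lerBrDl.
  apply: (le_trans (vint_avg_cutoff_le tT yE yc)); rewrite lerD2l ler_wpM2l//.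
    by rewrite mulr_ge0// invr_ge0.
  exact: le_trans yK (ler_norm _).
have : c + vint P (`[0, t]%classic `*` setT) H - 0 * M * `|K2| <= E0.
  apply: (cvgr_to_le (F := \oo) (f := fun N => c + vint P slab (fun q => avg_cutoff N t q.1 *: H q) - w N * M * `|K2|)).
    apply: cvgB; last by apply: cvgMr_tmp; apply: cvgMr_tmp.
    by apply: cvgD; [exact: cvg_cst|exact: vint_avg_cutoff_cvg].
  apply: filterS (near_infty_natSinv_lt (PosNum r0)) => N hN; rewrite lerBlDr; exact: h.
rewrite /c; move: (vint _ _ _) => x; lra.
Qed.

End averaging.
End cutoffs.

(** * The dissipation inequality under limits and convex combinations *)

Section dissipation.
Context {R : realType} {d : nat} (T : R).
Local Notation torus := (torus R d).
Local Notation Q := (R * torus)%type.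
Local Notation slab := (@slab R d T).
Local Notation M := (@vmeasure R d _ torus setT).
Local Notation MQ := (@vmeasure R d _ Q slab).
Local Notation I t := (`[0, t]%classic : set R).
Implicit Types (p f : Q -> R) (V G H : Q -> 'rV[R]_d).

(** The integral of [f d|m| - G . dm], with [f] and [G] frozen at time [s]. *)
Definition gap f G (m : M) (s : R) : R := mass_at f m s - vint m setT (fun x => G (s, x)).

(** The common shape of all the inequalities defining dissipative solutions. It
is stable under limits and convex combinations when [f] and [p] are
nonnegative. *)
Definition dissipates p V H f G (E0 : R) (B : R -> M) (P : MQ) : Prop :=
  forall t, 0 <= t <= T ->
  gap p V (B t) t + tint t (fun s => gap f G (B s) s) + vint P (`[0, t]%classic `*` setT) H <= E0.

Variables (p f : Q -> R) (V G H : Q -> 'rV[R]_d).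
Hypotheses (cp : {within slab, continuous p}) (cf : {within slab, continuous f}).
Hypotheses (cV : {within slab, continuous V}) (cG : {within slab, continuous G}).
Hypothesis (cH : {within slab, continuous H}).
Hypotheses (p0 : forall q, slab q -> 0 <= p q) (f0 : forall q, slab q -> 0 <= f q).

Lemma gap_bm (B : R -> M) C : weakly_continuous T B -> tv_bounded T B C ->
  bm (I T) (fun s => gap f G (B s) s).
Proof.
move=> wB BC; apply: bmB; first exact: (mass_at_bm cf f0 wB BC).
exact: cts_bm_itv (slice_pair_cts wB BC cG).
Qed.

Lemma tint_gap (B : R -> M) C t : weakly_continuous T B -> tv_bounded T B C -> t <= T ->
  tint t (fun s => gap f G (B s) s) =
  tint t (fun s => mass_at f (B s) s) - tint t (fun s => vint (B s) setT (fun x => G (s, x))).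
Proof.
move=> wB BC tT; rewrite -tintB//; apply: (bm_itv tT).
  exact: (mass_at_bm cf f0 wB BC).
exact: cts_bm_itv (slice_pair_cts wB BC cG).
Qed.

Section limit.
Context (Y : Type) (E : set_system Y) {FE : ProperFilter E} (B_ : Y -> R -> M) (B : R -> M) (C : R).
Hypothesis T0 : 0 <= T.
Hypothesis wB_ : \forall y \near E, weakly_continuous T (B_ y).
Hypothesis BC_ : \forall y \near E, tv_bounded T (B_ y) C.
Hypothesis Beq : forall s phi (e : R), 0 <= s <= T -> continuous phi -> 0 < e ->
  exists2 r : R, 0 < r & \forall y \near E, forall s', 0 <= s' <= T -> `|s - s'| < r ->
    `|vint (B_ y s) setT phi - vint (B_ y s') setT phi| <= e.
Hypothesis Bcvg : forall s phi, 0 <= s <= T -> continuous phi ->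
  vint (B_ y s) setT phi @[y --> E] --> vint (B s) setT phi.
Variables (P_ : Y -> MQ) (P : MQ) (K2 E0 : R).
Hypothesis PK : \forall y \near E, tvr (P_ y) slab <= K2.
Hypothesis Pcvg : forall G, {within slab, continuous G} ->
  vint (P_ y) slab G @[y --> E] --> vint P slab G.

Let wB := path_limit_cts T0 wB_ Beq Bcvg.
Let BC := path_limit_bounded BC_ Bcvg.

Let phi (B : R -> M) a := gap p V (B a) a + tint a (fun s => gap f G (B s) s).

Let phi_lim a (e : R) : 0 <= a <= T -> 0 < e -> \forall y \near E, phi B a - e <= phi (B_ y) a.
Proof.
move=> aT e0; have e4 : 0 < e / 4 by rewrite divr_gt0.
have h1 := mass_limit (FE := FE) cp p0 Bcvg aT e4.
have /cvgrPdist_le/(_ _ e4) h2 := Bcvg aT (slice_cts cV aT).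
have h3 := mass_time_limit (FE := FE) cf f0 T0 wB_ BC_ Beq Bcvg aT e4.
have /cvgrPdist_le/(_ _ e4) h4 := vint_slice_limit (FE := FE) wB_ BC_ Beq Bcvg cG aT.
have FF : Filter E by exact: filter_filter.
have h := @filterI _ E FF _ _ (@filterI _ E FF _ _ h1 h2) (@filterI _ E FF _ _ h3 h4).
apply: filterS3 h wB_ BC_ => y [[y1 y2] [y3 y4]] wy yC.
have /andP[_ leaT] := aT.
rewrite /phi (tint_gap wB BC leaT) (tint_gap wy yC leaT) /gap.
move: y1 y2 y3 y4; rewrite !ler_norml => y1 /andP[y2 _] y3 /andP[y4 _].
move: y1 y2 y3 y4; move: (mass_at p (B a) a) (mass_at p (B_ y a) a)
  (vint (B a) setT (fun x => V (a, x))) (vint (B_ y a) setT (fun x => V (a, x)))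
  (tint a (fun s => mass_at f (B s) s)) (tint a (fun s => mass_at f (B_ y s) s))
  (tint a (fun s => vint (B s) setT (fun x => G (s, x))))
  (tint a (fun s => vint (B_ y s) setT (fun x => G (s, x)))).
by move=> x1 x2 x3 x4 x5 x6 x7 x8 y1 y2 y3 y4; lra.
Qed.

(** A field that is nearly optimal for the mass at time [t] bounds the mass from
below at nearby times; the time integral varies by at most a multiple of the
length of the interval. *)
Let phi_lsc t (e : R) : 0 <= t <= T -> 0 < e ->
  exists2 r : R, 0 < r & forall a, t <= a <= T -> a - t < r -> phi B t - e <= phi B a.
Proof.
move=> tT e0; have e4 : 0 < e / 4 by rewrite divr_gt0.
have pt x : 0 <= p (t, x) by apply: p0; exact/slabE.
have bp : bm setT (fun x => p (t, x)) by apply: bm_slice tT; apply: cts_bm cp; exact: slab_baire.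
have [F [cF F1 hF]] := tvint_polar_cts torus_baire (B t) bp (fun x _ => pt x) e4.
have {}cF : continuous (F : torus -> _) by apply/continuous_subspace_setT.
have /subspace_continuousP/(_ t) := pair_at_cts cp wB BC cF.
rewrite /= in_itv/= => /(_ tT)/cvgrPdist_le/(_ _ e4)/nbhs_ballP[r1 /= r10 hr1].
have /subspace_continuousP/(_ t) := slice_pair_cts wB BC cV.
rewrite /= in_itv/= => /(_ tT)/cvgrPdist_le/(_ _ e4)/nbhs_ballP[r2 /= r20 hr2].
have bg := gap_bm wB BC; have [_ [N hN]] := bg.
have N1 : 0 < `|N| + 1 by rewrite ltr_wpDl.
exists (Num.min (Num.min r1 r2) (e / 4 / (`|N| + 1))); first by rewrite !lt_min r10 r20 divr_gt0.
move=> a /andP[ta aT]; rewrite !lt_min => /andP[/andP[a1 a2] a3].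
have a0T : 0 <= a <= T by case/andP: tT => t0 _; rewrite (le_trans t0 ta).
have h1 := hr1 a _ _; have h2 := hr2 a _ _.
have ba r : a - t < r -> ball t r a.
  by move=> ar; rewrite -ball_normE /= distrC ger0_norm// subr_ge0.
have {}h1 := h1 (ba _ a1); have {}h2 := h2 (ba _ a2).
rewrite !in_itv/= in h1 h2.
have {}h1 : `|pair_at p F (B t) t - pair_at p F (B a) a| <= e / 4 := h1 a0T.
have {}h2 : `|vint (B t) setT (fun x => V (t, x)) - vint (B a) setT (fun x => V (a, x))| <= e / 4.
  exact: h2 a0T.
have h3 := pair_le_mass cp p0 (B a) cF F1 a0T.
have h4 : `|tint a (fun s => gap f G (B s) s) - tint t (fun s => gap f G (B s) s)| <= e / 4.
  apply: (@le_trans _ _ ((`|N| + 1) * (a - t))).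
    apply: tint_incr.
    - by case/andP: tT => -> _.
    - exact: (bm_itv aT).
    - move=> u /andP[u0 ua]; apply: (@le_trans _ _ N).
        by apply: hN; rewrite /= in_itv/= u0 (le_trans ua).
      by rewrite (le_trans (ler_norm _))// lerDl.
  by rewrite mulrC -ler_pdivlMr// ltW.
rewrite /phi /gap -/(gap f G).
move: hF h1 h2 h3 h4; rewrite -/(mass_at p (B t) t) -/(pair_at p F (B t) t) !ler_norml.
move: (mass_at p (B t) t) (mass_at p (B a) a) (pair_at p F (B t) t) (pair_at p F (B a) a)
  (vint (B t) setT (fun x => V (t, x))) (vint (B a) setT (fun x => V (a, x)))
  (tint t (fun s => mass_at f (B s) s - vint (B s) setT (fun x => G (s, x))))
  (tint a (fun s => mass_at f (B s) s - vint (B s) setT (fun x => G (s, x)))).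
by move=> x1 x2 x3 x4 x5 x6 x7 x8 y1 /andP[y2 y2'] /andP[y3 y3'] y4 /andP[y5 y5']; lra.
Qed.

Lemma dissipates_limit : (\forall y \near E, dissipates p V H f G E0 (B_ y) (P_ y)) ->
  dissipates p V H f G E0 B P.
Proof.
move=> hd t tT.
have [N N0 hN] : exists2 N : R, 0 <= N & forall q, slab q -> enorm (H q) <= N.
  have [_ [N hN]] := cts_bm (slab_baire T) (cts_enorm cH); exists `|N| => // q sq.
  by rewrite -[leLHS]ger0_norm ?enorm_ge0// (le_trans (hN q sq))// ler_norm.
apply: (cutoff_limit cH N0 hN FE (Phi_ := fun y => phi (B_ y)) (Phi := phi B) PK Pcvg) => //.
by move=> e; exact: phi_lsc.
Qed.

End limit.

Section convex.
Variables (a b : R).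
Hypotheses (a0 : 0 <= a) (b0 : 0 <= b).

Lemma vint_comb {disp} {X : topMeasurableType disp} (K D : set X) (m1 m2 : @vmeasure R d disp X K)
    (F : X -> 'rV[R]_d) : measurable D -> bmv D F ->
  vint (a *: m1 + b *: m2) D F = a * vint m1 D F + b * vint m2 D F.
Proof.
move=> mD bF; rewrite vint_mZD//; congr (_ + _).
by rewrite (_ : b *: m2 = (b - 1) *: m2 + m2) ?vint_mZD//; [ring|rewrite scalerBl scale1r subrK].
Qed.

(** Convexity of the total variation, through its polar form. *)
Lemma mass_at_comb (g : Q -> R) (m m1 m2 : M) s :
  (forall F, bmv setT F -> vint m setT F = a * vint m1 setT F + b * vint m2 setT F) ->
  {within slab, continuous g} -> (forall q, slab q -> 0 <= g q) -> 0 <= s <= T ->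
  mass_at g m s <= a * mass_at g m1 s + b * mass_at g m2 s.
Proof.
move=> mE cg g0 sT; apply/ler_addgt0Pr => e e0.
have bg : bm setT (fun x => g (s, x)) by apply: bm_slice sT; apply: cts_bm cg; exact: slab_baire.
have g0' x : 0 <= g (s, x) by apply: g0; exact/slabE.
have [G' [bG' G1 hG]] := tvint_polar m measurableT bg (fun x _ => g0' x) e0.
rewrite -lerBlDr (le_trans hG)// mE//; last exact: bmvZf.
by apply: lerD; rewrite ler_wpM2l//; exact: vint_le_enorm1.
Qed.

Variables (B B1 B2 : R -> M) (C1 C2 : R).
Hypotheses (wB1 : weakly_continuous T B1) (BC1 : tv_bounded T B1 C1).
Hypotheses (wB2 : weakly_continuous T B2) (BC2 : tv_bounded T B2 C2).
Hypothesis BE : forall s F, bmv setT F ->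
  vint (B s) setT F = a * vint (B1 s) setT F + b * vint (B2 s) setT F.

Lemma weakly_continuous_comb : weakly_continuous T B.
Proof.
move=> phi cphi; apply: (@cts_eq _ _ _ (fun t => a * vint (B1 t) setT phi + b * vint (B2 t) setT phi)).
  move=> t _; rewrite BE//.
  by exact: continuous_bmv.
by apply: ctsD; (apply: ctsM; [exact: cts_cst|]); [exact: wB1|exact: wB2].
Qed.

Lemma tv_bounded_comb : tv_bounded T B (a * C1 + b * C2).
Proof.
move=> t tT.
have c1 : {within slab, continuous (fun=> 1 : R)} by exact: cts_cst.
have := @mass_at_comb (fun=> 1) (B t) (B1 t) (B2 t) t (BE t) c1 (fun _ _ => ler01) tT.
rewrite /mass_at !tvint_cst// !mul1r => h; apply: (le_trans h).
by apply: lerD; rewrite ler_wpM2l//; [exact: BC1|exact: BC2].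
Qed.

Lemma dissipates_comb (P P1 P2 : MQ) E0 : a + b = 1 ->
  (forall D F, measurable D -> bmv D F -> vint P D F = a * vint P1 D F + b * vint P2 D F) ->
  dissipates p V H f G E0 B1 P1 -> dissipates p V H f G E0 B2 P2 ->
  dissipates p V H f G E0 B P.
Proof.
move=> ab1 PE d1 d2 t tT; have /andP[t0 tleT] := tT.
have mt : measurable (I t `*` [set: torus]) by exact: measurableX.
have sub : I t `*` [set: torus] `<=` slab.
  by move=> q /= []; rewrite in_itv/= => /andP[q0 qt] _; apply/slabE; rewrite q0 (le_trans qt).
have bH : bmv (I t `*` setT) H.
  have bHs : bmv slab H := ctv_bmv (slab_baire T) cH.
  exact: (bmv_sub (@slab_measurable R d T) mt sub bHs).
have gap_comb (g : Q -> R) (W : Q -> 'rV[R]_d) s : {within slab, continuous g} ->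
    (forall q, slab q -> 0 <= g q) -> {within slab, continuous W} -> 0 <= s <= T ->
    gap g W (B s) s <= a * gap g W (B1 s) s + b * gap g W (B2 s) s.
  move=> cg g0 cW sT; rewrite /gap BE//; last exact: slice_bmv cW sT.
  have := mass_at_comb (BE s) cg g0 sT.
  move: (mass_at g (B s) s) => x; lra.
have [bg1 bg2] := (bm_itv tleT (gap_bm wB1 BC1), bm_itv tleT (gap_bm wB2 BC2)).
have h : tint t (fun s => gap f G (B s) s) <=
    a * tint t (fun s => gap f G (B1 s) s) + b * tint t (fun s => gap f G (B2 s) s).
  rewrite -!tintZ// -tintD; [|exact: bmZ|exact: bmZ].
  apply: tint_le.
  - exact: (bm_itv tleT (gap_bm weakly_continuous_comb tv_bounded_comb)).
  - by apply: bmD; exact: bmZ.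
  - by move=> s /andP[s0 st]; apply: gap_comb => //; rewrite s0 (le_trans st).
have h' := gap_comb p V t cp p0 cV tT.
rewrite PE//; have := d1 t tT; have := d2 t tT.
move: h h'.
move: (gap p V (B t) t) (gap p V (B1 t) t) (gap p V (B2 t) t)
  (tint t (fun s => gap f G (B s) s)) (tint t (fun s => gap f G (B1 s) s))
  (tint t (fun s => gap f G (B2 s) s)) (vint P1 (I t `*` setT) H) (vint P2 (I t `*` setT) H).
move=> x1 x2 x3 x4 x5 x6 x7 x8 h1 h2 h3 h4.
rewrite -[E0]mul1r -ab1 mulrDl.
have := ler_wpM2l a0 h4; have := ler_wpM2l b0 h3; lra.
Qed.

End convex.
End dissipation.

(** * The fields of the dissipation inequality *)

Section trial_fields.
Context {R : realType} {d : nat} (T : R).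
Local Notation torus := (torus R d).
Local Notation Q := (R * torus)%type.
Local Notation slab := (@slab R d T).
Local Notation field := (Q -> 'rV[R]_d).
Local Notation e_ j := (delta_mx 0 j : 'rV[R]_d).
Local Notation ctf F := {within slab, continuous (F : Q -> 'rV[R]_d)}.
Implicit Types (b v A : field).

Lemma sup_norm_ge A q : ctf A -> slab q -> enorm (A q) <= sup_norm T A.
Proof.
move=> cA sq; have [_ [N hN]] := cts_bm (slab_baire T) (cts_enorm cA).
apply: ub_le_sup; last by exists q.
by exists N => _ [q' sq' <-]; rewrite (le_trans (ler_norm _))// hN.
Qed.

Lemma C1_slab_derivable v q j i : C1_slab T v -> slab q ->
  derivable (fun y => v (q.1, torus_pi y) 0 i) (repr q.2) (e_ j) /\
  'D_(e_ j) (fun y => v (q.1, torus_pi y) 0 i) (repr q.2) = xpartial j v q 0 i.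
Proof.
move=> [_ _ dv _ _] sq; have h := dv q j sq; split.
  by have /derivable_mxP := h; exact.
by rewrite /xpartial /partial (derive_mx h) mxE.
Qed.

(** The Leibniz rule expresses the last term of [L2], in which a scalar product is
differentiated, by derivatives that are continuous by assumption. *)
Lemma xpartial_dotp b v q j : C1_slab T b -> C1_slab T v -> slab q ->
  xpartial j (fun q' => dotp (b q') (v q') : R^o) q =
  dotp (xpartial j b q) (v q) + dotp (b q) (xpartial j v q).
Proof.
move=> Cb Cv sq.
pose g i (y : 'rV[R]_d) : R := b (q.1, torus_pi y) 0 i.
pose h i (y : 'rV[R]_d) : R := v (q.1, torus_pi y) 0 i.
have gh i : is_derive (repr q.2) (e_ j) (fun y => g i y * h i y)
    (b q 0 i * xpartial j v q 0 i + v q 0 i * xpartial j b q 0 i).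
  have [dg Eg] := C1_slab_derivable j i Cb sq; have [dh Eh] := C1_slab_derivable j i Cv sq.
  have := @is_deriveM _ _ (g i) (h i) (repr q.2) (e_ j) _ _ (DeriveDef dg Eg) (DeriveDef dh Eh).
  by rewrite /g /h torus_reprK -surjective_pairing.
have hs (r : seq 'I_d) : is_derive (repr q.2) (e_ j) (fun y => \sum_(i <- r) g i y * h i y)
    (\sum_(i <- r) (b q 0 i * xpartial j v q 0 i + v q 0 i * xpartial j b q 0 i)).
  elim: r => [|i r IH].
    rewrite big_nil (_ : (fun y => _) = fun=> 0); first exact: is_derive_cst.
    by apply/funext => y; rewrite big_nil.
  rewrite big_cons (_ : (fun y => _) = (fun y => g i y * h i y) + (fun y => \sum_(i <- r) g i y * h i y)).
    exact: is_deriveD.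
  by apply/funext => y; rewrite big_cons.
rewrite /xpartial /partial; have [_ ->] := hs (index_enum _).
rewrite /dotp -big_split/=; apply: eq_bigr => i _.
by rewrite addrC; congr (_ + _); rewrite mulrC.
Qed.

Lemma along_cts v b : C1_slab T v -> C1_slab T b -> ctf (along v b).
Proof.
move=> [cv _ _ _ _] [_ _ _ _ cb].
apply: (@ctv_sum _ _ _ _ _ _ (fun j q => v q 0 j *: xpartial j b q)) => j.
by apply: ctvZ; [exact: ctv_coord|exact: cb].
Qed.

Lemma L3_cts b v : trial T b v -> ctf (L3 b v).
Proof.
move=> [Cb Cv _]; have [cv _ _ _ _] := Cv.
apply: ctvD; last exact: along_cts.
apply: (@ctv_eq _ _ _ _ (fun q => -1 *: v q)); first by move=> q _; rewrite scaleN1r.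
by apply: ctvZ => //; exact: cts_cst.
Qed.

Lemma L2_cts b v : trial T b v -> ctf (L2 T b v).
Proof.
move=> [Cb Cv _]; have [cv _ _ _ cdv] := Cv; have [cb _ _ ctb cdb] := Cb.
have cN F : ctf F -> ctf (fun q => - F q).
  move=> cF; apply: (@ctv_eq _ _ _ _ (fun q => -1 *: F q)); first by move=> q _; rewrite scaleN1r.
  by apply: ctvZ => //; exact: cts_cst.
apply: ctvD; last first.
  apply: cN; apply: ctvZ => //.
  apply: (@cts_eq _ _ _ (fun q => \sum_j b q 0 j * (dotp (xpartial j b q) (v q) + dotp (b q) (xpartial j v q)))).
    by move=> q sq; apply: eq_bigr => j _; rewrite xpartial_dotp.
  apply: (@cts_sum _ _ _ _ _ (fun j q => b q 0 j * (dotp (xpartial j b q) (v q) + dotp (b q) (xpartial j v q)))) => j.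
  apply: ctsM; first exact: ctv_coord.
  exact: (ctsD (cts_dotp (cdb j) cv) (cts_dotp cb (cdv j))).
apply: ctvD; last by apply: ctvZ => //; exact: cts_dotp.
apply: ctvD; last exact: along_cts.
by apply: ctvD; [exact: cN|apply: cN; exact: along_cts].
Qed.

Definition weight v A (q : Q) : R := dotp (A q) (A q + 2 *: v q) / 2.

Lemma weight_cts v A : ctf v -> ctf A -> {within slab, continuous (weight v A : Q -> R)}.
Proof.
move=> cv cA; apply: ctsM; last exact: cts_cst.
apply: cts_dotp => //; apply: ctvD => //.
by apply: ctvZ => //; exact: cts_cst.
Qed.

Lemma weight_le v A l q : ctf v -> ctf A -> sup_norm T A <= l -> slab q ->
  weight v A q <= l ^+ 2 / 2 + l * sup_norm T v.
Proof.
move=> cv cA Al sq.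
have hA := le_trans (sup_norm_ge cA sq) Al; have hv := sup_norm_ge cv sq.
rewrite /weight dotpDr dotpZr -enorm_sqr mulrDl.
have A0 := enorm_ge0 (A q); have v0 := enorm_ge0 (v q).
have h1 := dotp_le (A q) (v q).
have h2 : enorm (A q) * enorm (v q) <= l * sup_norm T v by exact: ler_pM.
have h3 : enorm (A q) ^+ 2 <= l ^+ 2 by rewrite ler_pXn2r// nnegrE (le_trans A0).
move: h1 h2 h3; move: (dotp (A q) (v q)) (enorm (A q) * enorm (v q)) (l * sup_norm T v)
 (enorm (A q) ^+ 2) (l ^+ 2) => x1 x2 x3 x4 x5; lra.
Qed.

End trial_fields.

Section inequality_shape.
Context {R : realType} {d : nat} (T : R).
Local Notation torus := (torus R d).
Local Notation Q := (R * torus)%type.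
Local Notation slab := (@slab R d T).
Local Notation M := (@vmeasure R d _ torus setT).
Local Notation MQ := (@vmeasure R d _ Q slab).
Local Notation field := (Q -> 'rV[R]_d).
Variables (b v A : field) (c r : R).
Hypotheses (tbv : trial T b v) (CA : C1_slab T A).

Definition decay (q : Q) : R := expR (- r * q.1).
Definition slack (q : Q) : R := r - c - weight v A q.
Definition end_field : field := fun q => decay q *: b q.
Definition momentum_field : field := fun q => decay q *: (A q - L3 b v q).
Definition mass_weight (q : Q) : R := decay q * slack q.
Definition source_field : field := fun q =>
  decay q *: (slack q *: b q + (L2 T b v q + weight v A q *: b q)).

Let cb : {within slab, continuous b}. Proof. by case: tbv => -[]. Qed.
Let cv : {within slab, continuous v}. Proof. by case: tbv => _ []. Qed.
Let cA : {within slab, continuous A}. Proof. by case: CA. Qed.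

Lemma decay_cts : {within slab, continuous decay}.
Proof.
apply: continuous_subspaceT => q.
have h : continuous (fun q : Q => - r * q.1).
  by move=> p; apply: cvgM; [exact: cvg_cst|exact: cvg_fst].
exact: (continuous_comp (h q) (@continuous_expR R _)).
Qed.

Lemma slack_cts : {within slab, continuous slack}.
Proof. by apply: ctsB; [exact: cts_cst|exact: weight_cts]. Qed.

Lemma end_field_cts : {within slab, continuous end_field}.
Proof. by apply: ctvZ => //; exact: decay_cts. Qed.

Lemma momentum_field_cts : {within slab, continuous momentum_field}.
Proof.
apply: ctvZ; first exact: decay_cts.
apply: ctvD => //; apply: (@ctv_eq _ _ _ _ (fun q => -1 *: L3 b v q)).
  by move=> q _; rewrite scaleN1r.
by apply: ctvZ; [exact: cts_cst|exact: L3_cts].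
Qed.

Lemma mass_weight_cts : {within slab, continuous mass_weight}.
Proof. by apply: ctsM; [exact: decay_cts|exact: slack_cts]. Qed.

Lemma source_field_cts : {within slab, continuous source_field}.
Proof.
apply: ctvZ; first exact: decay_cts.
apply: ctvD; first by apply: ctvZ => //; exact: slack_cts.
by apply: ctvD; [exact: L2_cts|apply: ctvZ => //; exact: weight_cts].
Qed.

Lemma decay_ge0 q : 0 <= decay q. Proof. exact: expR_ge0. Qed.

(** The lower bound on [r] serves to make the weight of the total variation
nonnegative. *)
Lemma slack_ge0 l : sup_norm T A <= l -> c + l ^+ 2 / 2 + l * sup_norm T v <= r ->
  forall q, slab q -> 0 <= slack q.
Proof.
move=> Al rl q sq; have := weight_le cv cA Al sq; rewrite /slack; move: rl.
by move: (l ^+ 2 / 2) (l * sup_norm T v) (weight v A q) => x1 x2 x3; lra.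
Qed.

Lemma gap_end (m : M) t : 0 <= t <= T ->
  gap decay end_field m t = expR (- r * t) * etaint m (fun x => b (t, x)) (fun=> 1).
Proof.
move=> tT; have bb := slice_bmv cb tT.
rewrite /gap /mass_at /etaint /end_field /decay /= tvint_cst// tvint_cst// mul1r mulrBr.
congr (_ - _); rewrite vintZ//; congr (_ * _).
by apply: eq_vint => x _; rewrite scale1r.
Qed.

Lemma gap_source (m : M) s : 0 <= s <= T ->
  gap mass_weight source_field m s = expR (- r * s) *
    (etaint m (fun x => b (s, x)) (fun x => r - c - weight v A (s, x))
     - vint m setT (fun x => L2 T b v (s, x) + weight v A (s, x) *: b (s, x))).
Proof.
move=> sT; have bb := slice_bmv cb sT.
have bs : bm setT (fun x => slack (s, x)).
  by apply: bm_slice sT; apply: cts_bm slack_cts; exact: slab_baire.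
have bw : bm setT (fun x => weight v A (s, x)).
  apply: bm_slice sT; apply: cts_bm (weight_cts cv cA); exact: slab_baire.
have bL : bmv setT (fun x => L2 T b v (s, x)) by exact: slice_bmv (L2_cts tbv) sT.
rewrite /gap /mass_at /etaint /mass_weight /source_field /decay /= tvintZ// vintZ//; last first.
  apply: bmvD; first exact: bmvZf.
  by apply: bmvD => //; exact: bmvZf.
rewrite vintD//; [|exact: bmvZf|by apply: bmvD => //; exact: bmvZf].
by rewrite -mulrBr opprD addrA.
Qed.

(** Multiplied out, the integrand consists of a weight in front of the total
variation and of a field paired with the measure, as in [dissipates]. *)
Lemma diss_ineqE (B : R -> M) (P : MQ) t : 0 <= t <= T ->
  diss_ineq B P b v A c r t <->
  gap decay end_field (B t) t + tint t (fun s => gap mass_weight source_field (B s) s)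
  + vint P (`[0, t]%classic `*` setT) momentum_field
  <= etaint (B 0) (fun x => b (0, x)) (fun=> 1).
Proof.
move=> tT; rewrite gap_end// addrAC /diss_ineq -/(weight v A).
rewrite (eq_tint (l := fun s => expR (- r * s) *
    (etaint (B s) (fun x => b (s, x)) (fun x => r - c - weight v A (s, x))
     - vint (B s) setT (fun x => L2 T b v (s, x) + weight v A (s, x) *: b (s, x))))) //.
move=> s /andP[s0 st]; apply: gap_source; rewrite s0 (le_trans st)//.
by case/andP: tT.
Qed.

End inequality_shape.

(** * A priori bounds on solutions *)

Section constant_trial.
Context {R : realType} {d : nat} (T : R).
Hypothesis T0 : 0 < T.
Local Notation torus := (torus R d).
Local Notation Q := (R * torus)%type.
Local Notation slab := (@slab R d T).
Implicit Types (u : 'rV[R]_d) (q : Q).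

(** Difference quotients in time are one-sided at the ends of the interval, which
must not be reduced to a point. *)
Lemma tincr_proper q : slab q -> ProperFilter (tincr T q).
Proof.
move=> /slabE/andP[q0 qT]; apply: Build_ProperFilter_ex => P.
rewrite /tincr /within /= => /nbhs_ballP[e /= e0 he].
have e2 : 0 < e / 2 by rewrite divr_gt0.
have inball (h : R) : `|h| <= e / 2 -> ball 0 e h.
  by move=> hh; rewrite -ball_normE /= sub0r normrN (le_lt_trans hh)//; lra.
have [qltT|] := ltP q.1 T.
  have h0 : 0 < Num.min (e / 2) (T - q.1) by rewrite lt_min e2 subr_gt0.
  exists (Num.min (e / 2) (T - q.1)); apply: he.
  - by apply: inball; rewrite ger0_norm ?(ltW h0)// ge_min lexx.
  - by rewrite gt_eqF.
  - rewrite /= in_itv/= addr_ge0 ?(ltW h0)//=.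
    by rewrite -lerBrDl ge_min lexx orbT.
move=> Tq; have h0 : 0 < Num.min (e / 2) T by rewrite lt_min e2 T0.
exists (- Num.min (e / 2) T); apply: he.
- by apply: inball; rewrite normrN ger0_norm ?(ltW h0)// ge_min lexx.
- by rewrite oppr_eq0 gt_eqF.
- rewrite /= in_itv/= subr_ge0 (le_trans _ Tq) ?ge_min ?lexx ?orbT//=.
  by rewrite lerBlDr (le_trans qT)// lerDl ltW.
Qed.

Lemma tquotient_cst {W : normedModType R} (u : W) q : tquotient (fun _ : Q => u) q = fun=> 0.
Proof. by apply/funext => h; rewrite /tquotient subrr scaler0. Qed.

Lemma tpartial_cst {W : normedModType R} (u : W) q : slab q -> tpartial T (fun _ : Q => u) q = 0.
Proof.
move=> sq; have PF := tincr_proper sq.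
by rewrite /tpartial tquotient_cst; apply: cvg_lim => //; exact: cvg_cst.
Qed.

Lemma xpartial_cst {W : normedModType R} (u : W) j q : xpartial j (fun _ : Q => u) q = 0.
Proof. by rewrite /xpartial /partial; exact: derive_cst. Qed.

Lemma C1_slab_cst u : C1_slab T (fun _ : Q => u).
Proof.
split.
- exact: ctv_cst.
- move=> q sq; rewrite tquotient_cst; have PF := tincr_proper sq.
  by apply/cvg_ex; exists 0; exact: cvg_cst.
- by move=> q j _; exact: derivable_cst.
- apply: (@ctv_eq _ _ _ _ (fun=> 0)); last exact: ctv_cst.
  by move=> q sq; rewrite tpartial_cst.
- move=> j; apply: (@ctv_eq _ _ _ _ (fun=> 0)); last exact: ctv_cst.
  by move=> q sq; rewrite xpartial_cst.
Qed.

Lemma trial_cst u : dotp u u = 1 -> trial T (fun _ : Q => u) (fun=> 0).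
Proof. by move=> u1; split=> //; exact: C1_slab_cst. Qed.

Lemma L3_cst u q : L3 (fun _ : Q => u) (fun=> 0) q = 0.
Proof.
by rewrite /L3 /along oppr0 add0r big1// => j _; rewrite xpartial_cst scaler0.
Qed.

Lemma L2_cst u q : slab q -> L2 T (fun _ : Q => u) (fun=> 0) q = 0.
Proof.
move=> sq; rewrite /L2 tpartial_cst// /along dotp0l scale0r.
rewrite !big1 ?oppr0 ?scale0r ?subr0 ?addr0//.
- by move=> j _; rewrite xpartial_cst scaler0.
- by move=> j _; rewrite xpartial_cst scaler0.
- by move=> j _; rewrite mxE scale0r.
Qed.

Lemma sup_norm0 : sup_norm T (fun _ : Q => 0 : 'rV[R]_d) = 0.
Proof.
rewrite /sup_norm -[RHS](sup1 0); congr sup.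
apply/seteqP; split=> r /=; first by case=> _ _ <-; exact: enorm0.
move=> ->; exists (0, point); last exact: enorm0.
by apply/slabE; rewrite /= lexx ltW.
Qed.

End constant_trial.

Section a_priori.
Context {R : realType} {d : nat} (T : R).
Local Notation torus := (torus R d).
Local Notation Q := (R * torus)%type.
Local Notation slab := (@slab R d T).
Local Notation M := (@vmeasure R d _ torus setT).
Local Notation MQ := (@vmeasure R d _ Q slab).
Local Notation field := (Q -> 'rV[R]_d).
Variables (cstar : field -> field -> R) (K1 K2 : R) (B0 : M).
Hypotheses (d0 : (0 < d)%N) (T0 : 0 < T).

Lemma etaint_ge0 (m : M) (b : torus -> 'rV[R]_d) f : bm setT f -> bmv setT b ->
  (forall x, 0 <= f x) -> (forall x, enorm (b x) <= 1) -> 0 <= etaint m b f.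
Proof. by move=> bf bb f0 b1; rewrite subr_ge0; exact: vint_le_enorm1. Qed.

Lemma Ck1_cst (u : 'rV[R]_d) : Ck 1 (fun _ : torus => u).
Proof.
exact: (@C1p_Ck1 R d (fun=> u) (fun i => C1p_cst (u 0 i))).
Qed.

(** For a constant unit field [b] the source terms vanish, so that [|B| - B . b]
grows at most exponentially, and [B . b] is controlled by the bound on
solutions. *)
Lemma solution_tv_bounded : exists C : R, forall (B : R -> M) (P : MQ),
  dissipative_solution cstar K1 K2 B0 B P -> tv_bounded T B C.
Proof.
pose u : 'rV[R]_d := delta_mx 0 (Ordinal d0).
have u1 : enorm u = 1 by rewrite -[u]scale1r enorm_delta normr1.
have uu : dotp u u = 1 by rewrite -enorm_sqr u1 expr1n.
pose b : field := fun=> u; pose z : field := fun=> 0.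
have tb : trial T b z by exact: trial_cst.
have C0 : C1_slab T z by exact: C1_slab_cst.
(* the least value of [r] allowed for [A = 0] and [lambda = 1] *)
pose c := cstar b z; pose r := c + 1 ^+ 2 / 2 + 1 * sup_norm T z.
pose N := C1_norm (fun _ : torus => u).
pose E0 := etaint B0 (fun=> u) (fun=> 1).
have bu D : bmv D (fun _ : torus => u) by exact: bmv_cst.
have eta0 m (k : R) : 0 <= k -> 0 <= etaint m (fun=> u) (fun=> k).
  by move=> k0; apply: etaint_ge0 => //; [exact: bm_cst|move=> x; rewrite u1].
exists (expR (`|r| * T) * E0 + `|K1 * N|) => B P solB t tT.
have tT' : t \in `[0, T] by rewrite in_itv.
have sl : sup_norm T z <= 1 by rewrite sup_norm0.
have := diss_dissipation solB ltr01 tT' tb C0 sl (lexx r).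
rewrite /diss_ineq.
have -> : vint P (`[0, t]%classic `*` setT) (fun q => expR (- r * q.1) *: (z q - L3 b z q)) = 0.
  rewrite -[RHS](vint0 P (`[0, t]%classic `*` setT)); apply: eq_vint => q _.
  by rewrite L3_cst subr0 scaler0.
rewrite addr0 (diss_init solB) => h.
have hI : 0 <= \int[lebesgue_measure]_(s in `[0, t])
      (expR (- r * s) * (etaint (B s) (fun x => b (s, x)) (fun x => r - c - dotp (z (s, x)) (z (s, x) + 2 *: z (s, x)) / 2)
         - vint (B s) setT (fun x => L2 T b z (s, x) + (dotp (z (s, x)) (z (s, x) + 2 *: z (s, x)) / 2) *: b (s, x)))).
  apply: Rintegral_ge0 => s; rewrite /= in_itv/= => /andP[s0 st].
  have sT : 0 <= s <= T by rewrite s0 (le_trans st)//; case/andP: tT.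
  rewrite mulr_ge0 ?expR_ge0// (_ : vint _ _ _ = 0) ?subr0.
    rewrite (_ : (fun x => _) = fun=> r - c); last first.
      by apply/funext => x; rewrite dotp0l mul0r subr0.
    apply: eta0.
    by rewrite /r sup_norm0 // mulr0 addr0 addrAC subrr add0r expr1n divr_ge0.
  rewrite -[RHS](vint0 (B s) setT); apply: eq_vint => x _.
  by rewrite L2_cst// dotp0l mul0r scale0r addr0.
have {}h : expR (- r * t) * etaint (B t) (fun=> u) (fun=> 1) <= E0.
  by apply: le_trans h; rewrite lerDl.
have hu : vint (B t) setT (fun=> u) <= `|K1 * N|.
  by rewrite (le_trans (ler_norm _))// (le_trans (diss_bound solB tT' (Ck1_cst u)))// ler_norm.
have E00 : 0 <= E0 by exact: eta0.
have : etaint (B t) (fun=> u) (fun=> 1) <= expR (`|r| * T) * E0.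
  rewrite mulNr expRN ler_pdivrMl ?expR_gt0// in h.
  apply: (le_trans h); rewrite ler_wpM2r// ler_expR.
  case/andP: tT => t0 tT.
  apply: (@le_trans _ _ (`|r| * t)); first by rewrite ler_wpM2r// ler_norm.
  by rewrite ler_wpM2l.
have E1 : vint (B t) setT (fun x => 1 *: u) = vint (B t) setT (fun=> u).
  by apply: eq_vint => x _; rewrite scale1r.
rewrite /etaint tvint_cst// mul1r E1.
by move: hu; rewrite -/N; move: (tvr (B t) setT) (vint (B t) setT (fun=> u)) (expR (`|r| * T) * E0) => x1 x2 x3; lra.
Qed.

Lemma solution_wcts (B : R -> M) (P : MQ) : dissipative_solution cstar K1 K2 B0 B P ->
  weakly_continuous T B.
Proof. by move=> s; apply/weakly_continuousP; exact: diss_continuous s. Qed.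

(** The Hoelder bound is stated for smooth fields only; density and the mass
bound extend equicontinuity in time to all continuous fields. *)
Lemma solution_equicontinuous (phi : torus -> 'rV[R]_d) (e : R) : continuous phi -> 0 < e ->
  exists2 r : R, 0 < r & forall (B : R -> M) (P : MQ) s s',
    dissipative_solution cstar K1 K2 B0 B P -> 0 <= s <= T -> 0 <= s' <= T -> `|s - s'| < r ->
    `|vint (B s) setT phi - vint (B s') setT phi| <= e.
Proof.
move=> cphi e0; have e33 : e / 3 + e / 3 + e / 3 = e by lra.
have [C hC] := solution_tv_bounded.
have e3 : 0 < e / 3 by rewrite divr_gt0.
have dC0 : 0 < d%:R * `|C| + 1 by rewrite ltr_wpDl// mulr_ge0.
have e4 : 0 < e / 3 / (d%:R * `|C| + 1) by rewrite divr_gt0.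
have [G [CG phiG]] := C1_dense cphi e4.
pose N := C1_norm G.
have KN0 : 0 < `|K1 * N| + 1 by rewrite ltr_wpDl.
pose w := e / 3 / (`|K1 * N| + 1); have w0 : 0 < w by rewrite divr_gt0.
exists (w ^+ 2); first by rewrite exprn_gt0.
move=> B P s s' solB sT s'T ss'.
have cG : continuous (G : torus -> _) by case: CG.
have bG : bmv setT (G : torus -> _) by exact: continuous_bmv.
have bphi : bmv setT phi by exact: continuous_bmv.
have near_ t : 0 <= t <= T -> `|vint (B t) setT phi - vint (B t) setT G| <= e / 3.
  move=> tT; rewrite -vintB//.
  apply: (le_trans (vint_le_sup (N := d%:R * (e / 3 / (d%:R * `|C| + 1))) _ _ _)).
  - exact: bmvB.
  - by move=> x; apply: enorm_le_max => i; rewrite !mxE.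
  apply: (@le_trans _ _ (d%:R * (e / 3 / (d%:R * `|C| + 1)) * `|C|)).
    apply: ler_wpM2l; first by rewrite mulr_ge0// ltW.
    by rewrite (le_trans (hC B P solB t tT))// ler_norm.
  rewrite mulrAC mulrA -[leLHS]mulrA mulrC -[leLHS]mulrA ler_piMr ?(ltW e3)//.
  by rewrite mulrC ler_pdivrMr// mul1r lerDl.
have hGG : `|vint (B s) setT G - vint (B s') setT G| <= e / 3.
  rewrite -vint_mB//.
  have := diss_holder solB (t0 := s') (t1 := s); rewrite !in_itv/= => /(_ s'T sT G CG) h.
  apply: (le_trans h).
  have hs : Num.sqrt `|s - s'| <= w.
    by rewrite -(ger0_norm (ltW w0)) -(sqrtr_sqr w) ler_sqrt ?sqr_ge0// ltW.
  apply: (@le_trans _ _ (`|K1 * N| * w)).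
    rewrite mulrAC -/N; apply: (@le_trans _ _ (`|K1 * N| * Num.sqrt `|s - s'|)).
      by rewrite ler_wpM2r ?sqrtr_ge0// ler_norm.
    by rewrite ler_wpM2l.
  by rewrite /w mulrCA ler_piMr ?(ltW e3)// ler_pdivrMr// mul1r lerDl.
have h1 := near_ s sT; have h2 := near_ s' s'T; rewrite distrC in h2.
have h3 := ler_normD (vint (B s) setT phi - vint (B s) setT G) (vint (B s) setT G - vint (B s') setT G).
have h4 := ler_normD (vint (B s) setT phi - vint (B s') setT G) (vint (B s') setT G - vint (B s') setT phi).
rewrite subrKA in h3; rewrite subrKA in h4.
apply: (le_trans h4); apply: (le_trans (lerD (le_trans h3 (lerD h1 hGG)) h2)).
by rewrite e33.
Qed.

End a_priori.

(** * Convexity and compactness of the set of solutions *)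

(** Indexing the ultrafilter by an arbitrary type makes the two components
functions that converge separately. *)
Lemma compact_prod_ultra (U W : topologicalType) (S : set (U * W)) :
  (forall (Y : Type) (E : set_system Y), UltraFilter E -> forall (u : Y -> U) (w : Y -> W),
     (\forall y \near E, S (u y, w y)) ->
     exists u' w', [/\ S (u', w'), u @ E --> u' & w @ E --> w']) -> compact S.
Proof.
move=> h; rewrite compact_ultra => E UE ES.
have FF : Filter E by exact: (@filter_filter _ _ (@ultra_proper _ _ UE)).
have [|p1 [p2 [Sp c1 c2]]] := h _ E UE fst snd.
  by apply: (@filterS _ E FF _ _ _ ES) => -[].
exists (p1, p2); split=> //=.
have F1 : Filter (nbhs p1) by exact: filter_filter.
have F2 : Filter (nbhs p2) by exact: filter_filter.
have {}h := @cvg_pair _ _ _ E (nbhs p1) (nbhs p2) FF F1 F2 fst snd c1 c2.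
move=> A nA; have EA := h A nA.
by apply: (@filterS _ E FF _ _ _ EA) => -[].
Qed.

Section solutions.
Context {R : realType} {d : nat} (T : R).
Local Notation torus := (torus R d).
Local Notation Q := (R * torus)%type.
Local Notation slab := (@slab R d T).
Local Notation M := (@vmeasure R d _ torus setT).
Local Notation MQ := (@vmeasure R d _ Q slab).
Local Notation field := (Q -> 'rV[R]_d).
Variables (cstar : field -> field -> R) (K1 K2 : R) (B0 : M).
Hypotheses (d0 : (0 < d)%N) (T0 : 0 < T).
Let T0' : 0 <= T := ltW T0.
Local Notation sol := (dissipative_solution cstar K1 K2 B0).

Definition admissible (b v A : field) (r : R) : Prop :=
  [/\ trial T b v, C1_slab T A & exists2 l : R, 0 < l &
    sup_norm T A <= l /\ cstar b v + l ^+ 2 / 2 + l * sup_norm T v <= r].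

Definition dissipation (B : R -> M) (P : MQ) : Prop := forall b v A r, admissible b v A r ->
  dissipates (decay r) (end_field b r) (momentum_field b v A r)
    (mass_weight v A (cstar b v) r) (source_field T b v A (cstar b v) r)
    (etaint B0 (fun x => b (0, x)) (fun=> 1)) B P.

Lemma dissipationP (B : R -> M) (P : MQ) : B 0 = B0 ->
  (forall (lambda t : R) b v A (r : R),
    0 < lambda -> t \in `[0, T] -> trial T b v -> C1_slab T A ->
    sup_norm T A <= lambda ->
    cstar b v + lambda ^+ 2 / 2 + lambda * sup_norm T v <= r ->
    diss_ineq B P b v A (cstar b v) r t) <-> dissipation B P.
Proof.
move=> B00; split.
  move=> h b v A r [tbv CA [l l0 [Al lr]]] t tT.
  by have := iffLR (diss_ineqE _ _ tbv CA B P tT) (h l t b v A r l0 (tT : t \in `[0, T]) tbv CA Al lr); rewrite B00.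
move=> h l t b v A r l0 tT tbv CA Al lr.
have tT' : 0 <= t <= T by move: tT; rewrite in_itv.
apply: (iffRL (diss_ineqE (cstar b v) r tbv CA B P tT')).
by rewrite B00; apply: h => //; split=> //; exists l.
Qed.

Lemma grad_continuous (phi : torus -> R^o) : Ck 1 phi -> continuous (grad phi : torus -> 'rV[R]_d).
Proof.
move=> [_ h]; apply/continuous_subspace_setT/ctv_coordP => i.
apply: (@cts_eq _ _ _ (partial i phi)); first by move=> x _; rewrite mxE.
by apply: continuous_subspaceT; case: (h i) => _ [].
Qed.

(** A bound on the mass is a family of bounds on pairings, and as such is stable
under limits and convex combinations. *)
Lemma tvr_le_polar (P : MQ) K : (forall F : field, {within slab, continuous F} ->
    (forall q, enorm (F q) <= 1) -> vint P slab F <= K) -> tvr P slab <= K.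
Proof.
move=> h; apply/ler_addgt0Pr => e e0.
have [F [cF F1 hF]] := tvint_polar_cts (slab_baire T) P (bm_cst slab 1) (fun x _ => ler01) e0.
rewrite tvint_cst ?mul1r in hF; last exact: slab_measurable.
rewrite -lerBlDr (le_trans hF)// (_ : vint _ _ _ = vint P slab F) ?h//.
by apply: eq_vint => q _; rewrite scale1r.
Qed.

Lemma vint_le_tvr (P : MQ) (F : field) : {within slab, continuous F} ->
  (forall q, enorm (F q) <= 1) -> vint P slab F <= tvr P slab.
Proof.
move=> cF F1; rewrite (le_trans (ler_norm _))// (le_trans (vint_le_tvint _ _ _))//.
- exact: slab_measurable.
- exact: slab_bmv.
rewrite -[leRHS]mul1r -tvint_cst; last exact: slab_measurable.
apply: tvint_le; [exact: slab_measurable| |exact: bm_cst|by []].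
by apply: bm_enorm; exact: slab_bmv.
Qed.

Lemma tv_leE (P : MQ) K : (tv (val P) slab <= K%:E)%E = (tvr P slab <= K).
Proof. by rewrite -lee_fin fineK// tv_fin. Qed.

Lemma val_comb {disp} {X : measurableType disp} (K : set X) (a b : R) (m1 m2 : @vmeasure R d disp X K) A i :
  val (a *: m1 + b *: m2) A 0 i = a * val m1 A 0 i + b * val m2 A 0 i.
Proof. by rewrite raddfD /= !mxE. Qed.

Section convexity.
Variables (a b : R) (a0 : 0 <= a) (b0 : 0 <= b) (ab1 : a + b = 1).
Variables (B1 B2 : R -> M) (P1 P2 : MQ).
Hypotheses (s1 : sol B1 P1) (s2 : sol B2 P2).
Let B (s : R) : M := a *: B1 s + b *: B2 s.
Let P : MQ := a *: P1 + b *: P2.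

Let BE s F : bmv setT F -> vint (B s) setT F = a * vint (B1 s) setT F + b * vint (B2 s) setT F.
Proof. by move=> bF; exact: vint_comb. Qed.

Let PE D F : measurable D -> bmv D F -> vint P D F = a * vint P1 D F + b * vint P2 D F.
Proof. exact: vint_comb. Qed.

Let comb_le x y K : x <= K -> y <= K -> a * x + b * y <= K.
Proof.
move=> xK yK; rewrite -[K]mul1r -ab1 mulrDl.
by apply: lerD; rewrite ler_wpM2l.
Qed.

Let comb_norm x y K : `|x| <= K -> `|y| <= K -> `|a * x + b * y| <= K.
Proof.
move=> xK yK; rewrite (le_trans (ler_normD _ _))// !normrM (ger0_norm a0) (ger0_norm b0).
exact: comb_le.
Qed.

Lemma solution_comb : sol B P.
Proof.
have [C hC] := solution_tv_bounded cstar K1 K2 B0 d0 T0.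
have [w1 w2] := (solution_wcts s1, solution_wcts s2).
have [C1 C2] := (hC _ _ s1, hC _ _ s2).
have Ck1_bmv (phi : torus -> 'rV[R]_d) : Ck 1 phi -> bmv setT phi.
  by move=> [cphi _]; exact: continuous_bmv.
have B0E : B 0 = B0 by rewrite /B (diss_init s1) (diss_init s2) -scalerDl ab1 scale1r.
split=> //.
- apply/weakly_continuousP; exact: (weakly_continuous_comb w1 w2 BE).
- move=> t tT phi sphi; have bg := continuous_bmv (grad_continuous (sphi 1)).
  by rewrite BE// (diss_div_free s1)// (diss_div_free s2)// !mulr0 addr0.
- move=> t tT phi Cphi; rewrite BE; last exact: Ck1_bmv.
  by apply: comb_norm; [exact: (diss_bound s1)|exact: (diss_bound s2)].
- move=> t0 t1 t0T t1T phi Cphi; have bphi := Ck1_bmv _ Cphi.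
  rewrite vint_mB// !BE//.
  have h1 := diss_holder s1 t0T t1T Cphi; have h2 := diss_holder s2 t0T t1T Cphi.
  rewrite vint_mB// in h1; rewrite vint_mB// in h2.
  have := comb_norm h1 h2; rewrite !mulrBr; congr (`|_| <= _); ring.
- rewrite tv_leE; apply: tvr_le_polar => F cF F1.
  rewrite PE; [|exact: slab_measurable|exact: slab_bmv].
  by apply: comb_le; (apply: (le_trans (vint_le_tvr _ cF F1)); rewrite -tv_leE); [exact: (diss_tv s1)|exact: (diss_tv s2)].
- apply/(dissipationP _ B0E) => b' v A r adm.
  have D1 := iffLR (dissipationP _ (diss_init s1)) (diss_dissipation s1) b' v A r adm.
  have D2 := iffLR (dissipationP _ (diss_init s2)) (diss_dissipation s2) b' v A r adm.
  have [tbv CA [l l0 [Al lr]]] := adm.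
  have sl := slack_ge0 tbv CA Al lr.
  have cd := @decay_cts R d T r.
  have cm : {within slab, continuous (mass_weight v A (cstar b' v) r)} := mass_weight_cts tbv CA.
  have ce : {within slab, continuous (end_field b' r)} := end_field_cts tbv.
  have cs : {within slab, continuous (source_field T b' v A (cstar b' v) r)} := source_field_cts tbv CA.
  have cmo : {within slab, continuous (momentum_field b' v A r)} := momentum_field_cts tbv CA.
  have p0 q : slab q -> 0 <= decay r q by move=> _; exact: decay_ge0.
  have f0 q : slab q -> 0 <= mass_weight v A (cstar b' v) r q.
    by move=> sq; rewrite mulr_ge0 ?decay_ge0// sl.
  exact: (dissipates_comb cd cm ce cs cmo p0 f0 a0 b0 w1 C1 w2 C2 BE ab1 PE D1 D2).
Qed.

Lemma disintegrates_comb (mu1 mu2 : MQ) : disintegrates mu1 B1 -> disintegrates mu2 B2 ->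
  disintegrates (a *: mu1 + b *: mu2) B.
Proof.
move=> h1 h2 S i mS; rewrite val_comb h1// h2//.
have [C hC] := solution_tv_bounded cstar K1 K2 B0 d0 T0.
have b1 := slice_val_bm (solution_wcts s1) (hC _ _ s1) i mS.
have b2 := slice_val_bm (solution_wcts s2) (hC _ _ s2) i mS.
rewrite -/(tint T _) -/(tint T _) -(tintZ a b1) -(tintZ b b2) -(tintD (bmZ a b1) (bmZ b b2)).
by apply: eq_tint => t _; rewrite val_comb.
Qed.

End convexity.

Lemma solution_set_comb (a b : R) x y : 0 <= a -> 0 <= b -> a + b = 1 ->
  solution_set (T := T) cstar K1 K2 B0 x -> solution_set (T := T) cstar K1 K2 B0 y ->
  solution_set (T := T) cstar K1 K2 B0 (a *: x + b *: y).
Proof.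
move=> a0 b0 ab1 [B1 dx s1] [B2 dy s2]; exists (fun s => a *: B1 s + b *: B2 s).
  exact: (@disintegrates_comb a b B1 B2 x.2 y.2 s1 s2 x.1 y.1 dx dy).
exact: (@solution_comb a b a0 b0 ab1 B1 B2 x.2 y.2 s1 s2).
Qed.

(** Each condition is a closed condition on pairings with continuous fields, apart
from the dissipation inequality, which is the matter of [dissipates_limit]. *)
Lemma solution_limit (Y : Type) (E : set_system Y) (UE : UltraFilter E)
    (B_ : Y -> R -> M) (mu_ P_ : Y -> MQ) :
  (\forall y \near E, disintegrates (mu_ y) (B_ y)) ->
  (\forall y \near E, sol (B_ y) (P_ y)) ->
  exists mu' P' B', [/\ disintegrates mu' B', sol B' P',
    mu_ y @[y --> E] --> mu' & P_ y @[y --> E] --> P'].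
Proof.
move=> disE solE; have FE : ProperFilter E := @ultra_proper _ _ UE.
have [C hC] := solution_tv_bounded cstar K1 K2 B0 d0 T0.
have wB_ : \forall y \near E, weakly_continuous T (B_ y).
  by apply: filterS solE => y; exact: solution_wcts.
have BC_ : \forall y \near E, tv_bounded T (B_ y) C.
  by apply: filterS solE => y; exact: hC.
(* all paths start at [B0], which is chosen as the limit at time 0; outside
   [0, T] the value is arbitrary *)
have /choice[B' hB'] : forall t, exists m : M, (t = 0 -> m = B0) /\ (0 <= t <= T ->
    forall phi, continuous phi -> vint (B_ y t) setT phi @[y --> E] --> vint m setT phi).
  move=> t; have [->|t_neq0] := eqVneq t 0.
    exists B0; split=> // _ phi cphi; apply: cvg_near_cst.
    by apply: filterS solE => y sy; rewrite (diss_init sy).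
  have [tT|ntT] := boolP (0 <= t <= T); last first.
    by exists B0; split=> // tT; rewrite tT in ntT.
  have [m hm] := alaoglu torus_baire (F := E) (m := fun y => B_ y t) (M := C)
    (filterS (fun y h => h t tT) BC_).
  exists m; split=> [t00|_ phi cphi]; first by rewrite t00 eqxx in t_neq0.
  by apply: hm; exact: continuous_subspaceT.
have Bcvg s phi : 0 <= s <= T -> continuous phi ->
    vint (B_ y s) setT phi @[y --> E] --> vint (B' s) setT phi.
  by move=> sT; apply: (hB' s).2.
have B'0 : B' 0 = B0 by apply: (hB' 0).1.
have Beq s phi (e : R) : 0 <= s <= T -> continuous phi -> 0 < e ->
  exists2 r : R, 0 < r & \forall y \near E, forall s', 0 <= s' <= T -> `|s - s'| < r ->
    `|vint (B_ y s) setT phi - vint (B_ y s') setT phi| <= e.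
  move=> sT cphi e0; have [r r0 hr] := solution_equicontinuous cstar K1 K2 B0 d0 T0 cphi e0.
  exists r => //; apply: filterS solE => y sy s' s'T ss'; exact: hr sy sT s'T ss'.
have wB' := path_limit_cts (FE := FE) T0' wB_ Beq Bcvg.
have BC' := path_limit_bounded (FE := FE) BC_ Bcvg.
have PK : \forall y \near E, tvr (P_ y) slab <= K2.
  by apply: filterS solE => y sy; rewrite -tv_leE; exact: diss_tv sy.
have [P' hP'] := alaoglu (slab_baire T) (F := E) (m := P_) (M := K2) PK.
have [mu' dmu'] := path_disintegration wB' BC'.
exists mu', P', B'; split=> //; last 2 first.
- apply/vm_cvgP => G cG; have bG := slab_bmv cG.
  rewrite (disintegrates_vint wB' BC' T0' dmu' bG).
  have TT : 0 <= T <= T by rewrite T0' lexx.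
  have := vint_slice_limit (FE := FE) wB_ BC_ Beq Bcvg cG TT.
  apply: cvg_trans; apply: near_eq_cvg.
  apply: filterS3 disE wB_ BC_ => y dy wy yC.
  by rewrite (disintegrates_vint wy yC T0' dy bG).
- by apply/vm_cvgP => G cG; exact: hP'.
split=> //.
- exact/weakly_continuousP.
- move=> t tT phi sphi; have tT' : 0 <= t <= T by move: tT; rewrite in_itv.
  have cg := grad_continuous (sphi 1).
  apply: (cvg_unique _ (Bcvg t _ tT' cg)) => //; apply: cvg_near_cst.
  by apply: filterS solE => y sy; rewrite (diss_div_free sy).
- move=> t tT phi Cphi; have tT' : 0 <= t <= T by move: tT; rewrite in_itv.
  have cphi : continuous phi by case: Cphi.
  apply: (cvgr_to_le (cvg_norm (Bcvg t _ tT' cphi))).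
  by apply: filterS solE => y sy; exact: (diss_bound sy).
- move=> t0 t1 t0T t1T phi Cphi.
  have cphi : continuous phi by case: Cphi.
  have bphi := continuous_bmv cphi.
  have t0T' : 0 <= t0 <= T by move: t0T; rewrite in_itv.
  have t1T' : 0 <= t1 <= T by move: t1T; rewrite in_itv.
  rewrite vint_mB//.
  apply: (cvgr_to_le (cvg_norm (cvgB (Bcvg t1 _ t1T' cphi) (Bcvg t0 _ t0T' cphi)))).
  apply: filterS solE => y sy.
  by have := diss_holder sy t0T t1T Cphi; rewrite vint_mB.
- rewrite tv_leE; apply: tvr_le_polar => F cF F1.
  apply: (cvgr_to_le (hP' F cF)); apply: filterS PK => y; apply: le_trans.
  exact: vint_le_tvr.
- apply/(dissipationP _ B'0) => b v A r adm.
  have [tbv CA [l l0 [Al lr]]] := adm.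
  have sl := slack_ge0 tbv CA Al lr.
  apply: (dissipates_limit (FE := FE) (@decay_cts R d T r) (mass_weight_cts tbv CA) (end_field_cts tbv)
    (source_field_cts tbv CA) (momentum_field_cts tbv CA) _ _ T0' wB_ BC_ Beq Bcvg PK hP').
  + by move=> q _; exact: decay_ge0.
  + by move=> q sq; rewrite mulr_ge0 ?decay_ge0// sl.
  apply: filterS solE => y sy.
  exact: (iffLR (dissipationP _ (diss_init sy)) (diss_dissipation sy) b v A r adm).
Qed.

Lemma solution_set_limit (Y : Type) (E : set_system Y) : UltraFilter E ->
  forall mu_ P_ : Y -> MQ,
  (\forall y \near E, solution_set (T := T) cstar K1 K2 B0 (mu_ y, P_ y)) ->
  exists mu' P', [/\ solution_set (T := T) cstar K1 K2 B0 (mu', P'),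
    mu_ y @[y --> E] --> mu' & P_ y @[y --> E] --> P'].
Proof.
move=> UE mu_ P_ ES; have FE : ProperFilter E := @ultra_proper _ _ UE.
have /choice[B_ hB_] : forall y, exists B : R -> M,
    solution_set (T := T) cstar K1 K2 B0 (mu_ y, P_ y) -> disintegrates (mu_ y) B /\ sol B (P_ y).
  move=> y; have [[B dB sB]|ny] := pselect (solution_set (T := T) cstar K1 K2 B0 (mu_ y, P_ y)).
    by exists B.
  by exists (fun=> B0).
have dE : \forall y \near E, disintegrates (mu_ y) (B_ y) by apply: filterS ES => y /hB_[].
have sE : \forall y \near E, sol (B_ y) (P_ y) by apply: filterS ES => y /hB_[].
have [mu' [P' [B' [dB' sB' cmu cP]]]] := solution_limit UE dE sE.
by exists mu', P'; split=> //; exists B'.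
Qed.

Lemma solution_set_compact : compact (solution_set (T := T) cstar K1 K2 B0).
Proof. apply: compact_prod_ultra; exact: solution_set_limit. Qed.

End solutions.

Theorem theorem0p2 (R : realType) (d : nat) (T : R)
    (K1 K2 : R -> R -> R)
    (cstar : (R * torus R d -> 'rV[R]_d) -> (R * torus R d -> 'rV[R]_d) -> R)
    (B0 : @vmeasure R d _ (torus R d) setT) :
  (0 < d)%N -> 0 < T -> cstar_spec T cstar ->
  let mass0 := fine (tv (val B0) setT) in
  let S := solution_set (T := T) cstar (K1 T mass0) (K2 T mass0) B0 in
  S !=set0 -> convex_set S /\ compact S.
Proof.
move=> d0 T0 _ mass0 S _; split.
  move=> x y l; rewrite !inE => xS yS.
  have := @solution_set_comb R d T cstar (K1 T mass0) (K2 T mass0) B0 d0 T0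
    l%:num (1 - l%:num) x y.
  by apply => //; rewrite ?subr_ge0// addrC subrK.
exact: (@solution_set_compact R d T cstar (K1 T mass0) (K2 T mass0) B0 d0 T0).
Qed.
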